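(* There exists a conformal minimal surface $x$ in $\mathbb{R}^n$ (for suitable $n$), defined on the complex plane (punctured at $0,1$) by $$x_z=\frac{\mathbf u_3}{z^3}+\frac{\mathbf u_2}{z^2}+\frac{\mathbf v_3}{(z-1)^3}+\frac{\mathbf v_2}{(z-1)^2}+\mathbf w_2+\mathbf w_3z,\qquad \mathbf u_j,\mathbf v_j,\mathbf w_j\in\mathbb{C}^n,$$ which is super-conformal (1-isotropic) but not 2-isotropic, i.e. $x_{zz}\cdot x_{zz}\equiv0$ and $x_{zzz}\cdot x_{zzz}\not\equiv0$. Moreover: (1) All such examples lie in a unique associated family of minimal surfaces in an affine subspace $\mathbb{R}^6$ (up to rigid motions and dilations). (2) Such an $x$ has an adjoint surface $\hat x$ which extends to be an immersed Willmore 2-sphere in $S^6$, and $\hat x$ is not super-conformal.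
   Context: The dot product is the Euclidean inner product of $\mathbb{R}^n$ extended complex bilinearly to $\mathbb{C}^n$. A conformal minimal surface satisfies $x_z\cdot x_z=0$, $x_{z\bar z}=0$. The associated family of $x$ consists of the minimal surfaces obtained by replacing $x_z$ by $e^{i\theta}x_z$, $\theta\in\mathbb{R}$. $\mathbb{R}^6\subset S^6=\mathbb{R}^6\cup\{\infty\}$ by inverse stereographic projection; the 2-sphere is $\mathbb{C}\cup\{\infty\}$. Let $\mathbb{R}^{n+2}_1$ be $\mathbb{R}^{n+2}$ with $\langle Y,Y\rangle=\sum_{i=1}^{n+1}Y_i^2-Y_{n+2}^2$, extended complex bilinearly, and identify $S^n$ with the projectivized light cone by $y\leftrightarrow[(y,1)]$. For a conformal immersion $y:M\to S^n$ with local coordinate $z$, the canonical lift $Y$ is the (forward) light-cone-valued lift, $y=[Y]$, with $\langle Y_z,Y_{\bar z}\rangle=\frac12$. Let $V=\mathrm{span}\{Y,\mathrm{Re}\,Y_z,\mathrm{Im}\,Y_z,Y_{z\bar z}\}$, $V^\perp$ its orthogonal complement with normal connection $D$, and $N\in V$ the unique section with $\langle N,N\rangle=0$, $\langle N,Y\rangle=-1$, $\langle N,Y_z\rangle=0$. The equation $Y_{zz}=-\frac s2Y+\kappa$ defines the complex function $s$ and $\kappa\in\Gamma(V^\perp\otimes\mathbb{C})$. $y$ is Willmore if $D_{\bar z}D_{\bar z}\kappa+\frac{\bar s}2\kappa=0$ and super-conformal if $\langle\kappa,\kappa\rangle\equiv0$ (for a minimal surface $x$ in $\mathbb{R}^n$: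 $x_{zz}\cdot x_{zz}\equiv0$). An adjoint surface (adjoint transform) of a Willmore immersion $y:M\to S^n$ is a smooth map $\hat y:M\to S^n$ such that on an open dense subset, with respect to local coordinates, $\hat y=[\hat Y]$ with $\hat Y=\frac12|\mu|^2Y+\bar\mu Y_z+\mu Y_{\bar z}+N$ for a smooth local complex function $\mu$ satisfying $\mu_z-\frac12\mu^2-s=0$ and $\langle\eta,\eta\rangle=0$, where $\eta=D_{\bar z}\kappa+\frac{\bar\mu}2\kappa$. An adjoint surface of a minimal surface $x$ means one of its image in $S^n$.
   Formalization: In (1) ''rigid motions'' means complex orthogonal maps acting on x_z (with real ones uniqueness and lying in an affine R^6 fail); in (2) the sphere lies in S^n for a general example in R^n, and in S^6 when x lies in an affine R^6. *)

(* Defs.v *)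
From HB Require Import structures.
From mathcomp Require Import all_boot all_order all_algebra.
From mathcomp Require Import complex.
From mathcomp Require Import all_classical all_reals all_analysis.

Set Implicit Arguments.
Unset Strict Implicit.
Unset Printing Implicit Defensive.

Import Order.TTheory GRing.Theory Num.Theory.
Import numFieldNormedType.Exports.

Local Open Scope classical_set_scope.
Local Open Scope complex_scope.
Local Open Scope ring_scope.

Section Calculus.
Variable R : realType.

(* Real directional derivative of g at z along v.  R[i] is a normed module only
   over itself, so the library's derivative would be the complex one; here the
   real and imaginary parts are differentiated along t |-> z + t v, t real. *)
Definition pd (v : R[i]) (g : R[i] -> R[i]) (z : R[i]) : R[i] :=
  derive1 (fun t : R => complex.Re (g (z + t%:C * v))) 0 +i*
  derive1 (fun t : R => complex.Im (g (z + t%:C * v))) 0.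

Definition has_pd (v : R[i]) (g : R[i] -> R[i]) (z : R[i]) : Prop :=
  derivable (fun t : R => complex.Re (g (z + t%:C * v))) 0 1 /\
  derivable (fun t : R => complex.Im (g (z + t%:C * v))) 0 1.

Definition ddz (g : R[i] -> R[i]) (z : R[i]) : R[i] :=
  2^-1 * (pd 1 g z - 'i * pd 'i g z).
Definition ddzb (g : R[i] -> R[i]) (z : R[i]) : R[i] :=
  2^-1 * (pd 1 g z + 'i * pd 'i g z).

Fixpoint Ck (k : nat) (U : set R[i]^o) (g : R[i] -> R[i]) : Prop :=
  (forall z, U z -> {for z, continuous (g : R[i]^o -> R[i]^o)}) /\
  match k with
  | 0%N => True
  | k'.+1 =>
      (forall z, U z -> has_pd 1 g z /\ has_pd 'i g z) /\
      Ck k' U (pd 1 g) /\ Ck k' U (pd 'i g)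
  end.

(* Only used for open U. *)
Definition smooth (U : set R[i]^o) (g : R[i] -> R[i]) : Prop :=
  forall k, Ck k U g.

Definition vsmooth (m : nat) (U : set R[i]^o) (F : R[i] -> 'rV[R[i]]_m) : Prop :=
  forall j, smooth U (fun z => F z 0 j).

Definition vz (m : nat) (F : R[i] -> 'rV[R[i]]_m) (z : R[i]) : 'rV[R[i]]_m :=
  \row_j ddz (fun w => F w 0 j) z.
Definition vzb (m : nat) (F : R[i] -> 'rV[R[i]]_m) (z : R[i]) : 'rV[R[i]]_m :=
  \row_j ddzb (fun w => F w 0 j) z.

Definition cplx (m n : nat) (u : 'M[R]_(m, n)) : 'M[R[i]]_(m, n) :=
  map_mx (real_complex R) u.
Definition reV (m : nat) (u : 'rV[R[i]]_m) : 'rV[R[i]]_m :=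
  map_mx (fun c => (complex.Re c)%:C) u.
Definition imV (m : nat) (u : 'rV[R[i]]_m) : 'rV[R[i]]_m :=
  map_mx (fun c => (complex.Im c)%:C) u.

Definition cmap (m : nat) (f : R[i] -> 'rV[R]_m) : R[i] -> 'rV[R[i]]_m :=
  fun z => cplx (f z).

(* Euclidean inner product, extended complex bilinearly (no conjugation). *)
Definition dot (K : comNzRingType) (m : nat) (a b : 'rV[K]_m) : K :=
  (a *m b^T) 0 0.

End Calculus.

Section MinimalSurfaces.
Variable R : realType.

(* Conformal immersions, so that x_z never vanishes. *)
Definition minimal_surface (n : nat) (U : set R[i]^o) (x : R[i] -> 'rV[R]_n) :
    Prop :=
  vsmooth U (cmap x) /\
  forall z, U z ->
    [/\ dot (vz (cmap x) z) (vz (cmap x) z) = 0,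
        dot (vz (cmap x) z) (vzb (cmap x) z) <> 0 &
        vzb (vz (cmap x)) z = 0].

Definition minimal_superconformal (n : nat) (U : set R[i]^o)
    (x : R[i] -> 'rV[R]_n) : Prop :=
  forall z, U z -> dot (vz (vz (cmap x)) z) (vz (vz (cmap x)) z) = 0.

Definition vanishing_third (n : nat) (U : set R[i]^o)
    (x : R[i] -> 'rV[R]_n) : Prop :=
  forall z, U z ->
    dot (vz (vz (vz (cmap x))) z) (vz (vz (vz (cmap x))) z) = 0.

(* The members of the associated family of x. *)
Definition associated (n : nat) (U : set R[i]^o) (x x' : R[i] -> 'rV[R]_n) :
    Prop :=
  vsmooth U (cmap x') /\
  exists theta : R, forall z, U z ->
    vz (cmap x') z = (cos theta +i* sin theta) *: vz (cmap x) z.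

(* x' is obtained from x by a dilation and a rigid motion, where motions are those
   of the complex bilinear dot product: T maps C^m isometrically into C^n and acts
   on x_z (which does not see translations).  If T is real this is a Euclidean
   motion of R^m onto an affine m-space of R^n.  Non-real T (Goursat transforms)
   have to be allowed: they send minimal surfaces to minimal surfaces and keep
   all dot products of z-derivatives of x, hence preserve all the conditions of
   special_surface below, but are not Euclidean motions. *)
Definition congruent (m n : nat) (U : set R[i]^o) (x : R[i] -> 'rV[R]_m)
    (x' : R[i] -> 'rV[R]_n) : Prop :=
  exists (r : R) (T : 'M[R[i]]_(m, n)),
    [/\ 0 < r, T *m T^T = 1%:M &
        forall z, U z -> vz (cmap x') z = r%:C *: (vz (cmap x) z *m T)].

Definition punctured : set R[i]^o := [set z | z != 0 /\ z != 1].

Definition has_form (n : nat) (x : R[i] -> 'rV[R]_n) : Prop :=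
  exists u3 u2 v3 v2 w2 w3 : 'rV[R[i]]_n, forall z : R[i], punctured z ->
    vz (cmap x) z = (z ^- 3) *: u3 + (z ^- 2) *: u2
      + ((z - 1) ^- 3) *: v3 + ((z - 1) ^- 2) *: v2 + w2 + z *: w3.

Definition special_surface (n : nat) (x : R[i] -> 'rV[R]_n) : Prop :=
  [/\ minimal_surface punctured x,
      has_form x,
      minimal_superconformal punctured x &
      ~ vanishing_third punctured x].

End MinimalSurfaces.

Section ConformalSurfaces.
Variable R : realType.

(* The unit sphere S^n sits in R^(n+1); the Lorentz space R^(n+2)_1 is written
   'rV_(n + 1 + 1), the last coordinate being the negative one. *)

Definition lorentz_mx (n : nat) : 'M[R[i]]_(n + 1 + 1) :=
  block_mx 1%:M 0 0 (- 1%:M).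

Definition lorentz (n : nat) (a b : 'rV[R[i]]_(n + 1 + 1)) : R[i] :=
  (a *m lorentz_mx n *m b^T) 0 0.

Definition lperp (n : nat) (V : 'M[R[i]]_(n + 1 + 1)) : 'M[R[i]]_(n + 1 + 1) :=
  kermx (lorentz_mx n *m V^T).

Definition stereo (n : nat) (x : 'rV[R]_n) : 'rV[R]_(n + 1) :=
  (dot x x + 1)^-1 *: row_mx (2 *: x) (dot x x - 1)%:M.

(* Surfaces in S^n are given in a complex coordinate z ranging over an open
   subset U of C. *)

Definition smooth_in_sphere (n : nat) (U : set R[i]^o)
    (y : R[i] -> 'rV[R]_(n + 1)) : Prop :=
  vsmooth U (cmap y) /\ forall z, U z -> dot (y z) (y z) = 1.

Definition conformal_immersion (n : nat) (U : set R[i]^o)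
    (y : R[i] -> 'rV[R]_(n + 1)) : Prop :=
  smooth_in_sphere U y /\
  forall z, U z ->
    dot (vz (cmap y) z) (vz (cmap y) z) = 0 /\
    dot (vz (cmap y) z) (vzb (cmap y) z) <> 0.

Definition canonical_lift (n : nat) (U : set R[i]^o)
    (y : R[i] -> 'rV[R]_(n + 1)) (Y : R[i] -> 'rV[R]_(n + 1 + 1)) : Prop :=
  vsmooth U (cmap Y) /\
  forall z, U z ->
    (exists r : R, 0 < r /\ Y z = r *: row_mx (y z) 1%:M) /\
    lorentz (vz (cmap Y) z) (vzb (cmap Y) z) = 2^-1.

(* The complexification of V, as a row space. *)
Definition Vspace (n : nat) (Y : R[i] -> 'rV[R]_(n + 1 + 1)) (z : R[i]) :
    'M[R[i]]_(n + 1 + 1) :=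
  (cmap Y z + reV (vz (cmap Y) z) + imV (vz (cmap Y) z)
     + vzb (vz (cmap Y)) z)%MS.

(* The normal connection: derivative along zbar, projected to the complement of
   V along V. *)
Definition Dzb (n : nat) (Y : R[i] -> 'rV[R]_(n + 1 + 1))
    (xi : R[i] -> 'rV[R[i]]_(n + 1 + 1)) (z : R[i]) : 'rV[R[i]]_(n + 1 + 1) :=
  vzb xi z *m proj_mx (lperp (Vspace Y z)) (Vspace Y z).

(* All of Y, N, s, kappa are uniquely determined on U by y. *)
Definition invariants (n : nat) (U : set R[i]^o) (y : R[i] -> 'rV[R]_(n + 1))
    (Y N : R[i] -> 'rV[R]_(n + 1 + 1)) (s : R[i] -> R[i])
    (kappa : R[i] -> 'rV[R[i]]_(n + 1 + 1)) : Prop :=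
  canonical_lift U y Y /\
  forall z, U z ->
    [/\ (cmap N z <= Vspace Y z)%MS,
        [/\ lorentz (cmap N z) (cmap N z) = 0,
            lorentz (cmap N z) (cmap Y z) = - 1 &
            lorentz (cmap N z) (vz (cmap Y) z) = 0],
        (kappa z <= lperp (Vspace Y z))%MS &
        vz (vz (cmap Y)) z = - (s z / 2) *: cmap Y z + kappa z].

Definition willmore (n : nat) (U : set R[i]^o) (y : R[i] -> 'rV[R]_(n + 1)) :
    Prop :=
  conformal_immersion U y /\
  exists Y N s kappa, invariants U y Y N s kappa /\
    forall z, U z ->
      Dzb Y (Dzb Y kappa) z + ((s z)^* / 2) *: kappa z = 0.

Definition superconformal (n : nat) (U : set R[i]^o)
    (y : R[i] -> 'rV[R]_(n + 1)) : Prop :=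
  exists Y N s kappa, invariants U y Y N s kappa /\
    forall z, U z -> lorentz (kappa z) (kappa z) = 0.

(* M is a domain of C and its coordinate z is used throughout: the equations
   for mu are invariant under holomorphic changes of coordinate, and mu is
   determined by yh, so local choices of mu patch together. *)
Definition adjoint_surface (n : nat) (M : set R[i]^o)
    (y yh : R[i] -> 'rV[R]_(n + 1)) : Prop :=
  [/\ willmore M y,
      smooth_in_sphere M yh &
      exists U : set R[i]^o,
        [/\ open U, U `<=` M, M `<=` closure U &
          exists Y N s kappa, invariants U y Y N s kappa /\
          exists mu : R[i] -> R[i], smooth U mu /\
          forall z, U z ->
            [/\ exists c : R, c != 0 /\
                  c%:C *: cplx (row_mx (yh z) 1%:M) =
                    (2^-1 * `|mu z| ^+ 2) *: cmap Y z
                    + (mu z)^* *: vz (cmap Y) z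
                    + mu z *: vzb (cmap Y) z + cmap N z,
                ddz mu z - 2^-1 * mu z ^+ 2 - s z = 0 &
                let eta := Dzb Y kappa z + ((mu z)^* / 2) *: kappa z in
                lorentz eta eta = 0]]].

(* Maps from the 2-sphere C \cup {oo}: the point oo is None, and the two
   charts have coordinates z and 1/z. *)
Definition chart0 (n : nat) (yh : option R[i] -> 'rV[R]_(n + 1)) (z : R[i]) :=
  yh (Some z).
Definition chart1 (n : nat) (yh : option R[i] -> 'rV[R]_(n + 1)) (w : R[i]) :=
  if w == 0 then yh None else yh (Some w^-1).

Definition willmore_sphere (n : nat) (yh : option R[i] -> 'rV[R]_(n + 1)) :
    Prop :=
  willmore setT (chart0 yh) /\ willmore setT (chart1 yh).

(* x has an adjoint surface xh in S^n = R^n \cup {oo} which extends to an immersed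
   Willmore 2-sphere and is not super-conformal. *)
Definition has_adjoint_sphere (n : nat) (x : R[i] -> 'rV[R]_n) : Prop :=
  exists xh : R[i] -> 'rV[R]_(n + 1),
    [/\ adjoint_surface (@punctured R) (fun z => stereo (x z)) xh,
        exists yh : option R[i] -> 'rV[R]_(n + 1),
          (forall z, @punctured R z -> yh (Some z) = xh z) /\
          willmore_sphere yh &
        ~ superconformal (@punctured R) xh].

(* x takes its values in the affine m-space p + R^m B of R^n, with Euclidean
   coordinates x'. *)
Definition affine_coords (m n : nat) (U : set R[i]^o) (x : R[i] -> 'rV[R]_n)
    (x' : R[i] -> 'rV[R]_m) : Prop :=
  exists (p : 'rV[R]_n) (B : 'M[R]_(m, n)),
    B *m B^T = 1%:M /\ forall z, U z -> x z = p + x' z *m B.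

End ConformalSurfaces.

(* Main.v *)
Require Import Defs.
From HB Require Import structures.
From mathcomp Require Import all_boot all_order all_algebra.
From mathcomp Require Import complex.
From mathcomp Require Import all_classical all_reals all_analysis.
From mathcomp Require Import ring lra.

(* Write phi = x_z and let F be a primitive of phi.  The equations phi.phi = phi'.phi' = 0 determine
   the Gram matrix of the six coefficient vectors up to a factor l, and l is nonzero because
   phi''.phi'' = - 180 l / (z (z - 1))^4; as the Gram matrix is then nondegenerate, any two solutions
   differ by a complex orthogonal map and the factor, whose argument is the angle of the associated
   family.

   Adjoint surfaces are hatx = b + 2 Re F_perp, with F_perp the component of F orthogonal to phi for the
   Hermitian product.  In a moving frame the second fundamental form of V along the light cone lift of
   hatx splits as C (x) Qb + nu (x) T, and the projected zbar-derivative of this tensor vanishes,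
   which is the Willmore equation.  With delta = z (z - 1), the vectors r = delta (F + delta delta' phi / 2)
   and pi = delta^3 phi are polynomial with pi <> 0, and r.r, r.pi are divisible by delta: so |delta|^2
   times the lift of hatx extends smoothly over the poles 0 and 1, and the equation extends by density.
   The family is symmetric under z |-> 1/z, which takes care of the point at infinity.  Finally
   hatx is immersed at z unless F is orthogonal to phi and phi'; replacing F by F + t alpha, such a
   point bounds t^2 by a continuous function on a compact square, hence none exists for large t. *)

Set Implicit Arguments.
Unset Strict Implicit.
Unset Printing Implicit Defensive.

Import Order.TTheory GRing.Theory Num.Theory.
Import numFieldNormedType.Exports.

Local Open Scope classical_set_scope.
Local Open Scope complex_scope.
Local Open Scope ring_scope.

(** * Smooth functions and Wirtinger derivatives *)

Section DirectionalDerivatives.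
Variable R : realType.
Implicit Types (v z d : R[i]) (f g : R[i] -> R[i]) (U : set R[i]^o).

(** The surface $x$ fixes its primitive $F$ only up to a constant, and each constant gives an
    adjoint surface; this freedom is what makes immersedness reachable. Write $F_\perp=F+a\phi$ and
    $\beta=(\log|\phi|^2)_z$. A minimal surface has $s=\beta_z-\frac12\beta^2$ and $D_{\bar
    z}\kappa=-\frac{\bar\beta}2\kappa$, so that $a_z=-1-a\beta$ says exactly that $\mu=\beta+2/a$
    solves the Riccati equation, and $\eta=\kappa/\bar a$ is null because $\kappa$ is. The same
    equation prevents $a$ from vanishing on an open set, whence the dense domain of $\mu$. That
    $\hat x$ is not super-conformal comes from $\hat x_{zz}\cdot\hat x_{zz}=a^2\,\phi''\cdot\phi''$.
    Lifts to the light cone are unavoidable since $\hat x$ tends to infinity at the poles. There $F$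
    has double and $\phi$ triple poles; the multiple of $\phi$ in $r$, invisible to $F_\perp$,
    lowers the poles of $F$ to simple ones. *)

Definition is_pd v g z d : Prop :=
  is_derive (0 : R) (1 : R) (fun t : R => complex.Re (g (z + t%:C * v))) (complex.Re d) /\
  is_derive (0 : R) (1 : R) (fun t : R => complex.Im (g (z + t%:C * v))) (complex.Im d).

Lemma is_pdP v g z d : is_pd v g z d <-> has_pd v g z /\ pd v g z = d.
Proof.
split=> [[dr di]|[[dr di] <-]].
  split; first by split; apply: ex_derive.
  rewrite /pd !derive1E (@derive_val _ _ _ _ _ _ _ dr) (@derive_val _ _ _ _ _ _ _ di).
  by case: d {dr di}.
by split; rewrite /pd /= derive1E; apply: derivableP.
Qed.

Lemma has_pdP v g z : has_pd v g z -> is_pd v g z (pd v g z).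
Proof. by move=> h; apply/is_pdP. Qed.

Lemma is_pd_cst v c z : is_pd v (fun=> c) z 0.
Proof. by split; apply: is_derive_cst. Qed.

Lemma is_pd_eq v g z d d' : is_pd v g z d -> d = d' -> is_pd v g z d'.
Proof. by move=> h <-. Qed.

Lemma is_pd_id v z : is_pd v id z v.
Proof.
case: z v => [x y] [v w]; split => /=.
  under eq_fun do rewrite mul0r subr0.
  apply: (is_derive_eq (is_deriveD (is_derive_cst x (0:R) (1:R))
    (is_deriveM (is_derive_id (0:R) (1:R)) (is_derive_cst v (0:R) (1:R))))).
  by rewrite scaler0 !add0r [_ *: _]mulr1.
under eq_fun do rewrite mul0r addr0.
apply: (is_derive_eq (is_deriveD (is_derive_cst y (0:R) (1:R))
  (is_deriveM (is_derive_id (0:R) (1:R)) (is_derive_cst w (0:R) (1:R))))).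
by rewrite scaler0 !add0r [_ *: _]mulr1.
Qed.

Lemma is_pdD v f g z d e :
  is_pd v f z d -> is_pd v g z e -> is_pd v (fun w => f w + g w) z (d + e).
Proof.
have ReD (x y : R[i]) : complex.Re (x + y) = complex.Re x + complex.Re y by case: x y => ? ? [].
have ImD (x y : R[i]) : complex.Im (x + y) = complex.Im x + complex.Im y by case: x y => ? ? [].
move=> [fr fi] [gr gi]; split.
  by under eq_fun do rewrite ReD; rewrite ReD; apply: is_deriveD.
by under eq_fun do rewrite ImD; rewrite ImD; apply: is_deriveD.
Qed.

Lemma is_pdN v f z d : is_pd v f z d -> is_pd v (fun w => - f w) z (- d).
Proof.
have ReN (x : R[i]) : complex.Re (- x) = - complex.Re x by case: x.
have ImN (x : R[i]) : complex.Im (- x) = - complex.Im x by case: x.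
move=> [fr fi]; split.
  by under eq_fun do rewrite ReN; rewrite ReN; apply: is_deriveN.
by under eq_fun do rewrite ImN; rewrite ImN; apply: is_deriveN.
Qed.

Lemma is_pd_conj v f z d : is_pd v f z d -> is_pd v (fun w => (f w)^*) z d^*.
Proof.
have ReJ (x : R[i]) : complex.Re x^* = complex.Re x by case: x.
have ImJ (x : R[i]) : complex.Im x^* = - complex.Im x by case: x.
move=> [fr fi]; split.
  by under eq_fun do rewrite ReJ; rewrite ReJ.
by under eq_fun do rewrite ImJ; rewrite ImJ; apply: is_deriveN.
Qed.

Lemma ReM (x y : R[i]) :
  complex.Re (x * y) = complex.Re x * complex.Re y - complex.Im x * complex.Im y.
Proof. by case: x y => ? ? []. Qed.

Lemma ImM (x y : R[i]) :
  complex.Im (x * y) = complex.Re x * complex.Im y + complex.Im x * complex.Re y.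
Proof. by case: x y => ? ? []. Qed.

Lemma is_pdM v f g z d e : is_pd v f z d -> is_pd v g z e ->
  is_pd v (fun w => f w * g w) z (d * g z + f z * e).
Proof.
move=> [fr fi] [gr gi]; have z0 : z + 0%:C * v = z by rewrite mul0r addr0.
split.
  under eq_fun do rewrite ReM.
  apply: (is_derive_eq (is_deriveB (is_deriveM fr gr) (is_deriveM fi gi))).
  rewrite /= z0; case: d e (f z) (g z) {fr fi gr gi} => ? ? [? ?] [? ?] [? ?] /=.
  by rewrite /GRing.scale /=; ring.
under eq_fun do rewrite ImM.
apply: (is_derive_eq (is_deriveD (is_deriveM fr gi) (is_deriveM fi gr))).
rewrite /= z0; case: d e (f z) (g z) {fr fi gr gi} => ? ? [? ?] [? ?] [? ?] /=.
by rewrite /GRing.scale /=; ring.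
Qed.

Lemma normsq_eq0 (x y : R) : x ^+ 2 + y ^+ 2 = 0 -> x = 0 /\ y = 0.
Proof.
move=> /eqP; rewrite paddr_eq0 ?sqr_ge0// !sqrf_eq0.
by case/andP => /eqP -> /eqP ->.
Qed.

Lemma is_pdV v f z d : f z != 0 -> is_pd v f z d ->
  is_pd v (fun w => (f w)^-1) z (- (d * ((f z)^-1 * (f z)^-1))).
Proof.
move=> fz0 [fr fi]; have z0 : z + 0%:C * v = z by rewrite mul0r addr0.
(* [q] is $|f|^2$ along the line: the inverse is treated as $\bar f/|f|^2$ in real coordinates. *)
pose q (t : R) := complex.Re (f (z + t%:C * v)) ^+ 2 + complex.Im (f (z + t%:C * v)) ^+ 2.
have q0 : q 0 != 0.
  rewrite /q z0; apply: contra fz0; case: (f z) => x y /= /eqP /normsq_eq0 [-> ->].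
  by rewrite eq_complex /= eqxx.
pose dq := 2 * complex.Re (f z) * complex.Re d + 2 * complex.Im (f z) * complex.Im d.
have isq : is_derive (0:R) (1:R) q dq.
  apply: (is_derive_eq (is_deriveD (is_deriveM fr fr) (is_deriveM fi fi))).
  by rewrite /dq /= z0 /GRing.scale /=; ring.
have isqV := is_deriveV q0 isq.
have ReV (x : R[i]) : complex.Re x^-1 = complex.Re x * (complex.Re x ^+ 2 + complex.Im x ^+ 2)^-1 by case: x.
have ImV (x : R[i]) : complex.Im x^-1 = - (complex.Im x * (complex.Re x ^+ 2 + complex.Im x ^+ 2)^-1) by case: x.
split.
  under eq_fun do rewrite ReV.
  apply: (is_derive_eq (is_deriveM fr isqV)).
  move: q0; rewrite /dq /q /= z0; case: d (f z) {isqV isq dq q fr fi fz0} => ? ? [x y] /= q0.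
  by rewrite /GRing.scale /=; field.
under eq_fun do rewrite ImV.
apply: (is_derive_eq (is_deriveN (is_deriveM fi isqV))).
move: q0; rewrite /dq /q /= z0; case: d (f z) {isqV isq dq q fr fi fz0} => ? ? [x y] /= q0.
by rewrite /GRing.scale /=; field.
Qed.

(** Meant for positive real values: it supplies the conformal factor of the canonical lift as a
    smooth function into [R[i]]. *)
Definition csqrt_real (c : R[i]) : R[i] := (Num.sqrt (complex.Re c))%:C.

Lemma is_pd_sqrt v f z d : 0 < complex.Re (f z) -> complex.Im d = 0 -> is_pd v f z d ->
  is_pd v (fun w => csqrt_real (f w)) z (d * (2^-1 * (csqrt_real (f z))^-1)).
Proof.
move=> fz0 d0 [fr fi]; have z0 : z + 0%:C * v = z by rewrite mul0r addr0.
have s0 : Num.sqrt (complex.Re (f z)) != 0 by rewrite sqrtr_eq0 -ltNge.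
have isS : is_derive (complex.Re (f (z + 0%:C * v))) (1:R) (@Num.sqrt R)
     (2 * Num.sqrt (complex.Re (f (z + 0%:C * v))))^-1.
  by apply: is_derive1_sqrt; rewrite z0.
have E : d * (2^-1 * (csqrt_real (f z))^-1) =
    ((2 * Num.sqrt (complex.Re (f z)))^-1 * complex.Re d)%:C.
  rewrite /csqrt_real; have -> : d = (complex.Re d)%:C by case: d d0 {fr fi} => ? ? /= ->.
  by rewrite !(rmorphM, fmorphV) rmorph_nat /= invfM mulrC.
rewrite E; split => /=; last exact: is_derive_cst.
rewrite -{2}z0; exact: (is_derive1_comp isS fr).
Qed.

End DirectionalDerivatives.

(** * Closure properties of smooth functions *)

Section Smooth.
Variable R : realType.
Implicit Types (v z : R[i]) (f g : R[i] -> R[i]) (U : set R[i]^o).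

Definition cts f z := {for z, continuous (f : R[i]^o -> R[i]^o)}.

#[local] Instance nbhs_complex_filter z : ProperFilter (nbhs (z : R[i]^o)) := nbhs_pfilter _.

Lemma cts_cst c z : cts (fun=> c) z.
Proof. by apply: (@near_cst_continuous R[i]^o R[i]^o c); near=> y. Unshelve. all: by end_near. Qed.

Lemma cts_id z : cts id z.
Proof. exact: cvg_id. Qed.

Lemma ctsD f g z : cts f z -> cts g z -> cts (fun w => f w + g w) z.
Proof. by move=> cf cg; exact: (@continuousD R[i] R[i]^o R[i]^o f g z cf cg). Qed.

Lemma ctsN f z : cts f z -> cts (fun w => - f w) z.
Proof. by move=> cf; exact: (@continuousN R[i] R[i]^o R[i]^o f z cf). Qed.

Lemma ctsM f g z : cts f z -> cts g z -> cts (fun w => f w * g w) z.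
Proof. by move=> cf cg; exact: (@continuousM R[i] R[i]^o f g z cf cg). Qed.

Lemma ctsV f z : f z != 0 -> cts f z -> cts (fun w => (f w)^-1) z.
Proof. by move=> f0 cf; exact: (@continuousV R[i] R[i]^o f z f0 cf). Qed.

Lemma nbhs_distC z (e : R[i]) : 0 < e -> \forall w \near (z : R[i]^o), `|z - w| < e.
Proof.
move=> e0; have : \forall w \near (z : R[i]^o), ball (z : R[i]^o) e w by apply: nbhsx_ballx.
by apply: filterS => w; rewrite -ball_normE.
Qed.

Lemma cts_conj f z : cts f z -> cts (fun w => (f w)^*) z.
Proof.
move=> cf; apply: (@continuous_comp R[i]^o R[i]^o R[i]^o f (fun w => w^* ) z cf).
apply/cvgrPdist_lt => e e0; apply: filterS (nbhs_distC (f z) e0) => w.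
by rewrite -rmorphB norm_conjC.
Qed.

Lemma Re_continuous z : ((fun w : R[i]^o => complex.Re w) : R[i]^o -> R) x @[x --> (z : R[i]^o)] --> complex.Re z.
Proof.
apply/cvgrPdist_lt => e e0.
have e0' : 0 < e%:C by rewrite ltcR.
apply: filterS (nbhs_distC z e0') => w h.
have ReB (x y : R[i]) : complex.Re x - complex.Re y = complex.Re (x - y) by case: x y => ? ? [].
by rewrite ReB -ltcR; apply: le_lt_trans (normc_ge_Re _) _.
Qed.

Lemma real_complex_continuous (x : R) : (fun w : R => w%:C : R[i]^o) y @[y --> x] --> (x%:C : R[i]^o).
Proof.
apply/cvgrPdist_lt => e e0.
have re : e = (complex.Re e)%:C.
  by move: e0; case: e => a b; rewrite ltcE /= => /andP[/eqP -> _].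
have e0' : 0 < complex.Re e by rewrite re ltcR in e0.
have : \forall w \near x, `|x - w| < complex.Re e.
  have : \forall w \near x, ball x (complex.Re e) w by apply: nbhsx_ballx.
  by apply: filterS => w; rewrite -ball_normE.
apply: filterS => w h.
by rewrite -rmorphB re normc_def /= expr0n /= addr0 sqrtr_sqr ltcR.
Qed.

Lemma cts_sqrt f z : cts f z -> cts (fun w => csqrt_real (f w)) z.
Proof.
move=> cf.
have h1 : (complex.Re (f w) @[w --> (z : R[i]^o)] --> complex.Re (f z)).
  exact: (cvg_comp _ _ cf (@Re_continuous (f z))).
have h2 : (Num.sqrt (complex.Re (f w)) @[w --> (z : R[i]^o)] --> Num.sqrt (complex.Re (f z))).
  exact: (cvg_comp _ _ h1 (@sqrt_continuous R _)).
exact: (cvg_comp _ _ h2 (@real_complex_continuous _)).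
Qed.

Lemma cts_eq U f g z : open U -> U z -> {in U, f =1 g} -> cts f z -> cts g z.
Proof.
move=> oU Uz fg cf; have e : f z = g z by rewrite fg ?inE.
rewrite /cts /prop_for /continuous_at -e.
apply: cvg_trans cf; apply: near_eq_cvg.
have : \forall w \near (z : R[i]^o), U w by exact: open_nbhs_nbhs.
by apply: filterS => w Uw; rewrite /= fg ?inE.
Qed.

Lemma along_cvg v z : (z + t%:C * v : R[i]^o) @[t --> (0:R)] --> (z : R[i]^o).
Proof.
rewrite -[X in _ --> X]addr0 -[X in _ --> _ + X](mul0r v).
apply: cvgD; first exact: cvg_cst.
by apply: cvgM; [exact: (@real_complex_continuous 0)|exact: cvg_cst].
Qed.

Lemma near_along U v z : open U -> U z -> \forall t \near (0:R), U (z + t%:C * v).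
Proof.
move=> oU Uz; apply: (@along_cvg v z U).
exact: open_nbhs_nbhs.
Qed.

Lemma is_pd_near U v f g z d : open U -> U z -> {in U, f =1 g} -> is_pd v f z d -> is_pd v g z d.
Proof.
move=> oU Uz fg [fr fi].
have nr := near_along v oU Uz.
have aux (h k : R -> R) e : (\forall t \near (0:R), h t = k t) ->
    is_derive (0:R) (1:R) h e -> is_derive (0:R) (1:R) k e.
  exact: near_eq_is_derive.
split.
  by apply: aux fr; apply: filterS nr => t Ut; rewrite fg ?inE.
by apply: aux fi; apply: filterS nr => t Ut; rewrite fg ?inE.
Qed.

Lemma pd_eq_in U v f g : open U -> {in U, f =1 g} ->
  (forall z, U z -> has_pd v f z) -> {in U, pd v f =1 pd v g}.
Proof.
move=> oU fg hf z /[1!inE] Uz; have := is_pd_near oU Uz fg (has_pdP (hf _ Uz)).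
by case/is_pdP.
Qed.

Lemma Ck_cts k U f z : Ck k U f -> U z -> cts f z.
Proof. by case: k => [|k] [h _]; exact: h. Qed.

Lemma Ck0 U f : (forall z, U z -> cts f z) -> Ck 0 U f.
Proof. by split. Qed.

Lemma Ck_eq k U f g : open U -> {in U, f =1 g} -> Ck k U f -> Ck k U g.
Proof.
move=> oU; elim: k f g => [|k IH] f g fg hf.
  by apply: Ck0 => z Uz; exact: (cts_eq oU Uz fg (Ck_cts hf Uz)).
split; first by move=> z Uz; exact: (cts_eq oU Uz fg (Ck_cts hf Uz)).
case: hf => [_ [hf [h1 hi]]].
split; last first.
  split; [apply: IH h1|apply: IH hi]; apply: pd_eq_in => // z Uz;
  by case: (hf z Uz).
move=> z Uz; case: (hf z Uz) => /has_pdP p1 /has_pdP pi.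
by split; [case/is_pdP: (is_pd_near oU Uz fg p1)|case/is_pdP: (is_pd_near oU Uz fg pi)].
Qed.

Lemma CkS k U f : Ck k.+1 U f -> Ck k U f.
Proof.
elim: k f => [|k IH] f; first by case.
by move=> [cf [hf [h1 hi]]]; exact: (conj cf (conj hf (conj (IH _ h1) (IH _ hi)))).
Qed.

Lemma Ck_sub k U V f : V `<=` U -> Ck k U f -> Ck k V f.
Proof.
move=> VU; elim: k f => [|k IH] f hf.
  by apply: Ck0 => z /VU Uz; exact: (Ck_cts hf Uz).
split; first by move=> z /VU Uz; exact: (Ck_cts hf Uz).
case: hf => _ [hf [h1 hi]].
by split; [move=> z /VU; exact: hf|split; apply: IH].
Qed.

(** [Ck] is phrased with [pd], whose value for a sum or a quotient is known on [U] only. Candidates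
    [f1], [fi] for the partial derivatives may be used instead, so that each closure property below
    becomes an induction on [k]. *)
Lemma Ck_step k U f f1 fi : open U -> (forall z, U z -> cts f z) ->
  (forall z, U z -> is_pd 1 f z (f1 z)) -> (forall z, U z -> is_pd 'i f z (fi z)) ->
  Ck k U f1 -> Ck k U fi -> Ck k.+1 U f.
Proof.
move=> oU cf h1 hi c1 ci; split => //; split.
  by move=> z Uz; split; [case/is_pdP: (h1 z Uz)|case/is_pdP: (hi z Uz)].
split; [apply: Ck_eq c1 => // | apply: Ck_eq ci => //] => z /[1!inE] Uz.
  by case/is_pdP: (h1 z Uz).
by case/is_pdP: (hi z Uz).
Qed.

Lemma Ck_pd k U f z : Ck k.+1 U f -> U z -> is_pd 1 f z (pd 1 f z) /\ is_pd 'i f z (pd 'i f z).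
Proof. by move=> [_ [h _]] Uz; case: (h z Uz) => /has_pdP ? /has_pdP. Qed.

Lemma Ck_cst k U c : open U -> Ck k U (fun=> c).
Proof.
move=> oU; elim: k c => [|k IH] c; first by apply: Ck0 => z _; exact: cts_cst.
apply: (Ck_step (f1 := fun=> 0) (fi := fun=> 0)) => // z _; [exact: cts_cst|exact: is_pd_cst..].
Qed.

Lemma Ck_id k U : open U -> Ck k U id.
Proof.
move=> oU; case: k => [|k]; first by apply: Ck0 => z _; exact: cts_id.
apply: (Ck_step (f1 := fun=> 1) (fi := fun=> 'i)) => //.
- by move=> z _; exact: cts_id.
- by move=> z _; exact: is_pd_id.
- by move=> z _; exact: is_pd_id.
- exact: Ck_cst.
- exact: Ck_cst.
Qed.

Lemma CkD k U f g : open U -> Ck k U f -> Ck k U g -> Ck k U (fun z => f z + g z).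
Proof.
move=> oU; elim: k f g => [|k IH] f g hf hg.
  by apply: Ck0 => z Uz; exact: (ctsD (Ck_cts hf Uz) (Ck_cts hg Uz)).
apply: (Ck_step (f1 := fun z => pd 1 f z + pd 1 g z) (fi := fun z => pd 'i f z + pd 'i g z)) => //.
- by move=> z Uz; exact: (ctsD (Ck_cts hf Uz) (Ck_cts hg Uz)).
- by move=> z Uz; apply: is_pdD; [case: (Ck_pd hf Uz)|case: (Ck_pd hg Uz)].
- by move=> z Uz; apply: is_pdD; [case: (Ck_pd hf Uz)|case: (Ck_pd hg Uz)].
- by apply: IH; [case: hf => _ [_ []]|case: hg => _ [_ []]].
- by apply: IH; [case: hf => _ [_ []]|case: hg => _ [_ []]].
Qed.

Lemma CkN k U f : open U -> Ck k U f -> Ck k U (fun z => - f z).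
Proof.
move=> oU; elim: k f => [|k IH] f hf.
  by apply: Ck0 => z Uz; exact: (ctsN (Ck_cts hf Uz)).
apply: (Ck_step (f1 := fun z => - pd 1 f z) (fi := fun z => - pd 'i f z)) => //.
- by move=> z Uz; exact: (ctsN (Ck_cts hf Uz)).
- by move=> z Uz; apply: is_pdN; case: (Ck_pd hf Uz).
- by move=> z Uz; apply: is_pdN; case: (Ck_pd hf Uz).
- by apply: IH; case: hf => _ [_ []].
- by apply: IH; case: hf => _ [_ []].
Qed.

Lemma Ck_conj k U f : open U -> Ck k U f -> Ck k U (fun z => (f z)^*).
Proof.
move=> oU; elim: k f => [|k IH] f hf.
  by apply: Ck0 => z Uz; exact: (cts_conj (Ck_cts hf Uz)).
apply: (Ck_step (f1 := fun z => (pd 1 f z)^*) (fi := fun z => (pd 'i f z)^*)) => //.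
- by move=> z Uz; exact: (cts_conj (Ck_cts hf Uz)).
- by move=> z Uz; apply: is_pd_conj; case: (Ck_pd hf Uz).
- by move=> z Uz; apply: is_pd_conj; case: (Ck_pd hf Uz).
- by apply: IH; case: hf => _ [_ []].
- by apply: IH; case: hf => _ [_ []].
Qed.

Lemma CkM k U f g : open U -> Ck k U f -> Ck k U g -> Ck k U (fun z => f z * g z).
Proof.
move=> oU; elim: k f g => [|k IH] f g hf hg.
  by apply: Ck0 => z Uz; exact: (ctsM (Ck_cts hf Uz) (Ck_cts hg Uz)).
apply: (Ck_step (f1 := fun z => pd 1 f z * g z + f z * pd 1 g z)
  (fi := fun z => pd 'i f z * g z + f z * pd 'i g z)) => //.
- by move=> z Uz; exact: (ctsM (Ck_cts hf Uz) (Ck_cts hg Uz)).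
- by move=> z Uz; apply: is_pdM; [case: (Ck_pd hf Uz)|case: (Ck_pd hg Uz)].
- by move=> z Uz; apply: is_pdM; [case: (Ck_pd hf Uz)|case: (Ck_pd hg Uz)].
- have [h1 h2] := (CkS hf, CkS hg).
  by apply: CkD => //; apply: IH => //; [case: hf => _ [_ []]|case: hg => _ [_ []]].
- have [h1 h2] := (CkS hf, CkS hg).
  by apply: CkD => //; apply: IH => //; [case: hf => _ [_ []]|case: hg => _ [_ []]].
Qed.

Lemma CkV k U f : open U -> (forall z, U z -> f z != 0) -> Ck k U f ->
  Ck k U (fun z => (f z)^-1).
Proof.
move=> oU f0; elim: k => [|k IH] hf.
  by apply: Ck0 => z Uz; exact: (ctsV (f0 _ Uz) (Ck_cts hf Uz)).
have IHf := IH (CkS hf).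
apply: (Ck_step (f1 := fun z => - (pd 1 f z * ((f z)^-1 * (f z)^-1)))
  (fi := fun z => - (pd 'i f z * ((f z)^-1 * (f z)^-1)))) => //.
- by move=> z Uz; exact: (ctsV (f0 _ Uz) (Ck_cts hf Uz)).
- by move=> z Uz; apply: is_pdV; [exact: f0|case: (Ck_pd hf Uz)].
- by move=> z Uz; apply: is_pdV; [exact: f0|case: (Ck_pd hf Uz)].
- by apply: CkN => //; apply: CkM => //; [case: hf => _ [_ []]|apply: CkM].
- by apply: CkN => //; apply: CkM => //; [case: hf => _ [_ []]|apply: CkM].
Qed.

(** A function that is real on [U] agrees there with its conjugate, hence so do the derivatives. *)
Lemma pd_real v U f z : open U -> U z -> (forall w, U w -> (f w)^* = f w) -> has_pd v f z ->
  complex.Im (pd v f z) = 0.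
Proof.
move=> oU Uz fr /has_pdP h.
have h' : is_pd v (fun w => (f w)^*) z (pd v f z).
  by apply: is_pd_near oU Uz _ h => w /[1!inE] /fr ->.
have := is_pd_conj h; case/is_pdP: h' => _ e /is_pdP[_]; rewrite e.
case: (pd v f z) => x y /eqP; rewrite eq_complex /= => /andP[_ /eqP] h0.
by rewrite /=; lra.
Qed.

Lemma Ck_sqrt k U f : open U -> (forall z, U z -> 0 < f z) -> Ck k U f ->
  Ck k U (fun z => csqrt_real (f z)).
Proof.
move=> oU f0.
have fr w : U w -> (f w)^* = f w.
  by move=> /f0 h; rewrite conj_Creal// gtr0_real.
have fp w : U w -> 0 < complex.Re (f w).
  by move=> /f0; case: (f w) => x y; rewrite ltcE /= => /andP[].
elim: k => [|k IH] hf.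
  by apply: Ck0 => z Uz; exact: (cts_sqrt (Ck_cts hf Uz)).
have IHf := IH (CkS hf).
have s0 z : U z -> csqrt_real (f z) != 0.
  by move=> Uz; rewrite eq_complex /= negb_and sqrtr_eq0 -ltNge fp.
apply: (Ck_step (f1 := fun z => pd 1 f z * (2^-1 * (csqrt_real (f z))^-1))
  (fi := fun z => pd 'i f z * (2^-1 * (csqrt_real (f z))^-1))) => //.
- by move=> z Uz; exact: (cts_sqrt (Ck_cts hf Uz)).
- move=> z Uz; apply: is_pd_sqrt; [exact: fp| |by case: (Ck_pd hf Uz)].
  by apply: (pd_real oU Uz fr); case: hf => _ [h _]; case: (h z Uz).
- move=> z Uz; apply: is_pd_sqrt; [exact: fp| |by case: (Ck_pd hf Uz)].
  by apply: (pd_real oU Uz fr); case: hf => _ [h _]; case: (h z Uz).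
- by apply: CkM => //; [case: hf => _ [_ []]|apply: CkM => //; [exact: Ck_cst|apply: CkV]].
- by apply: CkM => //; [case: hf => _ [_ []]|apply: CkM => //; [exact: Ck_cst|apply: CkV]].
Qed.

End Smooth.

(** * Wirtinger derivatives and their commutation *)

Section Wirtinger.
Variable R : realType.
Implicit Types (v z : R[i]) (f g : R[i] -> R[i]) (U : set R[i]^o).

Lemma smooth_cts U f z : smooth U f -> U z -> cts f z.
Proof. by move=> h; apply: Ck_cts (h 0%N). Qed.

Lemma smooth_eq U f g : open U -> {in U, f =1 g} -> smooth U f -> smooth U g.
Proof. by move=> oU fg h k; apply: Ck_eq fg (h k). Qed.

Lemma smooth_sub U V f : V `<=` U -> smooth U f -> smooth V f.
Proof. by move=> VU h k; apply: Ck_sub VU (h k). Qed.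

Lemma smooth_cst U c : open U -> smooth U (fun=> c).
Proof. by move=> oU k; exact: Ck_cst. Qed.

Lemma smooth_id U : open U -> smooth U id.
Proof. by move=> oU k; exact: Ck_id. Qed.

Lemma smoothD U f g : open U -> smooth U f -> smooth U g -> smooth U (fun z => f z + g z).
Proof. by move=> oU hf hg k; apply: CkD. Qed.

Lemma smoothN U f : open U -> smooth U f -> smooth U (fun z => - f z).
Proof. by move=> oU hf k; apply: CkN. Qed.

Lemma smoothB U f g : open U -> smooth U f -> smooth U g -> smooth U (fun z => f z - g z).
Proof. by move=> oU hf hg; apply: smoothD => //; apply: smoothN. Qed.

Lemma smoothM U f g : open U -> smooth U f -> smooth U g -> smooth U (fun z => f z * g z).
Proof. by move=> oU hf hg k; apply: CkM. Qed.

Lemma smoothX U f n : open U -> smooth U f -> smooth U (fun z => f z ^+ n).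
Proof.
move=> oU hf; elim: n => [|n IH]; first exact: smooth_cst.
by under eq_fun do rewrite exprS; apply: smoothM.
Qed.

Lemma smooth_conj U f : open U -> smooth U f -> smooth U (fun z => (f z)^*).
Proof. by move=> oU hf k; apply: Ck_conj. Qed.

Lemma smoothV U f : open U -> (forall z, U z -> f z != 0) -> smooth U f ->
  smooth U (fun z => (f z)^-1).
Proof. by move=> oU f0 hf k; apply: CkV. Qed.

Lemma smooth_sqrt U f : open U -> (forall z, U z -> 0 < f z) -> smooth U f ->
  smooth U (fun z => csqrt_real (f z)).
Proof. by move=> oU f0 hf k; apply: Ck_sqrt. Qed.

Lemma smooth_is_pd U f z : smooth U f -> U z -> is_pd 1 f z (pd 1 f z) /\ is_pd 'i f z (pd 'i f z).
Proof. by move=> hf; apply: Ck_pd (hf 1%N). Qed.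

Lemma smooth_pd1 U f : smooth U f -> smooth U (pd 1 f).
Proof. by move=> hf k; case: (hf k.+1) => _ [_ []]. Qed.

Lemma smooth_pdi U f : smooth U f -> smooth U (pd 'i f).
Proof. by move=> hf k; case: (hf k.+1) => _ [_ []]. Qed.

Lemma smooth_ddz U f : open U -> smooth U f -> smooth U (ddz f).
Proof.
move=> oU hf; apply: smoothM => //; first exact: smooth_cst.
apply: smoothB => //; first exact: smooth_pd1.
by apply: smoothM => //; [exact: smooth_cst|exact: smooth_pdi].
Qed.

Lemma smooth_ddzb U f : open U -> smooth U f -> smooth U (ddzb f).
Proof.
move=> oU hf; apply: smoothM => //; first exact: smooth_cst.
apply: smoothD => //; first exact: smooth_pd1.
by apply: smoothM => //; [exact: smooth_cst|exact: smooth_pdi].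
Qed.

Lemma is_pd_ddz f z d e : is_pd 1 f z d -> is_pd 'i f z e ->
  ddz f z = 2^-1 * (d - 'i * e) /\ ddzb f z = 2^-1 * (d + 'i * e).
Proof. by rewrite /ddz /ddzb => /is_pdP[_ ->] /is_pdP[_ ->]. Qed.

Lemma dd_eq U f g z : open U -> U z -> {in U, f =1 g} -> smooth U f ->
  ddz f z = ddz g z /\ ddzb f z = ddzb g z.
Proof.
move=> oU Uz fg hf; have [h1 hi] := smooth_is_pd hf Uz.
have [-> ->] := is_pd_ddz h1 hi.
by have [-> ->] := is_pd_ddz (is_pd_near oU Uz fg h1) (is_pd_near oU Uz fg hi).
Qed.

Lemma dd_cst c z : ddz (fun=> c : R[i]) z = 0 /\ ddzb (fun=> c : R[i]) z = 0.
Proof.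
have [-> ->] := is_pd_ddz (is_pd_cst 1 c z) (is_pd_cst 'i c z).
by rewrite mulr0 subr0 addr0 mulr0.
Qed.

Lemma dd_id z : ddz id z = 1 /\ ddzb id z = 0.
Proof.
have [-> ->] := is_pd_ddz (is_pd_id 1 z) (is_pd_id 'i z).
have i2 : ('i : R[i]) * 'i = -1 by rewrite -expr2 sqrCi.
by rewrite i2 opprK subrr mulr0 -mulr2n mulVf// pnatr_eq0.
Qed.

Lemma ddD U f g z : smooth U f -> smooth U g -> U z ->
  ddz (fun w => f w + g w) z = ddz f z + ddz g z /\
  ddzb (fun w => f w + g w) z = ddzb f z + ddzb g z.
Proof.
move=> hf hg Uz; have [f1 fi] := smooth_is_pd hf Uz; have [g1 gi] := smooth_is_pd hg Uz.
have [-> ->] := is_pd_ddz (is_pdD f1 g1) (is_pdD fi gi).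
rewrite /ddz /ddzb; move: (pd 1 f z) (pd 'i f z) (pd 1 g z) (pd 'i g z) => a b c d.
by split; ring.
Qed.

Lemma ddN U f z : smooth U f -> U z ->
  ddz (fun w => - f w) z = - ddz f z /\ ddzb (fun w => - f w) z = - ddzb f z.
Proof.
move=> hf Uz; have [f1 fi] := smooth_is_pd hf Uz.
have [-> ->] := is_pd_ddz (is_pdN f1) (is_pdN fi).
rewrite /ddz /ddzb; move: (pd 1 f z) (pd 'i f z) => a b.
by split; ring.
Qed.

Lemma ddM U f g z : smooth U f -> smooth U g -> U z ->
  ddz (fun w => f w * g w) z = ddz f z * g z + f z * ddz g z /\
  ddzb (fun w => f w * g w) z = ddzb f z * g z + f z * ddzb g z.
Proof.
move=> hf hg Uz; have [f1 fi] := smooth_is_pd hf Uz; have [g1 gi] := smooth_is_pd hg Uz.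
have [-> ->] := is_pd_ddz (is_pdM f1 g1) (is_pdM fi gi).
rewrite /ddz /ddzb; move: (pd 1 f z) (pd 'i f z) (pd 1 g z) (pd 'i g z) => a b c d.
by split; ring.
Qed.

Lemma ddV U f z : smooth U f -> U z -> f z != 0 ->
  ddz (fun w => (f w)^-1) z = - ddz f z / f z ^+ 2 /\
  ddzb (fun w => (f w)^-1) z = - ddzb f z / f z ^+ 2.
Proof.
move=> hf Uz f0; have [f1 fi] := smooth_is_pd hf Uz.
have [-> ->] := is_pd_ddz (is_pdV f0 f1) (is_pdV f0 fi).
by split; rewrite /ddz /ddzb; move: (pd 1 f z) (pd 'i f z) (f z) f0 => a b c c0; field.
Qed.

Lemma dd_conj U f z : smooth U f -> U z ->
  ddz (fun w => (f w)^*) z = (ddzb f z)^* /\ ddzb (fun w => (f w)^*) z = (ddz f z)^*.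
Proof.
move=> hf Uz; have [f1 fi] := smooth_is_pd hf Uz.
have [-> ->] := is_pd_ddz (is_pd_conj f1) (is_pd_conj fi).
have h2 : ((2^-1 : R[i])^* ) = 2^-1 by rewrite fmorphV rmorph_nat.
rewrite /ddz /ddzb !(rmorphM, rmorphD, rmorphN) /= conjCi h2.
by move: (_ (pd 1 f z)) (_ (pd 'i f z)) => a b; split; ring.
Qed.

(** A partial derivative at a displaced point is an ordinary derivative at the parameter [w] of a
    line through [z]; this opens whole segments to calculus in one variable. *)
Lemma is_pd_shift v f z w : is_pd v f (z + w%:C * v) (pd v f (z + w%:C * v)) ->
  is_derive w (1 : R) (fun t : R => complex.Re (f (z + t%:C * v))) (complex.Re (pd v f (z + w%:C * v))) /\
  is_derive w (1 : R) (fun t : R => complex.Im (f (z + t%:C * v))) (complex.Im (pd v f (z + w%:C * v))).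
Proof.
have aux (h : R -> R) d : is_derive (0:R) (1:R) (fun t => h (w + t)) d -> is_derive w (1:R) h d.
  move=> hd.
  have is1 : is_derive w (1:R) (fun t : R => t - w) 1.
    apply: (is_derive_eq (is_deriveB (is_derive_id w (1:R)) (is_derive_cst w w (1:R)))).
    by rewrite subr0.
  have hd' : is_derive (w - w) (1:R) (fun t => h (w + t)) d by rewrite subrr.
  have := @is_derive1_comp R (fun t => h (w + t)) (fun t => t - w) w d 1 hd' is1; rewrite mulr1.
  by congr is_derive; apply/funext => t /=; rewrite addrC subrK.
move=> [hr hi]; split; apply: aux.
  by under eq_fun => t do rewrite rmorphD /= mulrDl addrA; exact: hr.
by under eq_fun => t do rewrite rmorphD /= mulrDl addrA; exact: hi.
Qed.

Lemma mean_value (h dh : R -> R) (a b : R) : a < b ->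
  (forall x, a <= x <= b -> is_derive x (1:R) h (dh x)) ->
  exists2 c, a <= c <= b & h b - h a = dh c * (b - a).
Proof.
move=> ab hd; have [||c] := @MVT R h dh a b ab.
- by move=> x; rewrite in_itv /= => /andP[/ltW ax /ltW xb]; apply: hd; rewrite ax xb.
- apply: derivable_within_continuous => x; rewrite in_itv /= => xab.
  by have [] := hd x xab.
by rewrite in_itv /= => /andP[/ltW ac /ltW cb] e; exists c => //; rewrite ac cb.
Qed.

(** The second difference of [u] over the square $[0,h]^2$ can be expanded in either order by two
    mean value theorems, so a value of [uxy] and a value of [uyx] in the square coincide. Continuity
    at the origin makes the values there arbitrarily close. *)
Lemma mixed_derivatives (u ux uy uxy uyx : R -> R -> R) (e : R) : 0 < e ->
  (forall s t, `|s| < e -> `|t| < e ->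
    [/\ is_derive s (1:R) (u ^~ t) (ux s t), is_derive t (1:R) (u s) (uy s t),
        is_derive t (1:R) (ux s) (uxy s t) & is_derive s (1:R) (uy ^~ t) (uyx s t)]) ->
  (forall d, 0 < d -> exists2 k, 0 < k & forall s t, `|s| < k -> `|t| < k ->
     `|uxy s t - uxy 0 0| < d /\ `|uyx s t - uyx 0 0| < d) ->
  uxy 0 0 = uyx 0 0.
Proof.
move=> e0 du cu; apply/eqP; rewrite -subr_eq0 -normr_le0; apply/ler_addgt0Pr => d d0.
have [k k0 hk] := cu (d / 2) (divr_gt0 d0 (ltr0n _ 2)).
(* Half the minimum keeps the closed square inside both neighbourhoods. *)
pose h := Num.min e k / 2.
have h0 : 0 < h by rewrite /h divr_gt0// lt_min e0 k0.
have hm : h < Num.min e k by rewrite /h; have : 0 < Num.min e k by [rewrite lt_min e0 k0]; lra.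
have [he hk'] : h < e /\ h < k by move: hm; rewrite lt_min => /andP[].
have inh x : 0 <= x <= h -> `|x| < e /\ `|x| < k.
  by move=> /andP[x0 xh]; rewrite ger0_norm//; split; lra.
have h00 : 0 <= (0:R) <= h by rewrite lexx ltW.
have hhh : 0 <= h <= h by rewrite lexx ltW.
have [c1 c1h e1] : exists2 c, 0 <= c <= h &
    (u h h - u h 0) - (u 0 h - u 0 0) = (ux c h - ux c 0) * (h - 0).
  apply: (@mean_value (fun s => u s h - u s 0) (fun c => ux c h - ux c 0)) => // x /inh[xe _].
  have [a1 _ _ _] := du x h xe (inh _ hhh).1; have [a2 _ _ _] := du x 0 xe (inh _ h00).1.
  exact: is_deriveB.
have [d1 d1h e2] : exists2 c, 0 <= c <= h & ux c1 h - ux c1 0 = uxy c1 c * (h - 0).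
  by apply: mean_value => // x /inh[xe _]; have [] := du c1 x (inh _ c1h).1 xe.
have [c2 c2h e3] : exists2 c, 0 <= c <= h &
    (u h h - u 0 h) - (u h 0 - u 0 0) = (uy h c - uy 0 c) * (h - 0).
  apply: (@mean_value (fun s => u h s - u 0 s) (fun c => uy h c - uy 0 c)) => // x /inh[xe _].
  have [_ a1 _ _] := du h x (inh _ hhh).1 xe; have [_ a2 _ _] := du 0 x (inh _ h00).1 xe.
  exact: is_deriveB.
have [d2 d2h e4] : exists2 c, 0 <= c <= h & uy h c2 - uy 0 c2 = uyx c c2 * (h - 0).
  by apply: (@mean_value (uy ^~ c2)) => // x /inh[xe _]; have [] := du x c2 xe (inh _ c2h).1.
have e5 : uxy c1 d1 = uyx d2 c2.
  apply: (@mulIf _ (h * h)); first by rewrite mulf_neq0// gt_eqF.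
  have -> : uxy c1 d1 * (h * h) = (u h h - u h 0) - (u 0 h - u 0 0) by rewrite e1 e2; ring.
  have -> : uyx d2 c2 * (h * h) = (u h h - u 0 h) - (u h 0 - u 0 0) by rewrite e3 e4; ring.
  by ring.
have [a1 _] := hk _ _ (inh _ c1h).2 (inh _ d1h).2.
have [_ a2] := hk _ _ (inh _ d2h).2 (inh _ c2h).2.
rewrite e5 in a1; rewrite add0r.
have -> : uxy 0 0 - uyx 0 0 = (uyx d2 c2 - uyx 0 0) - (uyx d2 c2 - uxy 0 0) by ring.
by apply: le_trans (ler_normB _ _) _; lra.
Qed.

Lemma open_box U z : open U -> U z -> exists2 e : R, 0 < e &
  forall s t : R, `|s| < e -> `|t| < e -> U (z + s%:C + t%:C * 'i).
Proof.
move=> oU Uz; have /nbhs_ballP[e /= e0 he] : nbhs (z : R[i]^o) U by apply: open_nbhs_nbhs.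
have re : e = (complex.Re e)%:C.
  by move: e0; case: (e) => a b; rewrite ltcE /= => /andP[/eqP -> _].
have e0' : 0 < complex.Re e by rewrite re ltcR in e0.
exists (complex.Re e / 2); first by rewrite divr_gt0.
move=> s t se te; apply: he; rewrite -ball_normE /ball_ /=.
have -> : z - (z + s%:C + t%:C * 'i) = - (s%:C + t%:C * 'i) by ring.
rewrite normrN; apply: le_lt_trans (ler_normD _ _) _.
have nC (x : R) : `|x%:C : R[i]| = `|x|%:C by rewrite normc_def /= expr0n /= addr0 sqrtr_sqr.
rewrite normrM normCi mulr1 !nC re -rmorphD ltcR; lra.
Qed.

Lemma box_cts f z : cts f z -> forall d : R, 0 < d -> exists2 k : R, 0 < k &
  forall s t : R, `|s| < k -> `|t| < k -> `|f (z + s%:C + t%:C * 'i) - f z| < d%:C.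
Proof.
move=> cf d d0.
have h1 : nbhs (z : R[i]^o) [set w | `|f z - f w| < d%:C].
  by apply: (cf [set c | `|f z - c| < d%:C]); apply: nbhs_distC; rewrite ltcR.
have h := nbhs_interior h1.
have [e e0 he] := @open_box _ z (@open_interior _ _) (nbhs_singleton h).
by exists e => // s t se te; rewrite distrC; apply: interior_subset (he s t se te).
Qed.

Lemma pd_comm U f z : open U -> smooth U f -> U z -> pd 'i (pd 1 f) z = pd 1 (pd 'i f) z.
Proof.
move=> oU hf Uz; have [e e0 he] := open_box oU Uz.
pose p (s t : R) : R[i] := z + s%:C + t%:C * 'i.
have p1 g s t : smooth U g -> `|s| < e -> `|t| < e ->
   is_derive s (1 : R) (fun s => complex.Re (g (p s t))) (complex.Re (pd 1 g (p s t))) /\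
   is_derive s (1 : R) (fun s => complex.Im (g (p s t))) (complex.Im (pd 1 g (p s t))).
  move=> hg se te.
  have E x : p x t = (z + t%:C * 'i) + x%:C * 1 by rewrite /p mulr1 addrAC.
  have [h _] := smooth_is_pd hg (he s t se te); rewrite -/(p s t) E in h.
  have [hr hi] := is_pd_shift h; rewrite E.
  by split; under eq_fun do rewrite E.
have pi g s t : smooth U g -> `|s| < e -> `|t| < e ->
   is_derive t (1 : R) (fun t => complex.Re (g (p s t))) (complex.Re (pd 'i g (p s t))) /\
   is_derive t (1 : R) (fun t => complex.Im (g (p s t))) (complex.Im (pd 'i g (p s t))).
  move=> hg se te.
  have [_ h] := smooth_is_pd hg (he s t se te).
  exact: is_pd_shift h.
have hf1 := smooth_pd1 hf; have hfi := smooth_pdi hf.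
have p00 : p 0 0 = z by rewrite /p mul0r !addr0.
have box g : smooth U g -> forall d : R, 0 < d -> exists2 k : R, 0 < k &
    forall s t : R, `|s| < k -> `|t| < k -> `|g (p s t) - g (p 0 0)| < d%:C.
  by move=> hg; rewrite p00; exact: box_cts (smooth_cts hg Uz).
have c1 := box _ (smooth_pdi hf1); have ci := box _ (smooth_pd1 hfi).
have ReB (x y : R[i]) : complex.Re x - complex.Re y = complex.Re (x - y) by case: x y => ? ? [].
have ImB (x y : R[i]) : complex.Im x - complex.Im y = complex.Im (x - y) by case: x y => ? ? [].
have Imle (x : R[i]) : `|complex.Im x|%:C <= `|x|.
  have := normc_ge_Re (x * 'i%R); rewrite normrM normCi mulr1 -complexiE ReiNIm normrN //.
suff : complex.Re (pd 'i (pd 1 f) (p 0 0)) = complex.Re (pd 1 (pd 'i f) (p 0 0)) /\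
       complex.Im (pd 'i (pd 1 f) (p 0 0)) = complex.Im (pd 1 (pd 'i f) (p 0 0)).
  by rewrite p00; case: (pd 'i _ _) => ? ?; case: (pd 1 _ _) => ? ? /= [-> ->].
(* [h] stands for the real or the imaginary part, both treated by the same argument. *)
have M (h : R[i] -> R) (hC : forall x y, `|h x - h y|%:C <= `|x - y|)
    (hp1 : forall g s t, smooth U g -> `|s| < e -> `|t| < e ->
       is_derive s (1 : R) (fun s => h (g (p s t))) (h (pd 1 g (p s t))))
    (hpi : forall g s t, smooth U g -> `|s| < e -> `|t| < e ->
       is_derive t (1 : R) (fun t => h (g (p s t))) (h (pd 'i g (p s t)))) :
    h (pd 'i (pd 1 f) (p 0 0)) = h (pd 1 (pd 'i f) (p 0 0)).
  pose u s t := h (f (p s t)); pose ux s t := h (pd 1 f (p s t)).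
  pose uy s t := h (pd 'i f (p s t)); pose uxy s t := h (pd 'i (pd 1 f) (p s t)).
  pose uyx s t := h (pd 1 (pd 'i f) (p s t)).
  suff : uxy 0 0 = uyx 0 0 by [].
  apply: (@mixed_derivatives u ux uy uxy uyx e e0).
    move=> s t se te; split; [exact: (hp1 f s t hf se te)|exact: (hpi f s t hf se te)|
      exact: (hpi _ s t hf1 se te)|exact: (hp1 _ s t hfi se te)].
  move=> d d0; have [k1 k10 h1] := c1 d d0; have [k2 k20 h2] := ci d d0.
  exists (Num.min k1 k2); first by rewrite lt_min k10 k20.
  move=> s t; rewrite !lt_min => /andP[s1 s2] /andP[t1 t2].
  have l1 := le_lt_trans (hC _ _) (h1 s t s1 t1); have l2 := le_lt_trans (hC _ _) (h2 s t s2 t2).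
  rewrite ltcR in l1; rewrite ltcR in l2.
  exact: (conj l1 l2).
split; apply: M.
- by move=> x y; rewrite ReB; exact: normc_ge_Re.
- by move=> g s t hg se te; exact: (p1 g s t hg se te).1.
- by move=> g s t hg se te; exact: (pi g s t hg se te).1.
- by move=> x y; rewrite ImB; exact: Imle.
- by move=> g s t hg se te; exact: (p1 g s t hg se te).2.
- by move=> g s t hg se te; exact: (pi g s t hg se te).2.
Qed.

Lemma ddz_ddzb_comm U f z : open U -> smooth U f -> U z -> ddzb (ddz f) z = ddz (ddzb f) z.
Proof.
move=> oU hf Uz; have h1 := smooth_pd1 hf; have hi := smooth_pdi hf.
have [h11 h1i] := smooth_is_pd h1 Uz; have [hi1 hii] := smooth_is_pd hi Uz.
have E := pd_comm oU hf Uz.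
have is1 v a b : is_pd v (pd 1 f) z a -> is_pd v (pd 'i f) z b ->
    is_pd v (ddz f) z (2^-1 * (a - 'i * b)) /\ is_pd v (ddzb f) z (2^-1 * (a + 'i * b)).
  move=> ha hb; split.
    have := is_pdM (is_pd_cst v (2^-1) z) (is_pdD ha (is_pdN (is_pdM (is_pd_cst v 'i z) hb))).
    by move/is_pd_eq; apply; ring.
  have := is_pdM (is_pd_cst v (2^-1) z) (is_pdD ha (is_pdM (is_pd_cst v 'i z) hb)).
  by move/is_pd_eq; apply; ring.
have [a1 b1] := is1 _ _ _ h11 hi1; have [a2 b2] := is1 _ _ _ h1i hii.
have [_ ->] := is_pd_ddz a1 a2; have [-> _] := is_pd_ddz b1 b2.
rewrite E; move: (pd 1 (pd 1 f) z) (pd 'i (pd 'i f) z) (pd 1 (pd 'i f) z) => a b c; ring.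
Qed.

End Wirtinger.

(** * Bilinear forms *)

Section Dot.
Variables (K : comNzRingType) (m : nat).
Implicit Types (a b c : 'rV[K]_m) (k : K).

Lemma dotE a b : dot a b = \sum_j a 0 j * b 0 j.
Proof. by rewrite /dot mxE; apply: eq_bigr => j _; rewrite mxE. Qed.

Lemma dotC a b : dot a b = dot b a.
Proof. by rewrite !dotE; apply: eq_bigr => j _; rewrite mulrC. Qed.

Lemma dotDl a b c : dot (a + b) c = dot a c + dot b c.
Proof. by rewrite /dot mulmxDl mxE. Qed.

Lemma dotZl k a b : dot (k *: a) b = k * dot a b.
Proof. by rewrite /dot -scalemxAl mxE. Qed.

Lemma dotNl a b : dot (- a) b = - dot a b.
Proof. by rewrite /dot mulNmx mxE. Qed.

Lemma dot0l b : dot 0 b = 0.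
Proof. by rewrite /dot mul0mx mxE. Qed.

Lemma dotDr a b c : dot c (a + b) = dot c a + dot c b.
Proof. by rewrite dotC dotDl !(dotC c). Qed.

Lemma dotZr k a b : dot b (k *: a) = k * dot b a.
Proof. by rewrite dotC dotZl dotC. Qed.

Lemma dotNr a b : dot b (- a) = - dot b a.
Proof. by rewrite dotC dotNl dotC. Qed.

Lemma dot0r b : dot b 0 = 0.
Proof. by rewrite dotC dot0l. Qed.

Definition dot_lin := (dotDl, dotDr, dotNl, dotNr, dotZl, dotZr, dot0l, dot0r).

End Dot.

Lemma dot_mulmx (K : comNzRingType) (m n : nat) (a b : 'rV[K]_m) (M : 'M[K]_(m, n)) :
  dot (a *m M) (b *m M) = (a *m (M *m M^T) *m b^T) 0 0.
Proof. by rewrite /dot trmx_mul !mulmxA. Qed.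

Section Lorentz.
Variables (R : realType) (n : nat).
Implicit Types (a b c : 'rV[R[i]]_(n + 1 + 1)) (k : R[i]).

Lemma lorentz_dot a b : lorentz a b = dot (a *m lorentz_mx R n) b.
Proof. by []. Qed.

Lemma lorentz_mxT : (lorentz_mx R n)^T = lorentz_mx R n.
Proof. by rewrite /lorentz_mx tr_block_mx !trmx0 trmx1 linearN /= trmx1. Qed.

Lemma lorentzC a b : lorentz a b = lorentz b a.
Proof.
by rewrite /lorentz -[in LHS](trmxK (a *m _ *m _)) mxE !trmx_mul trmxK lorentz_mxT mulmxA.
Qed.

Lemma lorentzDl a b c : lorentz (a + b) c = lorentz a c + lorentz b c.
Proof. by rewrite !lorentz_dot mulmxDl dotDl. Qed.
Lemma lorentzDr a b c : lorentz c (a + b) = lorentz c a + lorentz c b.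
Proof. by rewrite !lorentz_dot dotDr. Qed.
Lemma lorentzNl a b : lorentz (- a) b = - lorentz a b.
Proof. by rewrite !lorentz_dot mulNmx dotNl. Qed.
Lemma lorentzNr a b : lorentz b (- a) = - lorentz b a.
Proof. by rewrite !lorentz_dot dotNr. Qed.
Lemma lorentzZl k a b : lorentz (k *: a) b = k * lorentz a b.
Proof. by rewrite !lorentz_dot -scalemxAl dotZl. Qed.
Lemma lorentzZr k a b : lorentz b (k *: a) = k * lorentz b a.
Proof. by rewrite !lorentz_dot dotZr. Qed.
Lemma lorentz0l b : lorentz 0 b = 0.
Proof. by rewrite !lorentz_dot mul0mx dot0l. Qed.
Lemma lorentz0r b : lorentz b 0 = 0.
Proof. by rewrite !lorentz_dot dot0r. Qed.

Definition lor_lin := (lorentzDl, lorentzDr, lorentzNl, lorentzNr, lorentzZl, lorentzZr, lorentz0l, lorentz0r).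

Lemma lorentz_row (p q : 'rV[R[i]]_n) (a b c d : R[i]) :
  lorentz (row_mx (row_mx p a%:M) b%:M) (row_mx (row_mx q c%:M) d%:M) = dot p q + a * c - b * d.
Proof.
rewrite /lorentz /lorentz_mx mul_row_block !mulmx0 addr0 mulmx1 add0r mulmxN mulmx1.
rewrite !tr_row_mx !mul_row_col !tr_scalar_mx !mxE !big_ord1 !mxE /= !mulr1n mulNr.
by rewrite /dot mxE.
Qed.

End Lorentz.

Section VectorConj.
Variables (R : realType).
Implicit Types (m : nat).

Definition vconj m (v : 'rV[R[i]]_m) : 'rV[R[i]]_m := map_mx Num.conj v.

Lemma vconjD m (a b : 'rV[R[i]]_m) : vconj (a + b) = vconj a + vconj b.
Proof. exact: map_mxD. Qed.
Lemma vconjN m (a : 'rV[R[i]]_m) : vconj (- a) = - vconj a.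
Proof. exact: map_mxN. Qed.
Lemma vconjZ m k (a : 'rV[R[i]]_m) : vconj (k *: a) = k^* *: vconj a.
Proof. exact: map_mxZ. Qed.
Lemma vconjK m (a : 'rV[R[i]]_m) : vconj (vconj a) = a.
Proof. by apply/rowP => j; rewrite !mxE conjCK. Qed.
Lemma vconj0 m : vconj (0 : 'rV[R[i]]_m) = 0.
Proof. exact: map_mx0. Qed.

Lemma dot_conj m (a b : 'rV[R[i]]_m) : dot (vconj a) (vconj b) = (dot a b)^*.
Proof.
rewrite !dotE rmorph_sum; apply: eq_bigr => j _.
by rewrite !mxE rmorphM.
Qed.

Lemma lorentz_conj n (a b : 'rV[R[i]]_(n + 1 + 1)) :
  lorentz (vconj a) (vconj b) = (lorentz a b)^*.
Proof.
rewrite !lorentz_dot -dot_conj; congr dot.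
rewrite /vconj map_mxM; congr (_ *m _).
by rewrite /lorentz_mx map_block_mx !map_mx0 map_mxN !map_mx1.
Qed.

Lemma cplx_conj m (v : 'rV[R]_m) : vconj (cplx v) = cplx v.
Proof. by apply/rowP => j; rewrite !mxE conj_Creal// complex_real. Qed.

Lemma cplx_reP m (v : 'rV[R[i]]_m) : vconj v = v ->
  cplx (map_mx (@complex.Re R) v) = v.
Proof.
move=> h; apply/rowP => j; have := congr1 (fun w : 'rV__ => w 0 j) h; rewrite !mxE.
case: (v 0 j) => x y /eqP; rewrite eq_complex /= => /andP[_ /eqP e].
by congr Complex; lra.
Qed.

Lemma dot_cplx m (a b : 'rV[R]_m) : dot (cplx a) (cplx b) = (dot a b)%:C.
Proof. by rewrite !dotE rmorph_sum; apply: eq_bigr => j _; rewrite !mxE rmorphM. Qed.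

Lemma dot_conj_ge0 m (a : 'rV[R[i]]_m) : 0 <= dot a (vconj a).
Proof. by rewrite dotE; apply: sumr_ge0 => j _; rewrite mxE mul_conjC_ge0. Qed.

Lemma dot_conj_eq0 m (a : 'rV[R[i]]_m) : (dot a (vconj a) == 0) = (a == 0).
Proof.
apply/eqP/eqP => [|->]; last by rewrite dot0l.
rewrite dotE => h; apply/rowP => j.
have /eqP := h; rewrite psumr_eq0 => [/allP /(_ j)|i _]; last by rewrite mxE mul_conjC_ge0.
by rewrite mem_index_enum mxE mul_conjC_eq0 => /(_ isT) /implyP /(_ isT) /eqP -> ; rewrite mxE.
Qed.

Lemma dot_conj_gt0 m (a : 'rV[R[i]]_m) : (0 < dot a (vconj a)) = (a != 0).
Proof. by rewrite lt_def dot_conj_eq0 dot_conj_ge0 andbT. Qed.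

End VectorConj.

(** * Calculus with prescribed Wirtinger derivatives *)

Section Jets.
Variables (R : realType) (U : set R[i]^o).
Hypothesis oU : open U.
Implicit Types (f g : R[i] -> R[i]).

(** Smoothness and both derivatives travel together: the derivatives of a compound expression are
    read off from the term that assembles it, and [isd_uniq] identifies two ways of computing
    them. *)
Definition isd (f fz fb : R[i] -> R[i]) : Prop := smooth U f /\ forall z, U z -> ddz f z = fz z /\ ddzb f z = fb z.

Lemma isd_self f : smooth U f -> isd f (ddz f) (ddzb f).
Proof. by []. Qed.

Lemma isd_eq f fz fb gz gb : isd f fz fb -> (forall z, U z -> fz z = gz z) ->
  (forall z, U z -> fb z = gb z) -> isd f gz gb.
Proof.
by move=> [sf h] ez eb; split => // z Uz; have [-> ->] := h z Uz; rewrite ez// eb.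
Qed.

Lemma isd_ext f g fz fb : isd f fz fb -> (forall z, U z -> f z = g z) -> isd g fz fb.
Proof.
move=> [sf h] e; have e' : {in U, f =1 g} by move=> z /[1!inE]; exact: e.
split; first exact: smooth_eq e' sf.
by move=> z Uz; have [<- <-] := dd_eq oU Uz e' sf; exact: h.
Qed.

Lemma isd_smooth f fz fb : isd f fz fb -> smooth U f.
Proof. by case. Qed.

Lemma isd_smoothz f fz fb : isd f fz fb -> smooth U fz /\ smooth U fb.
Proof.
move=> [sf h]; split.
  by apply: smooth_eq (smooth_ddz oU sf) => // z /[1!inE] Uz; have [] := h z Uz.
by apply: smooth_eq (smooth_ddzb oU sf) => // z /[1!inE] Uz; have [] := h z Uz.
Qed.

Lemma isd_uniq f fz fb gz gb : isd f fz fb -> isd f gz gb ->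
  forall z, U z -> fz z = gz z /\ fb z = gb z.
Proof. by move=> [_ h1] [_ h2] z Uz; have [<- <-] := h1 z Uz; have [<- <-] := h2 z Uz. Qed.

(** Comparing mixed derivatives is how integrability enters below: the reality of $Y_{z\bar z}$, the
    equation for $N_{\bar z}$, the derivative of [chi]. *)
Lemma isd_comm f fz fb fzz fzb fbz fbb : isd f fz fb -> isd fz fzz fzb -> isd fb fbz fbb ->
  forall z, U z -> fzb z = fbz z.
Proof.
move=> [sf h] [sz hz] [sb hb] z Uz.
have [_ <-] := hz z Uz; have [<- _] := hb z Uz.
have e1 : {in U, ddz f =1 fz} by move=> w /[1!inE] Uw; have [] := h w Uw.
have e2 : {in U, ddzb f =1 fb} by move=> w /[1!inE] Uw; have [] := h w Uw.
have [_ <-] := dd_eq oU Uz e1 (smooth_ddz oU sf).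
have [<- _] := dd_eq oU Uz e2 (smooth_ddzb oU sf).
exact: ddz_ddzb_comm oU sf Uz.
Qed.

Lemma isd_cst c : isd (fun=> c) (fun=> 0) (fun=> 0).
Proof. by split => [|z _]; [exact: smooth_cst|exact: dd_cst]. Qed.

Lemma isd_id : isd id (fun=> 1) (fun=> 0).
Proof. by split => [|z _]; [exact: smooth_id|exact: dd_id]. Qed.

Lemma isdD f g fz fb gz gb : isd f fz fb -> isd g gz gb ->
  isd (fun z => f z + g z) (fun z => fz z + gz z) (fun z => fb z + gb z).
Proof.
move=> [sf hf] [sg hg]; split => [|z Uz]; first exact: smoothD.
by have [-> ->] := ddD sf sg Uz; have [-> ->] := hf z Uz; have [-> ->] := hg z Uz.
Qed.

Lemma isdN f fz fb : isd f fz fb -> isd (fun z => - f z) (fun z => - fz z) (fun z => - fb z).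
Proof.
move=> [sf hf]; split => [|z Uz]; first exact: smoothN.
by have [-> ->] := ddN sf Uz; have [-> ->] := hf z Uz.
Qed.

Lemma isdM f g fz fb gz gb : isd f fz fb -> isd g gz gb ->
  isd (fun z => f z * g z) (fun z => fz z * g z + f z * gz z) (fun z => fb z * g z + f z * gb z).
Proof.
move=> [sf hf] [sg hg]; split => [|z Uz]; first exact: smoothM.
by have [-> ->] := ddM sf sg Uz; have [-> ->] := hf z Uz; have [-> ->] := hg z Uz.
Qed.

Lemma isdV f fz fb : (forall z, U z -> f z != 0) -> isd f fz fb ->
  isd (fun z => (f z)^-1) (fun z => - fz z / f z ^+ 2) (fun z => - fb z / f z ^+ 2).
Proof.
move=> f0 [sf hf]; split => [|z Uz]; first exact: smoothV.
by have [-> ->] := ddV sf Uz (f0 z Uz); have [-> ->] := hf z Uz.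
Qed.

Lemma isd_conj f fz fb : isd f fz fb ->
  isd (fun z => (f z)^*) (fun z => (fb z)^*) (fun z => (fz z)^*).
Proof.
move=> [sf hf]; split => [|z Uz]; first exact: smooth_conj.
by have [-> ->] := dd_conj sf Uz; have [-> ->] := hf z Uz.
Qed.

Lemma isd_sum (I : finType) (f fz fb : I -> R[i] -> R[i]) :
  (forall j, isd (f j) (fz j) (fb j)) ->
  isd (fun z => \sum_j f j z) (fun z => \sum_j fz j z) (fun z => \sum_j fb j z).
Proof.
move=> h; elim: (index_enum I) => [|j s IH].
  by under eq_fun do rewrite big_nil; apply: isd_eq (isd_cst 0) _ _ => z _; rewrite big_nil.
under eq_fun do rewrite big_cons.
by apply: isd_eq (isdD (h j) IH) _ _ => z _; rewrite big_cons.
Qed.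

Section Vectors.
Variable m : nat.
Implicit Types (F G : R[i] -> 'rV[R[i]]_m).

Definition isv (F Fz Fb : R[i] -> 'rV[R[i]]_m) : Prop := forall j, isd (fun z => F z 0 j) (fun z => Fz z 0 j) (fun z => Fb z 0 j).

Lemma isvP F Fz Fb : isv F Fz Fb <->
  vsmooth U F /\ forall z, U z -> vz F z = Fz z /\ vzb F z = Fb z.
Proof.
split=> [h|[sF h] j].
  split=> [j|z Uz]; first by case: (h j).
  by split; apply/rowP => j; case: (h j) => _ /(_ z Uz) [hz hb]; rewrite mxE.
split => [|z Uz]; first exact: sF.
by have [<- <-] := h z Uz; rewrite !mxE.
Qed.

Lemma isv_self F : vsmooth U F -> isv F (vz F) (vzb F).
Proof. by move=> sF; apply/isvP. Qed.

Lemma isv_eq F Fz Fb Gz Gb : isv F Fz Fb -> (forall z, U z -> Fz z = Gz z) ->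
  (forall z, U z -> Fb z = Gb z) -> isv F Gz Gb.
Proof. by move=> h ez eb j; apply: isd_eq (h j) _ _ => z Uz; rewrite ?ez ?eb. Qed.

Lemma isv_ext F G Fz Fb : isv F Fz Fb -> (forall z, U z -> F z = G z) -> isv G Fz Fb.
Proof. by move=> h e j; apply: isd_ext (h j) _ => z Uz; rewrite e. Qed.

Lemma isv_uniq F Fz Fb Gz Gb : isv F Fz Fb -> isv F Gz Gb ->
  forall z, U z -> Fz z = Gz z /\ Fb z = Gb z.
Proof.
by move=> /isvP[_ h1] /isvP[_ h2] z Uz; have [<- <-] := h1 z Uz; have [<- <-] := h2 z Uz.
Qed.

Lemma isv_smooth F Fz Fb : isv F Fz Fb -> vsmooth U F.
Proof. by case/isvP. Qed.

Lemma isv_smoothz F Fz Fb : isv F Fz Fb -> vsmooth U Fz /\ vsmooth U Fb.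
Proof. by move=> h; split=> j; have [] := isd_smoothz (h j). Qed.

Lemma isv_comm F Fz Fb Fzz Fzb Fbz Fbb : isv F Fz Fb -> isv Fz Fzz Fzb -> isv Fb Fbz Fbb ->
  forall z, U z -> Fzb z = Fbz z.
Proof.
by move=> h hz hb z Uz; apply/rowP => j; exact: isd_comm (h j) (hz j) (hb j) z Uz.
Qed.

Lemma isv_cst c : isv (fun=> c) (fun=> 0) (fun=> 0).
Proof. by move=> j; apply: isd_eq (isd_cst _) _ _ => z _; rewrite mxE. Qed.

Lemma isvD F G Fz Fb Gz Gb : isv F Fz Fb -> isv G Gz Gb ->
  isv (fun z => F z + G z) (fun z => Fz z + Gz z) (fun z => Fb z + Gb z).
Proof.
move=> hF hG j; apply: isd_ext (isd_eq (isdD (hF j) (hG j)) _ _) _ => z _;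
by rewrite ?mxE.
Qed.

Lemma isvN F Fz Fb : isv F Fz Fb -> isv (fun z => - F z) (fun z => - Fz z) (fun z => - Fb z).
Proof.
by move=> hF j; apply: isd_ext (isd_eq (isdN (hF j)) _ _) _ => z _; rewrite ?mxE.
Qed.

Lemma isvZ f F fz fb Fz Fb : isd f fz fb -> isv F Fz Fb ->
  isv (fun z => f z *: F z) (fun z => fz z *: F z + f z *: Fz z)
    (fun z => fb z *: F z + f z *: Fb z).
Proof.
by move=> hf hF j; apply: isd_ext (isd_eq (isdM hf (hF j)) _ _) _ => z _; rewrite ?mxE.
Qed.

Lemma isv_conj F Fz Fb : isv F Fz Fb ->
  isv (fun z => vconj (F z)) (fun z => vconj (Fb z)) (fun z => vconj (Fz z)).
Proof.
by move=> hF j; apply: isd_ext (isd_eq (isd_conj (hF j)) _ _) _ => z _; rewrite ?mxE.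
Qed.

Lemma isd_dot F G Fz Fb Gz Gb : isv F Fz Fb -> isv G Gz Gb ->
  isd (fun z => dot (F z) (G z)) (fun z => dot (Fz z) (G z) + dot (F z) (Gz z))
    (fun z => dot (Fb z) (G z) + dot (F z) (Gb z)).
Proof.
move=> hF hG; have h := isd_sum (fun j => isdM (hF j) (hG j)).
by apply: isd_ext (isd_eq h _ _) _ => z _; rewrite !dotE ?big_split.
Qed.

End Vectors.

Lemma isv_mulmx m p F Fz Fb (M : 'M[R[i]]_(m, p)) : isv F Fz Fb ->
  isv (fun z => F z *m M) (fun z => Fz z *m M) (fun z => Fb z *m M).
Proof.
move=> hF j; have h := isd_sum (fun k => isdM (hF k) (isd_cst (M k j))).
apply: isd_ext (isd_eq h _ _) _ => z _; rewrite mxE//;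
by apply: eq_bigr => k _; rewrite mulr0 addr0.
Qed.

Lemma isv_row m p F Fz Fb G Gz Gb : isv (m := m) F Fz Fb -> isv (m := p) G Gz Gb ->
  isv (fun z => row_mx (F z) (G z)) (fun z => row_mx (Fz z) (Gz z)) (fun z => row_mx (Fb z) (Gb z)).
Proof.
move=> hF hG j; case: (split_ordP j) => k ->.
  by apply: isd_ext (isd_eq (hF k) _ _) _ => z _; rewrite row_mxEl.
by apply: isd_ext (isd_eq (hG k) _ _) _ => z _; rewrite row_mxEr.
Qed.

Lemma isv_scalar f fz fb : isd f fz fb ->
  isv (fun z => (f z)%:M : 'rV_1) (fun z => (fz z)%:M) (fun z => (fb z)%:M).
Proof.
move=> hf j; rewrite [j]ord1.
by apply: isd_ext (isd_eq hf _ _) _ => z _; rewrite mxE eqxx mulr1n.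
Qed.

Lemma isd_lorentz n (F G Fz Fb Gz Gb : R[i] -> 'rV[R[i]]_(n + 1 + 1)) :
  isv F Fz Fb -> isv G Gz Gb ->
  isd (fun z => lorentz (F z) (G z)) (fun z => lorentz (Fz z) (G z) + lorentz (F z) (Gz z))
    (fun z => lorentz (Fb z) (G z) + lorentz (F z) (Gb z)).
Proof. by move=> hF hG; exact: isd_dot (isv_mulmx (lorentz_mx R n) hF) hG. Qed.

End Jets.

(** * Moving frames and the Willmore equation *)

(* Generalizing the pairings first keeps [mxE] and [ring] from unfolding them. *)
Ltac gen_pairings := cbv beta; repeat match goal with
  | |- context [@lorentz ?R ?n ?a ?b] => generalize (@lorentz R n a b); intro
  | |- context [@dot ?K ?m ?a ?b] => generalize (@dot K m a b); intro
  end.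

(** The orthogonal projection onto the complement of the span of [Y], [N], [P], [Q]. Signs and
    factors 2 come from $\langle Y,N\rangle=-1$ and $\langle P,Q\rangle=\frac12$, all other pairings
    of the frame being zero. *)
Definition nproj (R : realType) (n : nat) (Y N P Q w : 'rV[R[i]]_(n + 1 + 1)) :
    'rV[R[i]]_(n + 1 + 1) :=
  w + lorentz w N *: Y + lorentz w Y *: N - (2 * lorentz w Q) *: P - (2 * lorentz w P) *: Q.

Section Entries.
Variables (R : realType) (m n : nat).
Implicit Types (A B : 'M[R[i]]_(m, n)) (x y k : R[i]).
Lemma add_entry A B i j x y : A i j = x -> B i j = y -> (A + B) i j = x + y.
Proof. by rewrite mxE => -> ->. Qed.
Lemma scale_entry k A i j x : A i j = x -> (k *: A) i j = k * x.
Proof. by rewrite mxE => ->. Qed.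
Lemma opp_entry A i j x : A i j = x -> (- A) i j = - x.
Proof. by rewrite mxE => ->. Qed.
Lemma zero_entry i j : (0 : 'M[R[i]]_(m, n)) i j = 0.
Proof. by rewrite mxE. Qed.
End Entries.

(* The entry of a linear combination is computed by a proof term: rewriting would compare
   the scalars up to conversion. *)
Ltac entry_pf R m n A i j := lazymatch A with
  | @Algebra.add _ ?B ?C =>
      let p := entry_pf R m n B i j in let q := entry_pf R m n C i j in
      constr:(add_entry p q)
  | @GRing.scale _ _ ?k ?B => let p := entry_pf R m n B i j in constr:(scale_entry k p)
  | @Algebra.opp _ ?B => let p := entry_pf R m n B i j in constr:(opp_entry p)
  | @Algebra.zero _ => constr:(@zero_entry R m n i j)
  | _ => constr:(erefl (@fun_of_matrix (complex (Real.sort R)) m n A i j))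
  end.
Ltac mx_entries := lazymatch goal with
  |- @fun_of_matrix ?K ?m ?n ?A ?i ?j = @fun_of_matrix _ _ _ ?B _ _ =>
    let R := open_constr:(_ : realType) in unify K (complex (Real.sort R));
    let p := entry_pf R m n A i j in let q := entry_pf R m n B i j in
    refine (etrans p (etrans _ (esym q)))
  end.

Ltac gen_vectors := repeat match goal with
  | |- context [@nproj ?R ?n ?a ?b ?c ?d ?e] => generalize (@nproj R n a b c d e); intro
  | |- context [@vconj ?R ?n ?a] => generalize (@vconj R n a); intro
  end.
Ltac vring := gen_pairings; gen_vectors; let j := fresh in apply/rowP => j; mx_entries; ring.
Ltac vfield := gen_pairings; gen_vectors; let j := fresh in apply/rowP => j; mx_entries; field.

Section NormalProjection.
Variables (R : realType) (n : nat).
Local Notation vec := 'rV[R[i]]_(n + 1 + 1).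
Implicit Types (Y N P Q v w : vec).

Definition frame_at Y N P Q : Prop :=
  [/\ [/\ lorentz Y Y = 0, lorentz N N = 0, lorentz Y N = - 1 & lorentz Y P = 0],
      [/\ lorentz Y Q = 0, lorentz N P = 0 & lorentz N Q = 0] &
      [/\ lorentz P P = 0, lorentz Q Q = 0 & lorentz P Q = 2^-1]].

Definition normal_at Y N P Q w : Prop :=
  [/\ lorentz w Y = 0, lorentz w N = 0, lorentz w P = 0 & lorentz w Q = 0].

Variables (Y N P Q : vec).
Hypothesis fr : frame_at Y N P Q.

Lemma nproj_normal w : normal_at Y N P Q (nproj Y N P Q w).
Proof.
case: fr => [[h1 h2 h3 h4] [h5 h6 h7] [h8 h9 h10]].
have [h3' h4' h5'] : [/\ lorentz N Y = -1, lorentz P Y = 0 & lorentz Q Y = 0] by rewrite !(lorentzC _ Y).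
have [h6' h7' h10'] : [/\ lorentz P N = 0, lorentz Q N = 0 & lorentz Q P = 2^-1].
  by rewrite !(lorentzC _ N) (lorentzC Q).
have nz2 : (2 : R[i]) != 0 by rewrite pnatr_eq0.
by split; rewrite /nproj !lor_lin ?(h1, h2, h3, h4, h5, h6, h7, h8, h9, h10, h3', h4', h5', h6', h7', h10'); field.
Qed.

Lemma nproj_id w : normal_at Y N P Q w -> nproj Y N P Q w = w.
Proof.
by move=> [h1 h2 h3 h4]; rewrite /nproj h1 h2 h3 h4 !mulr0 !scale0r !addr0 !subr0.
Qed.

Lemma nproj_span (a b c d : R[i]) w : nproj Y N P Q (a *: Y + b *: N + c *: P + d *: Q + w) = nproj Y N P Q w.
Proof.
case: fr => [[h1 h2 h3 h4] [h5 h6 h7] [h8 h9 h10]].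
have [h3' h4' h5'] : [/\ lorentz N Y = -1, lorentz P Y = 0 & lorentz Q Y = 0] by rewrite !(lorentzC _ Y).
have [h6' h7' h10'] : [/\ lorentz P N = 0, lorentz Q N = 0 & lorentz Q P = 2^-1].
  by rewrite !(lorentzC _ N) (lorentzC Q).
have nz2 : (2 : R[i]) != 0 by rewrite pnatr_eq0.
rewrite /nproj !lor_lin ?(h1, h2, h3, h4, h5, h6, h7, h8, h9, h10, h3', h4', h5', h6', h7', h10').
by vfield.
Qed.

Lemma nprojD v w : nproj Y N P Q (v + w) = nproj Y N P Q v + nproj Y N P Q w.
Proof. by rewrite /nproj !lor_lin; vring. Qed.

Lemma nprojZ k w : nproj Y N P Q (k *: w) = k *: nproj Y N P Q w.
Proof. by rewrite /nproj !lor_lin; vring. Qed.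

Lemma nproj_decomp w : w = - lorentz w N *: Y - lorentz w Y *: N + (2 * lorentz w Q) *: P
  + (2 * lorentz w P) *: Q + nproj Y N P Q w.
Proof. by rewrite /nproj; vring. Qed.

End NormalProjection.

Section ProjectionMatrix.
Variables (R : realType) (n : nat).
Local Notation vec := 'rV[R[i]]_(n + 1 + 1).
Implicit Types (Y N P Q v w : vec).

Lemma sub_lperp (V : 'M[R[i]]_(n + 1 + 1)) v :
  (v <= lperp V)%MS <-> (forall w, (w <= V)%MS -> lorentz v w = 0).
Proof.
rewrite /lperp; split=> [/sub_kermxP h w /submxP[D ->]|h].
  by rewrite /lorentz trmx_mul !mulmxA -(mulmxA v) h mul0mx mxE.
apply/sub_kermxP/rowP => j; have := h _ (row_sub j V).
rewrite /lorentz mxE => h0; rewrite mulmxA [RHS]mxE -[RHS]h0 [LHS]mxE.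
by apply: eq_bigr => k _; rewrite !mxE.
Qed.

(** [proj_mx] projects along its second space when the two spaces meet trivially, which is what the
    first hypothesis provides. *)
Lemma lperp_proj (V : 'M[R[i]]_(n + 1 + 1)) v w : (forall x : vec, (x <= V)%MS -> (x <= lperp V)%MS -> x = 0) ->
  (w <= lperp V)%MS -> (v - w <= V)%MS -> v *m proj_mx (lperp V) V = w.
Proof.
move=> d wp vV.
have d0 : (lperp V :&: V = 0)%MS.
  apply/eqP; rewrite -submx0; apply/rV_subP => x; rewrite sub_capmx => /andP[xp xV].
  by rewrite (d x xV xp) sub0mx.
have -> : v = w + (v - w) by rewrite addrC subrK.
by rewrite mulmxDl (proj_mx_id d0 wp) (proj_mx_0 d0 vV) addr0.
Qed.

(** Such a null frame makes $V$ nondegenerate, so the matrix projection used for the normal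
    connection is the explicit [nproj]. *)
Lemma frame_proj (V : 'M[R[i]]_(n + 1 + 1)) Y N P Q : frame_at Y N P Q ->
  (forall v, (v <= V)%MS <-> exists a b c d, v = a *: Y + b *: N + c *: P + d *: Q) ->
  (forall v, (v <= lperp V)%MS <-> normal_at Y N P Q v) /\
  (forall v, v *m proj_mx (lperp V) V = nproj Y N P Q v).
Proof.
move=> fr hV.
have inV v a b c d : v = a *: Y + b *: N + c *: P + d *: Q -> (v <= V)%MS.
  by move=> ->; apply/hV; exists a, b, c, d.
have perp v : (v <= lperp V)%MS <-> normal_at Y N P Q v.
  split=> [/sub_lperp h|[h1 h2 h3 h4]].
    have [iY iN iP iQ] : [/\ (Y <= V)%MS, (N <= V)%MS, (P <= V)%MS & (Q <= V)%MS].
      split; [apply: (inV _ 1 0 0 0)|apply: (inV _ 0 1 0 0)|apply: (inV _ 0 0 1 0)|apply: (inV _ 0 0 0 1)];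
      by apply/rowP => j; rewrite !mxE; ring.
    by split; apply: h.
  by apply/sub_lperp => w /hV[a [b [c [d ->]]]]; rewrite !lor_lin h1 h2 h3 h4 !mulr0 !addr0.
split=> // v; apply: lperp_proj.
- move=> x /hV[a [b [c [d ex]]]] /perp nx.
  rewrite -(nproj_id nx) ex -[X in nproj _ _ _ _ X]addr0 nproj_span//.
  by rewrite /nproj !lor_lin !mulr0 !scale0r !addr0 !subr0.
- by apply/perp; exact: nproj_normal.
- apply: (inV _ (- lorentz v N) (- lorentz v Y) (2 * lorentz v Q) (2 * lorentz v P)).
  by rewrite /nproj; vring.
Qed.

End ProjectionMatrix.

(** * The structure equations of a conformal surface *)

Section MovingFrame.
Variables (R : realType) (n : nat) (U : set R[i]^o).
Hypothesis oU : open U.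
Local Notation vec := 'rV[R[i]]_(n + 1 + 1).

Lemma isd_eq_cst f fz fb (c : R[i]) : isd U f fz fb -> (forall z, U z -> f z = c) ->
  forall z, U z -> fz z = 0 /\ fb z = 0.
Proof. by move=> h e; apply: isd_uniq h (isd_ext oU (isd_cst oU c) _) => z /e. Qed.

(* The complexified moving frame of a surface: [Yz], [M], [kappa] are the
   derivatives $Y_z$, $Y_{z\bar z}$ and the normal part of $Y_{zz}$. *)
Record moving_frame (Y N Yz M kappa : R[i] -> vec) (s q : R[i] -> R[i]) : Prop := MovingFrame {
  mf_Y : isv U Y Yz (fun z => vconj (Yz z));
  mf_Yz : isv U Yz (fun z => - (s z / 2) *: Y z + kappa z) M;
  mf_M : forall z, U z -> M z = 2^-1 *: N z - q z *: Y z;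
  mf_real : forall z, U z -> [/\ vconj (Y z) = Y z, vconj (N z) = N z & vconj (M z) = M z];
  mf_smooth : [/\ smooth U s, smooth U q, vsmooth U N & vsmooth U kappa];
  mf_frame : forall z, U z -> frame_at (Y z) (N z) (Yz z) (vconj (Yz z));
  mf_kappa : forall z, U z -> normal_at (Y z) (N z) (Yz z) (vconj (Yz z)) (kappa z) }.

(** All pairings of the frame follow by differentiating the three given ones, once commuting
    derivatives have shown that $Y_{z\bar z}$ is real. *)
Lemma moving_frame_of_lift (Y Yz : R[i] -> vec) :
  isv U Y Yz (fun z => vconj (Yz z)) -> (forall z, U z -> vconj (Y z) = Y z) ->
  (forall z, U z -> [/\ lorentz (Y z) (Y z) = 0, lorentz (Yz z) (Yz z) = 0 &
     lorentz (Yz z) (vconj (Yz z)) = 2^-1]) ->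
  exists N M kappa s q, moving_frame Y N Yz M kappa s q.
Proof.
move=> hY rY hp.
have nz2 : (2 : R[i]) != 0 by rewrite pnatr_eq0.
have [sz sb] := isv_smoothz oU hY.
have hYz := isv_self sz; set Yzz := vz Yz in hYz; set M := vzb Yz in hYz.
have hYb := isv_conj oU hYz.
have rM z : U z -> vconj (M z) = M z by move=> Uz; rewrite -(isv_comm oU hY hYz hYb Uz).
have [szz sM] := isv_smoothz oU hYz.
have pYY z (Uz : U z) : lorentz (Y z) (Y z) = 0 by have [] := hp z Uz.
have pzz z (Uz : U z) : lorentz (Yz z) (Yz z) = 0 by have [] := hp z Uz.
have pzb z (Uz : U z) : lorentz (Yz z) (vconj (Yz z)) = 2^-1 by have [] := hp z Uz.
have half (a b : R[i]) : a + a = b + b -> a = b.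
  by move=> e; apply: (mulfI nz2); rewrite -[2]/(1 + 1) !mulrDl !mul1r.
have pYz z (Uz : U z) : lorentz (Y z) (Yz z) = 0.
  have [h _] := isd_eq_cst (isd_lorentz oU hY hY) pYY Uz.
  by apply: half; rewrite addr0 -{1}lorentzC.
have pYb z (Uz : U z) : lorentz (Y z) (vconj (Yz z)) = 0.
  by rewrite -{1}rY// lorentz_conj pYz// conjC0.
have pYM z (Uz : U z) : lorentz (Y z) (M z) = - 2^-1.
  have [_ h] := isd_eq_cst (isd_lorentz oU hY hYz) pYz Uz.
  by move: h; rewrite lorentzC pzb// => /eqP; rewrite addrC addr_eq0 => /eqP.
have pYzz z (Uz : U z) : lorentz (Y z) (Yzz z) = 0.
  have [h _] := isd_eq_cst (isd_lorentz oU hY hYz) pYz Uz.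
  by move: h; rewrite pzz// add0r.
have pzzz z (Uz : U z) : lorentz (Yzz z) (Yz z) = 0.
  have [h _] := isd_eq_cst (isd_lorentz oU hYz hYz) pzz Uz.
  by apply: half; rewrite addr0 -{2}[in LHS]lorentzC.
have pMz z (Uz : U z) : lorentz (M z) (Yz z) = 0.
  have [_ h] := isd_eq_cst (isd_lorentz oU hYz hYz) pzz Uz.
  by apply: half; rewrite addr0 -{2}[in LHS]lorentzC.
have pMb z (Uz : U z) : lorentz (M z) (vconj (Yz z)) = 0.
  by rewrite -{1}rM// lorentz_conj pMz// conjC0.
have pzzb z (Uz : U z) : lorentz (Yzz z) (vconj (Yz z)) = 0.
  have [h _] := isd_eq_cst (isd_lorentz oU hYz hYb) pzb Uz.
  by move: h; rewrite rM// (lorentzC (Yz z)) pMz// addr0.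
have pbb z (Uz : U z) : lorentz (vconj (Yz z)) (vconj (Yz z)) = 0.
  by rewrite lorentz_conj pzz// conjC0.
(* As $\langle Y,M\rangle=-\frac12$, the multiple of [Y] with this [q] makes [N] null; the factor in
   [s] then makes [kappa] orthogonal to [N]. *)
pose q z := lorentz (M z) (M z).
pose N z := 2 *: M z + (2 * q z) *: Y z.
pose s z := 2 * lorentz (Yzz z) (N z).
pose kappa z := Yzz z + (s z / 2) *: Y z.
have hM := isv_self sM.
have hq := isd_lorentz oU hM hM.
have hN : isv U N _ _ := isvD oU (isvZ oU (isd_cst oU 2) hM) (isvZ oU (isdM oU (isd_cst oU 2) hq) hY).
have hs : isd U s _ _ := isdM oU (isd_cst oU 2) (isd_lorentz oU (isv_self szz) hN).
have hk : isv U kappa _ _ := isvD oU (isv_self szz) (isvZ oU (isdM oU hs (isd_cst oU 2^-1)) hY).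
have pNN z (Uz : U z) : lorentz (N z) (N z) = 0.
  by rewrite /N !lor_lin pYY// (lorentzC (M z)) pYM// /q; field.
have pYN z (Uz : U z) : lorentz (Y z) (N z) = -1.
  by rewrite /N !lor_lin pYY// pYM//; field.
exists N, M, kappa, s, q; split => //.
- by apply: isv_eq hYz _ _ => z Uz //; rewrite /kappa; vring.
- by move=> z Uz; rewrite /N; vfield.
- move=> z Uz; split; [exact: rY| |exact: rM].
  have rq : (q z)^* = q z by rewrite /q -lorentz_conj rM.
  by rewrite /N vconjD !vconjZ rM// rY// rmorphM /= rq rmorph_nat.
- by split; [case: hs|case: hq|exact: isv_smooth hN|exact: isv_smooth hk].
- move=> z Uz; split; split; rewrite ?pYY ?pNN ?pYN ?pYz ?pYb ?pzz ?pbb ?pzb //.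
    by rewrite /N !lor_lin pMz// pYz// !mulr0 addr0.
  by rewrite /N !lor_lin pMb// pYb// !mulr0 addr0.
- move=> z Uz; split; rewrite /kappa lorentzDl lorentzZl.
  + by rewrite (lorentzC (Yzz z)) pYzz// pYY// mulr0 addr0.
  + by rewrite pYN// /s; field.
  + by rewrite pzzz// pYz// mulr0 addr0.
  + by rewrite pzzb// pYb// mulr0 addr0.
Qed.

Section Consequences.
Variables (Y N Yz M kappa : R[i] -> vec) (s q : R[i] -> R[i]).
Hypothesis mf : moving_frame Y N Yz M kappa s q.
Local Notation Yb := (fun z => vconj (Yz z)).
Local Notation Pn z := (nproj (Y z) (N z) (Yz z) (vconj (Yz z))).

Lemma nproj_smooth w : vsmooth U w -> vsmooth U (fun z => Pn z (w z)).
Proof.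
move=> /isv_self hw; have [_ _ /isv_self hN _] := mf_smooth mf.
have hY := mf_Y mf; have hYz := mf_Yz mf; have hYb := isv_conj oU hYz.
exact: (isv_smooth (isvD oU (isvD oU (isvD oU (isvD oU hw (isvZ oU (isd_lorentz oU hw hN) hY))
  (isvZ oU (isd_lorentz oU hw hY) hN))
  (isvN oU (isvZ oU (isdM oU (isd_cst oU 2) (isd_lorentz oU hw hYb)) hYz)))
  (isvN oU (isvZ oU (isdM oU (isd_cst oU 2) (isd_lorentz oU hw hYz)) hYb)))).
Qed.

(** The normal part comes from $(Y_{zz})_{\bar z}=(Y_{z\bar z})_z$ after conjugation, the
    coefficient of $Y_z$ from differentiating $\langle N,Y_{\bar z}\rangle=0$. The other two
    coefficients stay implicit: the tensor to which the formula is applied vanishes on $Y$ and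
    $Y_{\bar z}$. *)
Lemma frame_Nzb kz kb Nz Nb : isv U kappa kz kb -> isv U N Nz Nb -> forall z, U z ->
  exists a b, Nb z = a *: Y z + b *: Yb z - (s z)^* *: Yz z + 2 *: vconj (Pn z (kb z)).
Proof.
move=> hk hN z Uz; have nz2 : (2 : R[i]) != 0 by rewrite pnatr_eq0.
have hY := mf_Y mf; have hYz := mf_Yz mf; have hYb := isv_conj oU hYz.
have [ss sq _ _] := mf_smooth mf.
have fr w (Uw : U w) := mf_frame mf Uw.
have [[h1 h2 h3 h4] [h5 h6 h7] [h8 h9 h10]] := fr z Uz.
have [rY rN rM] := mf_real mf Uz.
have rNb : vconj (Nz z) = Nb z.
  have hcN : isv U (fun w => vconj (N w)) Nz Nb.
    have rN' w (Uw : U w) : N w = vconj (N w) by have [_ ->] := mf_real mf Uw.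
    exact: (isv_ext oU hN rN').
  by have [_ ->] := isv_uniq (isv_conj oU hN) hcN Uz.
have pYN w (Uw : U w) : lorentz (N w) (Y w) = -1 by rewrite lorentzC; have [[]] := fr w Uw.
have pNN w (Uw : U w) : lorentz (N w) (N w) = 0 by have [[]] := fr w Uw.
have pNb w (Uw : U w) : lorentz (N w) (Yb w) = 0 by have [_ []] := fr w Uw.
have e1 : lorentz (Nb z) (Y z) = 0.
  have [_] := isd_eq_cst (isd_lorentz oU hN hY) pYN Uz.
  by rewrite h7 addr0.
have e2 : lorentz (Nb z) (N z) = 0.
  have [_ h] := isd_eq_cst (isd_lorentz oU hN hN) pNN Uz.
  by apply: (mulfI nz2); rewrite mulr0 -h [X in _ + X]lorentzC -mulr2n mulr_natl.
have [k1 k2 k3 k4] := mf_kappa mf Uz.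
have e3 : lorentz (Nb z) (Yb z) = - ((s z)^* / 2).
  have [_] := isd_eq_cst (isd_lorentz oU hN hYb) pNb Uz.
  have kb0 : lorentz (N z) (vconj (kappa z)) = 0 by rewrite -{1}rN lorentz_conj lorentzC k2 conjC0.
  rewrite vconjD vconjZ lorentzDr lorentzZr rY kb0 pYN// addr0 rmorphN rmorphM fmorphV rmorph_nat.
  by rewrite mulrN1 opprK => /eqP; rewrite addr_eq0 => /eqP ->.
have e4 : Pn z (Nb z) = 2 *: vconj (Pn z (kb z)).
  have conjP w : vconj (Pn z w) = Pn z (vconj w).
    rewrite /nproj !(vconjD, vconjN, vconjZ) vconjK rY rN !rmorphM /= rmorph_nat.
    rewrite -!lorentz_conj vconjK rY rN.
    by vring.
  rewrite -rNb -conjP.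
  have -> : 2 *: vconj (Pn z (kb z)) = vconj (2 *: Pn z (kb z)) by rewrite vconjZ rmorph_nat.
  congr vconj.
  have [_ sM] := isv_smoothz oU hYz; have hM := isv_self sM.
  have hss := isd_self ss; have hsq := isd_self sq.
  have hK := isvD oU (isvZ oU (isdN oU (isdM oU hss (isd_cst oU 2^-1))) hY) hk.
  have eM := isv_comm oU hYz hK hM Uz; rewrite /= in eM.
  have hM' : isv U M _ _ := isv_ext oU
     (isvD oU (isvZ oU (isd_cst oU 2^-1) hN) (isvN oU (isvZ oU hsq hY)))
     (fun w Uw => esym (mf_M mf Uw)).
  have [eN _] := isv_uniq hM hM' Uz; rewrite eN in eM.
  have -> : kb z = ((ddzb s z / 2 - ddz q z) *: Y z + 0 *: N z + (- q z) *: Yz z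
      + (s z / 2) *: vconj (Yz z)) + 2^-1 *: Nz z.
    have -> : kb z = (0 *: N z + 2^-1 *: Nz z - (ddz q z *: Y z + q z *: Yz z))
       + (ddzb s z / 2 + s z * 0) *: Y z + (s z / 2) *: vconj (Yz z).
      have -> : 0 *: N z + 2^-1 *: Nz z - (ddz q z *: Y z + q z *: Yz z) = 
         - (ddzb s z * 2^-1 + s z * 0) *: Y z + - (s z / 2) *: vconj (Yz z) + kb z.
        by rewrite -eM.
      by vring.
    by vring.
  by rewrite nproj_span// nprojZ scalerA mulfV// scale1r.
exists (- lorentz (Nb z) (N z)), (2 * lorentz (Nb z) (Yz z)).
rewrite {1}[Nb z](nproj_decomp (Y z) (N z) (Yz z) (vconj (Yz z))) e1 e3 e4.
by vfield.
Qed.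

End Consequences.
End MovingFrame.

(** * Willmore surfaces from a parallel second fundamental form *)

Section WillmoreCriterion.
Variables (R : realType) (n : nat) (U : set R[i]^o).
Hypothesis oU : open U.
Local Notation vec := 'rV[R[i]]_(n + 1 + 1).
Variables (Y N Yz M kappa : R[i] -> vec) (s q : R[i] -> R[i]).
Hypothesis mf : moving_frame U Y N Yz M kappa s q.
Local Notation Pn z := (nproj (Y z) (N z) (Yz z) (vconj (Yz z))).

(** The Willmore equation in frame form. Quantifying over the derivatives lets it be used with any
    expressions for them, in particular with restrictions of derivatives taken on a larger set. *)
Definition willmore_residual_zero := forall kz kb Dz Db, isv U kappa kz kb ->
  isv U (fun z => Pn z (kb z)) Dz Db -> forall z, U z ->
  Pn z (Db z) + ((s z)^* / 2) *: kappa z = 0.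

(* The tensor [C (x) Qb + nu (x) T] is the $\partial_z$-second fundamental form of $V$,
   and the Willmore equation says that it is $\bar\partial$-parallel. *)
Variables (C Cz Cb nu nuz nub Qb Qbz Qbb T Tz Tb : R[i] -> vec).
Hypotheses (hC : isv U C Cz Cb) (hnu : isv U nu nuz nub) (hQ : isv U Qb Qbz Qbb) (hT : isv U T Tz Tb).
Hypothesis normC : forall z, U z -> normal_at (Y z) (N z) (Yz z) (vconj (Yz z)) (C z).
Hypothesis normnu : forall z, U z -> normal_at (Y z) (N z) (Yz z) (vconj (Yz z)) (nu z).
Hypothesis kerY : forall z, U z -> [/\ lorentz (Y z) (Qb z) = 0, lorentz (Y z) (T z) = 0,
  lorentz (vconj (Yz z)) (Qb z) = 0 & lorentz (vconj (Yz z)) (T z) = 0].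
Hypothesis kerC : forall z, U z -> [/\ lorentz (vconj (C z)) (Qb z) = 0, lorentz (vconj (C z)) (T z) = 0,
  lorentz (vconj (nu z)) (Qb z) = 0 & lorentz (vconj (nu z)) (T z) = 0].
Hypothesis kappaE : forall z, U z ->
  kappa z = lorentz (Yz z) (Qb z) *: C z + lorentz (Yz z) (T z) *: nu z.
Hypothesis parallel : forall z v, U z -> v = Yz z \/ v = N z ->
  lorentz v (Qbb z) *: C z + lorentz v (Qb z) *: Pn z (Cb z)
  + lorentz v (Tb z) *: nu z + lorentz v (T z) *: Pn z (nub z) = 0.

(** Write $h(v)=\langle v,Q\rangle C+\langle v,T\rangle\nu$. Since $h$ is parallel, derivatives of
    $h(v)$ fall on $v$ alone: $\kappa=h(Y_z)$ gives $D_{\bar z}\kappa=h(Y_{z\bar z})=\frac12h(N)$,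
    and then $D_{\bar z}D_{\bar z}\kappa=\frac12h(N_{\bar z})$. In [frame_Nzb] the terms along $Y$,
    $Y_{\bar z}$ and the conjugate normal vector are killed by [kerY] and [kerC], which leaves
    $-\frac{\bar s}2\kappa$. *)
Lemma willmore_criterion : willmore_residual_zero.
Proof.
move=> kz kb Dz Db hk hD z Uz; have nz2 : (2 : R[i]) != 0 by rewrite pnatr_eq0.
have hYz := mf_Yz mf.
have [_ _ /isv_self hN _] := mf_smooth mf.
have D1 w : U w -> Pn w (kb w) = 2^-1 *: (lorentz (N w) (Qb w) *: C w + lorentz (N w) (T w) *: nu w).
  move=> Uw; have fr := mf_frame mf Uw.
  have h := isvD oU (isvZ oU (isd_lorentz oU hYz hQ) hC) (isvZ oU (isd_lorentz oU hYz hT) hnu).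
  have hk' := isv_ext oU h (fun v Uv => esym (kappaE Uv)).
  have [_ ->] := isv_uniq hk hk' Uw.
  rewrite !nprojD !nprojZ (nproj_id (normC Uw)) (nproj_id (normnu Uw)).
  have e := parallel Uw (or_introl (erefl (Yz w))).
  have [kY1 kY2 _ _] := kerY Uw.
  rewrite (mf_M mf Uw) !(lorentzDl, lorentzNl, lorentzZl) kY1 kY2.
  rewrite -[RHS]addr0 -e; by vring.
have hD' := isv_ext oU hD D1.
have hE := isvZ oU (isd_cst oU 2^-1) (isvD oU (isvZ oU (isd_lorentz oU hN hQ) hC)
   (isvZ oU (isd_lorentz oU hN hT) hnu)).
have [_ ->] := isv_uniq hD' hE Uz.
rewrite scale0r add0r !(nprojD, nprojZ) (nproj_id (normC Uz)) (nproj_id (normnu Uz)).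
have e := parallel Uz (or_intror (erefl (N z))).
have [a [b ->]] := frame_Nzb oU mf hk hN Uz.
have [kY1 kY2 kY3 kY4] := kerY Uz.
have [kC1 kC2 kC3 kC4] := kerC Uz.
rewrite D1// (kappaE Uz) !(vconjZ, vconjD) !(lorentzDl, lorentzNl, lorentzZl).
rewrite kY1 kY2 kY3 kY4 kC1 kC2 kC3 kC4.
rewrite -[RHS](scaler0 _ 2^-1) -e; by vfield.
Qed.

End WillmoreCriterion.

(** * The light cone model of R^n *)

Section Lifts.
Variables (R : realType) (n : nat).
Implicit Types (p q : 'rV[R[i]]_n) (a b c d : R[i]).

(* [cone p a b] has coordinates $(p, b - a/2, b + a/2)$, so that the Lorentz form becomes
   $p\cdot q - a d - b c$; the point [x] of R^n lifts to [cone x 1 (x.x / 2)]. *)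
Definition cone p a b : 'rV[R[i]]_(n + 1 + 1) :=
  row_mx (row_mx p (b - a / 2)%:M) (b + a / 2)%:M.

Lemma lorentz_cone p q a b c d : lorentz (cone p a b) (cone q c d) = dot p q - a * d - b * c.
Proof.
have nz2 : (2 : R[i]) != 0 by rewrite pnatr_eq0.
by rewrite /cone lorentz_row; gen_pairings; field.
Qed.

Lemma coneD p q a b c d : cone (p + q) (a + c) (b + d) = cone p a b + cone q c d.
Proof.
rewrite /cone !add_row_mx; congr row_mx; last by rewrite -raddfD /=; congr _%:M; ring.
by congr row_mx; rewrite -raddfD /=; congr _%:M; ring.
Qed.

Lemma coneZ (k : R[i]) p a b : cone (k *: p) (k * a) (k * b) = k *: cone p a b.
Proof. by rewrite /cone !scale_row_mx !scale_scalar_mx !mulrDr mulrN !mulrA. Qed.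

Lemma cone_conj p a b : vconj (cone p a b) = cone (vconj p) a^* b^*.
Proof.
have h2 : (2^-1 : R[i])^* = 2^-1 by rewrite fmorphV rmorph_nat.
rewrite /cone /vconj !map_row_mx !map_scalar_mx /= !(rmorphB, rmorphD, rmorphM) /=.
by rewrite h2.
Qed.

Lemma isv_cone (U : set R[i]^o) (oU : open U) (F Fz Fb : R[i] -> 'rV[R[i]]_n)
    (f fz fb g gz gb : R[i] -> R[i]) :
  isv U F Fz Fb -> isd U f fz fb -> isd U g gz gb ->
  isv U (fun z => cone (F z) (f z) (g z)) (fun z => cone (Fz z) (fz z) (gz z))
    (fun z => cone (Fb z) (fb z) (gb z)).
Proof.
move=> hp ha hb; have hh := isdM oU ha (isd_cst oU 2^-1).
have h1 := isdD oU hb (isdN oU hh); have h2 := isdD oU hb hh.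
apply: isv_eq (isv_row oU (isv_row oU hp (isv_scalar oU h1)) (isv_scalar oU h2)) _ _ => z _;
by rewrite /cone !mulr0 !addr0.
Qed.

End Lifts.

(* Locked: otherwise failing rewrites compare these vectors up to unfolding. *)
HB.lock Definition pt (R : realType) (n : nat) (p : 'rV[R[i]]_n) : 'rV[R[i]]_(n + 1 + 1) :=
  cone p 1 (dot p p / 2).
(** The differential of [pt] at [p] in the direction [q]. *)
HB.lock Definition tg (R : realType) (n : nat) (p q : 'rV[R[i]]_n) : 'rV[R[i]]_(n + 1 + 1) :=
  cone q 0 (dot p q).
(** The null vector over the point at infinity of $S^n$. Pairing a multiple of [pt p] with it
    recovers the factor up to sign. *)
HB.lock Definition infv (R : realType) (n : nat) : 'rV[R[i]]_(n + 1 + 1) := cone 0 0 1.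
Arguments infv {R n}.

Ltac gen_vectors ::= repeat match goal with
  | |- context [@nproj ?R ?n ?a ?b ?c ?d ?e] => generalize (@nproj R n a b c d e); intro
  | |- context [@tg ?R ?n ?a ?b] => generalize (@tg R n a b); intro
  | |- context [@pt ?R ?n ?a] => generalize (@pt R n a); intro
  | |- context [@infv ?R ?n] => generalize (@infv R n); intro
  | |- context [@vconj ?R ?n ?a] => generalize (@vconj R n a); intro
  end.

Section LiftsTheory.
Variables (R : realType) (n : nat).
Implicit Types (p q : 'rV[R[i]]_n) (a b c d : R[i]).
Local Notation infv := (@infv R n).

Lemma ptE p : pt p = cone p 1 (dot p p / 2). Proof. by rewrite unlock. Qed.
Lemma tgE p q : tg p q = cone q 0 (dot p q). Proof. by rewrite unlock. Qed.
Lemma infvE : infv = cone 0 0 1. Proof. by rewrite unlock. Qed.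

Lemma tgD p q (r : 'rV[R[i]]_n) : tg p (q + r) = tg p q + tg p r.
Proof. by rewrite !tgE dotDr -coneD addr0. Qed.

Lemma tgZ (k : R[i]) p q : tg p (k *: q) = k *: tg p q.
Proof. by rewrite !tgE dotZr -coneZ mulr0. Qed.

Lemma tgN p q : tg p (- q) = - tg p q.
Proof. by rewrite -scaleN1r tgZ scaleN1r. Qed.

Lemma tg0 p : tg p 0 = 0.
Proof. by rewrite -[0 in LHS](scale0r 0) tgZ scale0r. Qed.

Definition tg_lin := (tgD, tgN, tgZ, tg0).

Lemma lor_ptpt p : lorentz (pt p) (pt p) = 0.
Proof.
have nz2 : (2 : R[i]) != 0 by rewrite pnatr_eq0.
by rewrite !ptE lorentz_cone; gen_pairings; field.
Qed.

Lemma lor_pttg p q : lorentz (pt p) (tg p q) = 0.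
Proof. by rewrite ptE tgE lorentz_cone; gen_pairings; ring. Qed.

Lemma lor_tgpt p q : lorentz (tg p q) (pt p) = 0.
Proof. by rewrite lorentzC lor_pttg. Qed.

Lemma lor_tgtg p q (r : 'rV[R[i]]_n) : lorentz (tg p q) (tg p r) = dot q r.
Proof. by rewrite !tgE lorentz_cone; gen_pairings; ring. Qed.

Lemma lor_ptinf p : lorentz (pt p) infv = - 1.
Proof. by rewrite ptE infvE lorentz_cone dot0r; gen_pairings; ring. Qed.

Lemma lor_infpt p : lorentz infv (pt p) = - 1.
Proof. by rewrite lorentzC lor_ptinf. Qed.

Lemma lor_tginf p q : lorentz (tg p q) infv = 0.
Proof. by rewrite !tgE infvE lorentz_cone dot0r; gen_pairings; ring. Qed.

Lemma lor_inftg p q : lorentz infv (tg p q) = 0.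
Proof. by rewrite lorentzC lor_tginf. Qed.

Lemma lor_infinf : lorentz infv infv = 0.
Proof. by rewrite !infvE lorentz_cone dot0r; ring. Qed.

Definition lor_lift := (lor_ptpt, lor_pttg, lor_tgpt, lor_tgtg, lor_ptinf, lor_infpt, lor_tginf, lor_inftg, lor_infinf).

Lemma pt_conj p : vconj p = p -> vconj (pt p) = pt p.
Proof.
move=> rp; by rewrite !ptE cone_conj rp rmorph1 rmorphM /= fmorphV rmorph_nat -dot_conj rp.
Qed.

Lemma tg_conj p q : vconj p = p -> vconj (tg p q) = tg p (vconj q).
Proof. by move=> rp; rewrite !tgE cone_conj rmorph0 -dot_conj rp. Qed.

Section Derivatives.
Variables (U : set R[i]^o) (x xz : R[i] -> 'rV[R[i]]_n).
Hypotheses (oU : open U) (hx : isv U x xz (fun z => vconj (xz z))).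

Lemma isv_pt : isv U (fun z => pt (x z)) (fun z => tg (x z) (xz z))
  (fun z => tg (x z) (vconj (xz z))).
Proof.
have nz2 : (2 : R[i]) != 0 by rewrite pnatr_eq0.
have h := isv_cone oU hx (isd_cst oU 1) (isdM oU (isd_dot oU hx hx) (isd_cst oU 2^-1)).
apply: isv_eq (isv_ext oU h (fun w _ => esym (ptE (x w)))) _ _ => z Uz; rewrite !(ptE, tgE); congr cone.
  by rewrite (dotC (xz z)); gen_pairings; field.
by rewrite (dotC (vconj (xz z))); gen_pairings; field.
Qed.

Lemma isv_tg (w wz wb : R[i] -> 'rV[R[i]]_n) : isv U w wz wb ->
  isv U (fun z => tg (x z) (w z))
    (fun z => tg (x z) (wz z) + dot (xz z) (w z) *: infv)
    (fun z => tg (x z) (wb z) + dot (vconj (xz z)) (w z) *: infv).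
Proof.
move=> hq; have h := isv_cone oU hq (isd_cst oU 0) (isd_dot oU hx hq).
apply: isv_eq (isv_ext oU h (fun v _ => esym (tgE (x v) (w v)))) _ _ => z Uz; rewrite !tgE infvE -coneZ -coneD scaler0 mulr0 mulr1 !addr0;
by congr cone; rewrite addrC.
Qed.

Variables (Y N Yz M kappa : R[i] -> 'rV[R[i]]_(n + 1 + 1)) (s q om omz omb : R[i] -> R[i]).
Hypothesis mf : moving_frame U Y N Yz M kappa s q.
Hypotheses (om0 : forall z, U z -> om z != 0) (hom : isd U om omz omb).
Hypothesis YE : forall z, U z -> Y z = om z *: pt (x z).
Local Notation normal z := (normal_at (Y z) (N z) (Yz z) (vconj (Yz z))).
Local Notation Pn z := (nproj (Y z) (N z) (Yz z) (vconj (Yz z))).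

Lemma lift_Yz z : U z ->
  Yz z = omz z *: pt (x z) + om z *: tg (x z) (xz z) /\
  vconj (Yz z) = omb z *: pt (x z) + om z *: tg (x z) (vconj (xz z)).
Proof.
move=> Uz; have h := isv_ext oU (mf_Y mf) YE.
exact: (isv_uniq h (isvZ oU hom isv_pt) Uz).
Qed.

(** The lift [pt] and its two derivatives are combinations of $Y$, $Y_z$ and $Y_{\bar z}$, hence
    tangential. *)
Lemma nproj_pt z (a b c : R[i]) w : U z ->
  Pn z (a *: pt (x z) + b *: tg (x z) (xz z) + c *: tg (x z) (vconj (xz z)) + w) = Pn z w.
Proof.
move=> Uz; have [eP eQ] := lift_Yz Uz; have o0 := om0 Uz.
have e : a *: pt (x z) + b *: tg (x z) (xz z) + c *: tg (x z) (vconj (xz z)) + w =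
  ((a - (b / om z) * omz z - (c / om z) * omb z) / om z) *: Y z + 0 *: N z + (b / om z) *: Yz z
  + (c / om z) *: vconj (Yz z) + w.
  rewrite eQ eP YE//; move: (om z) (omz z) (omb z) o0 => o oz ob o0; by vfield.
by rewrite e (nproj_span (mf_frame mf Uz)).
Qed.

(** $V$ is spanned by the lift [pt], its first derivatives and its mixed second derivative. Testing
    normality on these four vectors avoids an explicit [N]. *)
Lemma normal_pt z (xzb : 'rV[R[i]]_n) v : U z -> vzb xz z = xzb ->
  lorentz v (pt (x z)) = 0 -> lorentz v (tg (x z) (xz z)) = 0 ->
  lorentz v (tg (x z) (vconj (xz z))) = 0 ->
  lorentz v (tg (x z) xzb + dot (vconj (xz z)) (xz z) *: infv) = 0 -> normal z v.
Proof.
move=> Uz exzb v0 v1 v2 v3; have [eP eQ] := lift_Yz Uz.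
have nz2 : (2 : R[i]) != 0 by rewrite pnatr_eq0.
have vY : lorentz v (Y z) = 0 by rewrite YE// lorentzZr v0 mulr0.
have vM : lorentz v (M z) = 0.
  have [sz _] := isv_smoothz oU hx; have hxz := isv_self sz.
  have [soz _] := isd_smoothz oU hom.
  have h := isvD oU (isvZ oU (isd_self soz) isv_pt) (isvZ oU hom (isv_tg hxz)).
  have h' := isv_ext oU (mf_Yz mf) (fun w Uw => (lift_Yz Uw).1).
  have [_ ->] := isv_uniq h' h Uz.
  rewrite exzb; move: (_ + _ *: infv) v3 => W v3.
  move: (pt _) (tg _ (xz z)) (tg _ (vconj _)) v0 v1 v2 => A B C v0 v1 v2.
  by rewrite !(lorentzDr, lorentzZr) v0 v1 v2 v3 !mulr0 !addr0.
have vN : lorentz v (N z) = 0.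
  move: vM; rewrite (mf_M mf Uz) !(lorentzDr, lorentzZr, lorentzNr) vY mulr0 subr0.
  by move/eqP; rewrite mulf_eq0 invr_eq0 (negbTE nz2) => /eqP.
split; [exact: vY|exact: vN|by rewrite eP lorentzDr !lorentzZr v0 v1 !mulr0 addr0|].
by rewrite eQ lorentzDr !lorentzZr v0 v2 !mulr0 addr0.
Qed.

End Derivatives.
End LiftsTheory.

(** * Null curves and their adjoint surfaces *)

Section NullCurve.
Variables (R : realType) (n : nat) (U : set R[i]^o).
Hypothesis oU : open U.
Local Notation vec := 'rV[R[i]]_n.

(* A local null holomorphic curve: [phi] is $x_z$ and [phi1], [phi2] are its derivatives. *)
Record null_curve (phi phi1 phi2 : R[i] -> vec) : Prop := NullCurve {
  nc_phi : isv U phi phi1 (fun=> 0);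
  nc_phi1 : isv U phi1 phi2 (fun=> 0);
  nc_00 : forall z, U z -> dot (phi z) (phi z) = 0;
  nc_11 : forall z, U z -> dot (phi1 z) (phi1 z) = 0;
  nc_indep : forall z, U z -> phi z != 0 /\ forall c, phi1 z != c *: phi z }.

Variables (phi phi1 phi2 : R[i] -> vec).
Hypothesis nc : null_curve phi phi1 phi2.
Local Notation cj v := (fun z => vconj (v z)).

(** Gram-Schmidt for $\phi,\phi'$ and the Hermitian product: [rho] and [tau] are the squared lengths
    of [phi] and of the orthogonal component [psi] of [phi1]. Moreover $\beta=(\log\rho)_z$ and
    $\sigma=(\log\rho)_{z\bar z}$. *)
Definition rho z := dot (phi z) (vconj (phi z)).
Definition beta z := dot (phi1 z) (vconj (phi z)) / rho z.
Definition psi z := phi1 z - beta z *: phi z.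
Definition tau z := dot (psi z) (vconj (psi z)).
Definition sigma z := tau z / rho z.

Lemma rho_neq0 z : U z -> rho z != 0.
Proof. by move=> Uz; have [h _] := nc_indep nc Uz; rewrite dot_conj_eq0. Qed.

Lemma tau_neq0 z : U z -> tau z != 0.
Proof.
move=> Uz; have [_ h] := nc_indep nc Uz; rewrite dot_conj_eq0.
by rewrite /psi subr_eq0.
Qed.

Lemma sigma_neq0 z : U z -> sigma z != 0.
Proof. by move=> Uz; rewrite mulf_neq0 ?invr_eq0 ?tau_neq0 ?rho_neq0. Qed.

Lemma tauE z : U z -> tau z = sigma z * rho z.
Proof. by move=> Uz; rewrite mulfVK// rho_neq0. Qed.

Lemma conj_selfdot (v : vec) : (dot v (vconj v))^* = dot v (vconj v).
Proof. by rewrite -dot_conj vconjK dotC. Qed.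

Lemma rho_conj z : (rho z)^* = rho z. Proof. exact: conj_selfdot. Qed.
Lemma tau_conj z : (tau z)^* = tau z. Proof. exact: conj_selfdot. Qed.
Lemma sigma_conj z : (sigma z)^* = sigma z.
Proof. by rewrite rmorphM fmorphV /= rho_conj tau_conj. Qed.

Lemma half0 (a : R[i]) : a + a = 0 -> a = 0.
Proof.
move=> e; have nz2 : (2 : R[i]) != 0 by rewrite pnatr_eq0.
by apply: (mulfI nz2); rewrite mulr0 mulr_natl mulr2n.
Qed.

Lemma dot01 z : U z -> dot (phi z) (phi1 z) = 0.
Proof.
move=> Uz; have [h _] := isd_eq_cst oU (isd_dot oU (nc_phi nc) (nc_phi nc)) (nc_00 nc) Uz.
by apply: half0; rewrite -{1}dotC.
Qed.

Lemma dot12 z : U z -> dot (phi1 z) (phi2 z) = 0.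
Proof.
move=> Uz; have [h _] := isd_eq_cst oU (isd_dot oU (nc_phi1 nc) (nc_phi1 nc)) (nc_11 nc) Uz.
by apply: half0; rewrite -{1}dotC.
Qed.

Lemma dot02 z : U z -> dot (phi z) (phi2 z) = 0.
Proof.
move=> Uz; have [h _] := isd_eq_cst oU (isd_dot oU (nc_phi nc) (nc_phi1 nc)) dot01 Uz.
by move: h; rewrite (nc_11 nc)// add0r.
Qed.

Lemma psi_dot z : U z -> [/\ dot (psi z) (phi z) = 0, dot (psi z) (psi z) = 0 &
  dot (psi z) (vconj (phi z)) = 0].
Proof.
move=> Uz; have r0 := rho_neq0 Uz; rewrite /psi !dot_lin (dotC (phi1 z) (phi z)) (dot01 Uz).
rewrite (nc_00 nc)// (nc_11 nc)// -/(rho z) /beta; split.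
- by rewrite !mulr0 subr0.
- by rewrite !(mulr0, oppr0, subr0, addr0).
- by rewrite mulfVK// subrr.
Qed.

Lemma psib_dot z : U z -> [/\ dot (vconj (psi z)) (vconj (phi z)) = 0,
   dot (vconj (psi z)) (vconj (psi z)) = 0 & dot (vconj (psi z)) (phi z) = 0].
Proof.
move=> Uz; have [h1 h2 h3] := psi_dot Uz.
by rewrite !dot_conj h1 h2 conjC0; split => //; rewrite -[phi z]vconjK dot_conj h3 conjC0.
Qed.

Lemma isd_rho : isd U rho (fun z => beta z * rho z) (fun z => (beta z)^* * rho z).
Proof.
have h := isd_dot oU (nc_phi nc) (isv_conj oU (nc_phi nc)).
apply: isd_eq h _ _ => z Uz.
  by rewrite vconj0 dot0r addr0 /beta mulfVK// rho_neq0.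
rewrite dot0l add0r /beta rmorphM fmorphV /= rho_conj -dot_conj vconjK mulfVK ?rho_neq0//.
by rewrite dotC.
Qed.

(** By Pythagoras $(\log\rho)_{z\bar z}$ is the squared length of [psi] divided by [rho]. Only this
    derivative is computed in closed form; the other one is obtained by choice as [betaz]. *)
Lemma isd_beta_ex : exists bz, isd U beta bz sigma.
Proof.
have h := isdM oU (isd_dot oU (nc_phi1 nc) (isv_conj oU (nc_phi nc)))
   (isdV oU rho_neq0 isd_rho).
eexists; apply: isd_eq h _ _ => // z Uz.
have r0 := rho_neq0 Uz; have [_ _ p3] := psib_dot Uz.
rewrite dot0l add0r /sigma /tau.
have -> : dot (psi z) (vconj (psi z)) = dot (phi1 z) (vconj (psi z)).
  by rewrite {1}/psi dotDl dotNl dotZl (dotC (phi z)) p3 mulr0 subr0.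
rewrite /psi vconjD vconjN vconjZ dotDr dotNr dotZr.
have -> : dot (phi1 z) (vconj (phi z)) = beta z * rho z by rewrite /beta mulfVK.
by move: (beta z) ((beta z)^*) (rho z) r0 (dot _ _) => b bb r r0 d; field.
Qed.

Definition betaz := projT1 (cid isd_beta_ex).
Lemma isd_beta : isd U beta betaz sigma.
Proof. exact: (projT2 (cid isd_beta_ex)). Qed.

(** [psiz] is $\psi_z$, [gam] is $(\log\tau)_z$, and [chi] completes the Gram-Schmidt process for
    $\phi,\phi',\phi''$. *)
Definition psiz z := phi2 z - betaz z *: phi z - beta z *: phi1 z.
Definition gam z := dot (psiz z) (vconj (psi z)) / tau z.
Definition chi z := psiz z - gam z *: psi z.

Lemma isv_psi0 : isv U psi psiz (fun z => - sigma z *: phi z).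
Proof.
have h := isvD oU (nc_phi1 nc) (isvN oU (isvZ oU isd_beta (nc_phi nc))).
by apply: isv_eq h _ _ => z Uz; rewrite /psiz; vring.
Qed.

Lemma isv_psi : isv U psi (fun z => gam z *: psi z + chi z) (fun z => - sigma z *: phi z).
Proof. by apply: isv_eq isv_psi0 _ _ => z Uz //; rewrite /chi; vring. Qed.

Lemma psiz_dot z : U z -> [/\ dot (psiz z) (phi z) = 0, dot (psiz z) (psi z) = 0,
  dot (psiz z) (vconj (phi z)) = 0 & dot (psiz z) (psiz z) = dot (phi2 z) (phi2 z)].
Proof.
move=> Uz; have [p1 p2 p3] := psi_dot Uz.
have e1 : dot (psiz z) (phi z) = 0.
  rewrite /psiz !dot_lin (nc_00 nc)// (dotC (phi2 z)) (dot02 Uz) (dotC (phi1 z)) (dot01 Uz).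
  by rewrite !mulr0 !subr0.
split => //.
- have [h _] := isd_eq_cst oU (isd_dot oU isv_psi0 isv_psi0) (fun w Uw => let: And3 _ e _ := psi_dot Uw in e) Uz.
  by move: h; rewrite (dotC (psi z)); exact: half0.
- have [h _] := isd_eq_cst oU (isd_dot oU isv_psi0 (isv_conj oU (nc_phi nc)))
     (fun w Uw => let: And3 _ _ e := psi_dot Uw in e) Uz.
  by move: h; rewrite vconj0 dot0r addr0.
rewrite /psiz !dot_lin (dotC (phi2 z) (phi z)) (dotC (phi2 z) (phi1 z)) (dotC (phi1 z) (phi z)).
by rewrite (dot02 Uz) (dot12 Uz) (dot01 Uz) (nc_00 nc)// (nc_11 nc)//; gen_pairings; ring.
Qed.

(** The bilinear square of $\phi''$ survives the orthogonalisation because $\phi$ and $\phi'$ are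
    null, orthogonal to each other and to $\phi''$. This value later distinguishes the adjoint
    surface from a super-conformal one. *)
Lemma chi_dot z : U z -> [/\ dot (chi z) (phi z) = 0, dot (chi z) (psi z) = 0,
  dot (chi z) (vconj (phi z)) = 0, dot (chi z) (vconj (psi z)) = 0 &
  dot (chi z) (chi z) = dot (phi2 z) (phi2 z)].
Proof.
move=> Uz; have [p1 p2 p3] := psi_dot Uz; have [q1 q2 q3 q4] := psiz_dot Uz.
have e1 : dot (chi z) (psi z) = 0 by rewrite /chi dotDl dotNl dotZl q2 p2 mulr0 subr0.
split; rewrite ?e1 //.
- by rewrite /chi dotDl dotNl dotZl q1 p1 mulr0 subr0.
- by rewrite /chi dotDl dotNl dotZl q3 p3 mulr0 subr0.
- by rewrite /chi dotDl dotNl dotZl -/(tau z) /gam mulfVK ?tau_neq0// subrr.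
- rewrite {1}/chi dotDl dotNl dotZl !(dotC _ (chi z)) e1 mulr0 subr0.
  by rewrite /chi dotDl dotNl dotZl q4 (dotC (psi z)) q2 mulr0 subr0.
Qed.

Lemma isd_tau : isd U tau (fun z => gam z * tau z) (fun z => (gam z)^* * tau z).
Proof.
have h := isd_dot oU isv_psi0 (isv_conj oU isv_psi0).
apply: isd_eq h _ _ => z Uz; have [p1 p2 p3] := psi_dot Uz; have [b1 b2 b3] := psib_dot Uz.
  by rewrite vconjZ dotZr p3 mulr0 addr0 /gam mulfVK// tau_neq0.
rewrite dotZl (dotC (phi z)) b3 mulr0 add0r /gam rmorphM fmorphV /= tau_conj -dot_conj vconjK.
by rewrite mulfVK ?tau_neq0// dotC.
Qed.

Lemma isd_sigma : isd U sigma (fun z => (gam z - beta z) * sigma z)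
   (fun z => ((gam z)^* - (beta z)^*) * sigma z).
Proof.
have h := isdM oU isd_tau (isdV oU rho_neq0 isd_rho).
apply: isd_eq h _ _ => z Uz; have r0 := rho_neq0 Uz; rewrite /sigma;
by move: ((beta z)^*) ((gam z)^*) (beta z) (gam z) (tau z) (rho z) r0 => b' g' b g t r r0; field.
Qed.

Lemma smooth_gam : smooth U gam.
Proof.
have [sz _] := isv_smoothz oU isv_psi0.
have h := isdM oU (isd_dot oU (isv_self sz) (isv_conj oU isv_psi0)) (isdV oU tau_neq0 isd_tau).
exact: isd_smooth h.
Qed.

(** The factor in $\chi_{\bar z}=-\varepsilon\psi$, found by comparing mixed derivatives of
    [psi]. *)
Definition eps z := sigma z + ddzb gam z.
Definition chiz := vz chi.

Lemma isv_chi : isv U chi chiz (fun z => - eps z *: psi z).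
Proof.
have [sz _] := isv_smoothz oU isv_psi0.
have hp := isv_self sz; have hpb := isvZ oU (isdN oU isd_sigma) (nc_phi nc).
have h := isvD oU hp (isvN oU (isvZ oU (isd_self smooth_gam) isv_psi0)).
apply: isv_eq (isv_self (isv_smooth h)) _ _ => // z Uz.
have [_ ->] := isv_uniq (isv_self (isv_smooth h)) h Uz.
rewrite (isv_comm oU isv_psi0 hp hpb Uz) /eps /psi; vring.
Qed.

Section Adjoint.
Variables (F : R[i] -> vec).
Hypothesis hF : isv U F phi (fun=> 0).

(** $F+a\phi$ is the component of $F$ orthogonal to $\phi$ for the Hermitian product. [mm] and [kk]
    are the conjugate coefficients along [psi] and [chi], divided by [rho] as well so that $a_{\bar
    z}=\bar m$. *)
Definition aa z := - (dot (F z) (vconj (phi z)) / rho z).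
Definition mm z := - (dot (vconj (F z)) (psi z) / rho z).
Definition kk z := - (dot (vconj (F z)) (chi z) / rho z).

Lemma aa_conj z : (aa z)^* = - (dot (vconj (F z)) (phi z) / rho z).
Proof. by rewrite /aa rmorphN rmorphM fmorphV /= rho_conj -dot_conj vconjK. Qed.

Lemma mm_conj z : (mm z)^* = - (dot (F z) (vconj (psi z)) / rho z).
Proof. by rewrite /mm rmorphN rmorphM fmorphV /= rho_conj -dot_conj vconjK. Qed.

Lemma isd_aa : isd U aa (fun z => - 1 - aa z * beta z) (fun z => (mm z)^*).
Proof.
have h := isdN oU (isdM oU (isd_dot oU hF (isv_conj oU (nc_phi nc))) (isdV oU rho_neq0 isd_rho)).
apply: isd_eq h _ _ => z Uz; have r0 := rho_neq0 Uz.
  rewrite vconj0 dot0r -/(rho z) /aa; move: (dot _ _) (rho z) (beta z) r0 => d r b r0.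
  by field.
rewrite dot0l add0r mm_conj /psi vconjD vconjN vconjZ dotDr dotNr dotZr.
by move: (dot _ _) (dot _ _) (rho z) ((beta z)^*) r0 => d d' r b r0; field.
Qed.

Lemma isd_mm : isd U mm (fun z => (gam z - beta z) * mm z + kk z)
   (fun z => - ((aa z)^* * sigma z) - mm z * (beta z)^*).
Proof.
have h := isdN oU (isdM oU (isd_dot oU (isv_conj oU hF) isv_psi) (isdV oU rho_neq0 isd_rho)).
apply: isd_eq h _ _ => z Uz; have r0 := rho_neq0 Uz.
  rewrite vconj0 dot0l add0r dotDr dotZr /mm /kk.
  by move: (dot _ _) (dot _ _) (rho z) (beta z) (gam z) r0 => d d' r b g r0; field.
have [p1 p2 p3] := psi_dot Uz.
rewrite (dotC (vconj (phi z))) p3 add0r dotZr aa_conj /mm.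
by move: (dot _ _) (dot _ _) (rho z) ((beta z)^*) (sigma z) r0 => d d' r b s r0; field.
Qed.

Lemma isd_kk_ex : exists kz, isd U kk kz (fun z => - (eps z * mm z) - kk z * (beta z)^*).
Proof.
have h := isdN oU (isdM oU (isd_dot oU (isv_conj oU hF) isv_chi) (isdV oU rho_neq0 isd_rho)).
eexists; apply: isd_eq h _ _ => // z Uz; have r0 := rho_neq0 Uz.
have [q1 q2 q3 q4 q5] := chi_dot Uz.
rewrite (dotC (vconj (phi z))) q3 add0r dotZr /mm /kk.
by move: (dot _ _) (dot _ _) (rho z) ((beta z)^*) (eps z) r0 => d d' r b s r0; field.
Qed.

End Adjoint.
End NullCurve.

(** * The Willmore equation for the adjoint surface *)

Section AdjointWillmore.
Variables (R : realType) (n : nat) (U : set R[i]^o).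
Hypothesis oU : open U.
Variables (phi ps ch chz xh : R[i] -> 'rV[R[i]]_n).
Variables (rh si be ga ep a m k kz : R[i] -> R[i]).
Hypothesis h_phi : isv U phi (fun z => ps z + be z *: phi z) (fun=> 0).
Hypothesis h_ps : isv U ps (fun z => ga z *: ps z + ch z) (fun z => - si z *: phi z).
Hypothesis h_ch : isv U ch chz (fun z => - ep z *: ps z).
Hypothesis h_rh : isd U rh (fun z => be z * rh z) (fun z => (be z)^* * rh z).
Hypothesis h_si : isd U si (fun z => (ga z - be z) * si z) (fun z => ((ga z)^* - (be z)^*) * si z).
Hypothesis h_a : isd U a (fun z => - 1 - a z * be z) (fun z => (m z)^*).
Hypothesis h_m : isd U m (fun z => (ga z - be z) * m z + k z)
   (fun z => - ((a z)^* * si z) - m z * (be z)^*).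
Hypothesis h_k : isd U k kz (fun z => - (ep z * m z) - k z * (be z)^*).
Hypothesis si_conj : forall z, (si z)^* = si z.
Hypothesis rh0 : forall z, U z -> rh z != 0.
Hypothesis si0 : forall z, U z -> si z != 0.
Hypothesis d_phi : forall z, U z -> [/\ dot (phi z) (phi z) = 0, dot (phi z) (ps z) = 0,
  dot (phi z) (ch z) = 0 & dot (phi z) (vconj (phi z)) = rh z].
Hypothesis d_ps : forall z, U z -> [/\ dot (ps z) (ps z) = 0, dot (ps z) (ch z) = 0,
  dot (ps z) (vconj (phi z)) = 0 & dot (ps z) (vconj (ps z)) = si z * rh z].
Hypothesis d_ch : forall z, U z -> dot (ch z) (vconj (phi z)) = 0 /\ dot (ch z) (vconj (ps z)) = 0.

(** Packed as a product of equations to act as a single rewriting rule. *)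
Lemma dot_table z : U z ->
 ((dot (phi z) (phi z) = 0) * (dot (phi z) (ps z) = 0) * (dot (ps z) (phi z) = 0) *
  (dot (phi z) (ch z) = 0) * (dot (ch z) (phi z) = 0) *
  (dot (ps z) (ps z) = 0) * (dot (ps z) (ch z) = 0) * (dot (ch z) (ps z) = 0) *
  (dot (phi z) (vconj (phi z)) = rh z) * (dot (vconj (phi z)) (phi z) = rh z) *
  (dot (ps z) (vconj (ps z)) = (si z * rh z)%R) * (dot (vconj (ps z)) (ps z) = (si z * rh z)%R) *
  (dot (ps z) (vconj (phi z)) = 0) * (dot (vconj (phi z)) (ps z) = 0) *
  (dot (vconj (ps z)) (phi z) = 0) * (dot (phi z) (vconj (ps z)) = 0))%type *
 ((dot (ch z) (vconj (phi z)) = 0) * (dot (vconj (phi z)) (ch z) = 0) *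
  (dot (ch z) (vconj (ps z)) = 0) * (dot (vconj (ps z)) (ch z) = 0) *
  (dot (vconj (ch z)) (phi z) = 0) * (dot (phi z) (vconj (ch z)) = 0) *
  (dot (vconj (ch z)) (ps z) = 0) * (dot (ps z) (vconj (ch z)) = 0) *
  (dot (vconj (phi z)) (vconj (phi z)) = 0) * (dot (vconj (phi z)) (vconj (ps z)) = 0) *
  (dot (vconj (ps z)) (vconj (phi z)) = 0) * (dot (vconj (ps z)) (vconj (ps z)) = 0) *
  (dot (vconj (ch z)) (vconj (phi z)) = 0) * (dot (vconj (phi z)) (vconj (ch z)) = 0) *
  (dot (vconj (ch z)) (vconj (ps z)) = 0) * (dot (vconj (ps z)) (vconj (ch z)) = 0))%type.
Proof.
move=> Uz; have [p1 p2 p3 p4] := d_phi Uz; have [s1 s2 s3 s4] := d_ps Uz; have [c1 c2] := d_ch Uz.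
have cc (u v : 'rV[R[i]]_n) : dot u v = 0 -> dot (vconj u) (vconj v) = 0.
  by move=> e; rewrite dot_conj e conjC0.
have cv (u v : 'rV[R[i]]_n) : dot u (vconj v) = 0 -> dot (vconj u) v = 0.
  by move=> e; rewrite -[v]vconjK; exact: cc.
have sw (u v : 'rV[R[i]]_n) x : dot u v = x -> dot v u = x by rewrite dotC.
have e6 := cv _ _ s3; have e7 := cv _ _ c1; have e8 := cv _ _ c2.
have k1 := cc _ _ p1; have k2 := cc _ _ p2; have k3 := cc _ _ p3.
have k4 := cc _ _ s1; have k5 := cc _ _ s2.
exact ((p1, p2, sw _ _ _ p2, p3, sw _ _ _ p3, s1, s2, sw _ _ _ s2, p4, sw _ _ _ p4, s4, sw _ _ _ s4,
  s3, sw _ _ _ s3, e6, sw _ _ _ e6),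
 (c1, sw _ _ _ c1, c2, sw _ _ _ c2, e7, sw _ _ _ e7, e8, sw _ _ _ e8, k1, k2, sw _ _ _ k2, k4,
  sw _ _ _ k3, k3, sw _ _ _ k5, k5)).
Qed.

(** [xhz], [xhzb], [xhzz] are $\hat x_z$, $\hat x_{z\bar z}$, $\hat x_{zz}$, and [gmet] is the
    induced metric $\hat x_z\cdot\hat x_{\bar z}$. *)
Definition xhz z := a z *: ps z + m z *: vconj (phi z).
Definition gmet z := a z * (a z)^* * (si z * rh z) + m z * (m z)^* * rh z.
Definition xhzb z := (m z)^* *: ps z + m z *: vconj (ps z)
  - (a z * si z) *: phi z - ((a z)^* * si z) *: vconj (phi z).
Definition xhzz z := (ga z - be z) *: xhz z - ps z + a z *: ch z + k z *: vconj (phi z).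

Hypotheses (hx : isv U xh xhz (fun z => vconj (xhz z))) (rx : forall z, U z -> vconj (xh z) = xh z).
Hypothesis g0 : forall z, U z -> gmet z != 0.

Lemma xhzbar z : vconj (xhz z) = (a z)^* *: vconj (ps z) + (m z)^* *: phi z.
Proof. by rewrite /xhz vconjD !vconjZ vconjK. Qed.

Lemma isv_xhz : isv U xhz xhzz xhzb.
Proof.
have h := isvD oU (isvZ oU h_a h_ps) (isvZ oU h_m (isv_conj oU h_phi)).
by apply: isv_eq h _ _ => z Uz; cbv beta; rewrite /xhzz /xhzb /xhz ?vconj0 ?vconjD ?vconjZ; vring.
Qed.

Lemma xhz_dots z : U z -> [/\ dot (xhz z) (xhz z) = 0, dot (xhz z) (vconj (xhz z)) = gmet z,
   dot (xhz z) (phi z) = m z * rh z, dot (xhz z) (ps z) = 0 &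
   dot (xhz z) (ch z) = 0].
Proof.
move=> Uz; rewrite xhzbar /gmet /xhz.
by split; rewrite !(dotDl, dotDr, dotZl, dotZr) !(dot_table Uz); ring.
Qed.

Local Notation X z := (pt (xh z)).
Local Notation TG z v := (tg (xh z) v).

(** In the plane of $\psi$ and $\bar\phi$ the tangential argument is orthogonal to $\hat x_z$ for
    the Hermitian product. The multiple of the lift itself makes the vector orthogonal to the mixed
    second derivative as well, hence normal. *)
Definition nub z := TG z ((m z)^* *: ps z - ((a z)^* * si z) *: vconj (phi z)) + si z *: X z.

Lemma isd_gmet_ex : exists gz, isd U gmet gz
  (fun z => ((ga z)^* - (be z)^*) * gmet z + rh z * (m z * (k z)^* - a z * si z)).
Proof.
have h := isdD oU (isdM oU (isdM oU h_a (isd_conj oU h_a)) (isdM oU h_si h_rh))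
  (isdM oU (isdM oU h_m (isd_conj oU h_m)) h_rh).
eexists; apply: isd_eq h _ _ => // z Uz; cbv beta; rewrite /gmet.
by rewrite !(rmorphD, rmorphB, rmorphM, rmorphN, rmorph1) /= ?conjCK; ring.
Qed.

Lemma isv_tgx (v vz vb : R[i] -> 'rV[R[i]]_n) : isv U v vz vb ->
  isv U (fun z => TG z (v z)) (fun z => TG z (vz z) + dot (xhz z) (v z) *: infv)
    (fun z => TG z (vb z) + dot (vconj (xhz z)) (v z) *: infv).
Proof. by move=> hv; exact: (isv_tg oU hx hv). Qed.

Lemma xhb_dots z : U z -> [/\ dot (vconj (xhz z)) (phi z) = 0,
  dot (vconj (xhz z)) (ps z) = (a z)^* * (si z * rh z),
  dot (vconj (xhz z)) (vconj (phi z)) = (m z)^* * rh z,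
  dot (vconj (xhz z)) (vconj (ps z)) = 0 & dot (vconj (xhz z)) (ch z) = 0].
Proof.
by move=> Uz; rewrite xhzbar; split; rewrite dotDl !dotZl !(dot_table Uz); ring.
Qed.

Lemma isv_nub_ex : exists nz, isv U nub nz (fun z => ((ga z)^* - (be z)^*) *: nub z
  + (k z)^* *: TG z (ps z) + si z *: TG z (vconj (phi z))).
Proof.
have hv := isvD oU (isvZ oU (isd_conj oU h_m) h_ps)
  (isvN oU (isvZ oU (isdM oU (isd_conj oU h_a) h_si) (isv_conj oU h_phi))).
have h := isvD oU (isv_tgx hv) (isvZ oU h_si (isv_pt oU hx)).
eexists; apply: isv_eq h _ _ => // z Uz; cbv beta.
have [x1 x2 x3 x4 x5] := xhb_dots Uz.
rewrite dotDr dotNr !dotZr x2 x3 xhzbar vconjD vconjZ.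
rewrite !(rmorphD, rmorphB, rmorphM, rmorphN, rmorph1) /= ?conjCK /nub !tg_lin.
vring.
Qed.

Variables (Y N Yz M kappa : R[i] -> 'rV[R[i]]_(n + 1 + 1)) (s q om omz omb : R[i] -> R[i]).
Hypothesis mf : moving_frame U Y N Yz M kappa s q.
Hypotheses (om0 : forall z, U z -> om z != 0) (hom : isd U om omz omb).
Hypothesis YE : forall z, U z -> Y z = om z *: X z.
Local Notation normal z := (normal_at (Y z) (N z) (Yz z) (vconj (Yz z))).
Local Notation Pn z := (nproj (Y z) (N z) (Yz z) (vconj (Yz z))).

Lemma xhzb_val z : U z -> vzb xhz z = xhzb z.
Proof. by move=> Uz; have /isvP[_ /(_ z Uz)[]] := isv_xhz. Qed.

Lemma normal_tg z (v : 'rV[R[i]]_n) (c : R[i]) : U z -> dot v (xhz z) = 0 ->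
  dot v (vconj (xhz z)) = 0 -> dot v (xhzb z) = c * gmet z -> normal z (TG z v + c *: X z).
Proof.
move=> Uz h1 h2 h3; have [x1 x2 _ _ _] := xhz_dots Uz.
apply: (normal_pt oU hx mf hom YE Uz (xhzb_val Uz)); rewrite lorentzDl lorentzZl.
- by rewrite !lor_lift mulr0 addr0.
- by rewrite !lor_lift h1 mulr0 addr0.
- by rewrite !lor_lift h2 mulr0 addr0.
by rewrite !lorentzDr !lorentzZr !lor_lift h3 dotC x2; ring.
Qed.

Lemma xhzb_dots z : U z -> [/\ dot (xhzb z) (ch z) = 0, dot (xhzb z) (ps z) = m z * (si z * rh z),
  dot (xhzb z) (vconj (phi z)) = - (a z * si z * rh z) & dot (xhzb z) (vconj (ch z)) = 0].
Proof.
by move=> Uz; rewrite /xhzb; split; rewrite !(dotDl, dotNl, dotZl) !(dot_table Uz); ring.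
Qed.

Lemma normal_tg0 z (v : 'rV[R[i]]_n) : U z -> dot (xhz z) v = 0 ->
  dot (vconj (xhz z)) v = 0 -> dot (xhzb z) v = 0 -> normal z (TG z v).
Proof.
move=> Uz; rewrite !(dotC _ v) => h1 h2 h3; rewrite -[TG z _]addr0 -(scale0r (X z)).
by apply: normal_tg Uz h1 h2 _; rewrite h3 mul0r.
Qed.

Lemma normal_ch z : U z -> normal z (TG z (ch z)).
Proof.
move=> Uz; have [_ _ _ _ x5] := xhz_dots Uz; have [_ _ _ _ y5] := xhb_dots Uz.
by have [w1 _ _ _] := xhzb_dots Uz; exact: normal_tg0 Uz x5 y5 w1.
Qed.

Lemma normal_chb z : U z -> normal z (TG z (vconj (ch z))).
Proof.
move=> Uz; have [_ _ _ _ x5] := xhz_dots Uz; have [_ _ _ _ y5] := xhb_dots Uz.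
have [_ _ _ w4] := xhzb_dots Uz; apply: normal_tg0 Uz _ _ w4.
  by rewrite -[xhz z]vconjK dot_conj y5 conjC0.
by rewrite dot_conj x5 conjC0.
Qed.

Lemma normal_nub z : U z -> normal z (nub z).
Proof.
move=> Uz; have [x1 x2 x3 x4 x5] := xhz_dots Uz; have [y1 y2 y3 y4 y5] := xhb_dots Uz.
have [_ w2 w3 _] := xhzb_dots Uz.
have x6 : dot (xhz z) (vconj (phi z)) = 0 by rewrite -[xhz z]vconjK dot_conj y1 conjC0.
apply: (normal_tg Uz); rewrite dotC dotDr dotNr !dotZr.
- by rewrite x4 x6; ring.
- by rewrite y2 y3; ring.
by rewrite w2 w3 /gmet; ring.
Qed.

(** $\psi$ is a combination of the tangent vector $\hat x_z$ and the vector inside [nub]; the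
    projection keeps the latter. The next lemma treats $\bar\phi$ in the same way. *)
Lemma Pn_Q z : U z -> Pn z (TG z (ps z)) = (m z * rh z / gmet z) *: nub z.
Proof.
move=> Uz; have gn0 := g0 Uz.
have e : TG z (ps z) = (- (m z * rh z / gmet z * si z)) *: X z
  + ((a z)^* * (si z * rh z) / gmet z) *: TG z (xhz z)
  + 0 *: TG z (vconj (xhz z)) + (m z * rh z / gmet z) *: nub z.
  move: gn0; rewrite /nub /gmet {1}/xhz !tg_lin => gn0.
  by vfield.
rewrite {1}e (nproj_pt oU hx mf om0 hom YE _ _ _ _ Uz) nprojZ nproj_id//; exact: normal_nub.
Qed.

Lemma Pn_Pb z : U z -> Pn z (TG z (vconj (phi z))) = (- (a z * rh z / gmet z)) *: nub z.
Proof.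
move=> Uz; have gn0 := g0 Uz.
have e : TG z (vconj (phi z)) = (a z * rh z / gmet z * si z) *: X z
  + ((m z)^* * rh z / gmet z) *: TG z (xhz z)
  + 0 *: TG z (vconj (xhz z)) + (- (a z * rh z / gmet z)) *: nub z.
  move: gn0; rewrite /nub /gmet {1}/xhz !tg_lin => gn0.
  by vfield.
rewrite {1}e (nproj_pt oU hx mf om0 hom YE _ _ _ _ Uz) nprojZ nproj_id//; exact: normal_nub.
Qed.

(** The tensor required by the criterion. The denominators turn the pairings with $Y_z$ into the
    coefficients of the normal part of $\hat x_{zz}$. *)
Definition Cten z := (si z * rh z)^-1 *: TG z (ch z).
Definition nuten z := (- (si z * gmet z)^-1) *: nub z.
Definition Qten z := TG z (vconj (ps z)).
Definition Tten z := k z *: TG z (vconj (ps z)) + si z *: TG z (phi z).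

Lemma normal_scale z c v : normal z v -> normal z (c *: v).
Proof. by move=> [h1 h2 h3 h4]; split; rewrite lorentzZl ?h1 ?h2 ?h3 ?h4 mulr0. Qed.

Lemma Yz_pairings z : U z -> [/\ lorentz (Yz z) (Qten z) = om z * a z * (si z * rh z),
   lorentz (Yz z) (Tten z) = om z * (k z * a z * (si z * rh z) + si z * m z * rh z),
   lorentz (vconj (Yz z)) (Qten z) = 0 & lorentz (vconj (Yz z)) (Tten z) = 0].
Proof.
move=> Uz; have [eP eQ] := lift_Yz oU hx mf hom YE Uz.
have [x1 x2 x3 x4 x5] := xhz_dots Uz; have [y1 y2 y3 y4 y5] := xhb_dots Uz.
have x7 : dot (xhz z) (vconj (ps z)) = a z * (si z * rh z).
  by rewrite /xhz dotDl !dotZl !(dot_table Uz); ring.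
split.
- by rewrite eP /Qten lorentzDl !lorentzZl !lor_lift x7; ring.
- by rewrite eP /Tten lorentzDl !lorentzZl !lorentzDr !lorentzZr !lor_lift x7 x3; ring.
- by rewrite eQ /Qten lorentzDl !lorentzZl !lor_lift y4; ring.
- by rewrite eQ /Tten lorentzDl !lorentzZl !lorentzDr !lorentzZr !lor_lift y4 y1; ring.
Qed.

Lemma kappa_ten z : U z ->
  kappa z = lorentz (Yz z) (Qten z) *: Cten z + lorentz (Yz z) (Tten z) *: nuten z.
Proof.
move=> Uz; have [-> -> _ _] := Yz_pairings Uz.
have [soz _] := isd_smoothz oU hom.
have h := isvD oU (isvZ oU (isd_self soz) (isv_pt oU hx)) (isvZ oU hom (isv_tgx isv_xhz)).
have h' := isv_ext oU (mf_Yz mf) (fun w Uw => (lift_Yz oU hx mf hom YE Uw).1).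
have [e _] := isv_uniq h' h Uz.
have [x1 _ _ _ _] := xhz_dots Uz.
have fr := mf_frame mf Uz.
have -> : kappa z = Pn z (kappa z) by rewrite (nproj_id (mf_kappa mf Uz)).
have -> : Pn z (kappa z) = Pn z (((- (s z / 2)) *: Y z + 0 *: N z + 0 *: Yz z + 0 *: vconj (Yz z)) + kappa z).
  by rewrite nproj_span.
have -> : ((- (s z / 2)) *: Y z + 0 *: N z + 0 *: Yz z + 0 *: vconj (Yz z)) + kappa z =
    - (s z / 2) *: Y z + kappa z by vring.
rewrite e x1 scale0r addr0.
have s0 := si0 Uz; have r0 := rh0 Uz; have gn0 := g0 Uz.
have -> : ddz omz z *: X z + omz z *: TG z (xhz z) + (omz z *: TG z (xhz z) + om z *: TG z (xhzz z))
  = ddz omz z *: X z + (2 * omz z + om z * (ga z - be z)) *: TG z (xhz z) + 0 *: TG z (vconj (xhz z))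
   + (- om z *: TG z (ps z) + (om z * a z) *: TG z (ch z) + (om z * k z) *: TG z (vconj (phi z))).
  by rewrite /xhzz !tg_lin; vring.
rewrite (nproj_pt oU hx mf om0 hom YE _ _ _ _ Uz) !nprojD !nprojZ (Pn_Q Uz) (Pn_Pb Uz) (nproj_id (normal_ch Uz)).
rewrite /Cten /nuten; move: (nub z) (gmet z) gn0 => v g1 gn0.
by vfield; rewrite ?s0 ?r0 ?gn0.
Qed.

Lemma adjoint_willmore : willmore_residual_zero U Y N Yz kappa s.
Proof.
have [gz hg] := isd_gmet_ex; have [nz hn] := isv_nub_ex.
have sg0 z : U z -> si z * gmet z != 0 by move=> Uz; rewrite mulf_neq0 ?g0 ?si0.
have sr0 z : U z -> si z * rh z != 0 by move=> Uz; rewrite mulf_neq0 ?rh0 ?si0.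
have hC := isvZ oU (isdV oU sr0 (isdM oU h_si h_rh)) (isv_tgx h_ch).
have hnu := isvZ oU (isdN oU (isdV oU sg0 (isdM oU h_si hg))) hn.
have hQ := isv_tgx (isv_conj oU h_ps).
have hT := isvD oU (isvZ oU h_k hQ) (isvZ oU h_si (isv_tgx h_phi)).
apply: (willmore_criterion oU mf hC hnu hQ hT).
- by move=> z Uz; apply: normal_scale; exact: normal_ch.
- by move=> z Uz; apply: normal_scale; exact: normal_nub.
- move=> z Uz; have [_ _ y1 y2] := Yz_pairings Uz; split => //.
    by rewrite YE// lorentzZl lor_lift mulr0.
  by rewrite YE// lorentzZl lorentzDr !lorentzZr !lor_lift !mulr0 addr0 mulr0.
- move=> z Uz.
  have eN : vconj (nub z) = m z *: TG z (vconj (ps z)) - (a z * si z) *: TG z (phi z) + si z *: X z.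
    rewrite /nub vconjD vconjZ (tg_conj _ (rx Uz)) (pt_conj (rx Uz)) si_conj.
    rewrite vconjD vconjN !vconjZ vconjK rmorphM /= !conjCK si_conj.
    by rewrite !tg_lin.
  split; rewrite vconjZ ?eN ?(tg_conj _ (rx Uz)) ?(lorentzDr, lorentzZr) !lorentzZl ?(lorentzDl, lorentzNl, lorentzZl) !lor_lift
    !(dot_table Uz); ring.
- exact: kappa_ten.
move=> z v Uz hv; cbv beta.
have [y1 y2 y3 y4 y5] := xhb_dots Uz.
(* [v] lies in $V$ while the vector over $\bar\chi$ is normal; this disposes of the only term that
   is not a multiple of [nub] or of the vector over $\chi$. *)
have vch : lorentz v (TG z (vconj (ch z))) = 0.
  have [_ h2 h3 _] := normal_chb Uz; by case: hv => ->; rewrite lorentzC.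
rewrite vconjD vconjZ !tg_lin y5 y4 y1 !scale0r !addr0.
have s0 := si0 Uz; have r0 := rh0 Uz; have gn0 := g0 Uz.
have e1 := Pn_Q Uz; have e2 := Pn_Pb Uz; have e3 := nproj_id (normal_nub Uz).
have e4 := nproj_id (normal_ch Uz).
clear hv hC hnu hQ hT hn hg y1 y2 y3 y4 y5.
move: (nub z) (gmet z) gn0 e1 e2 e3 => vn g1 gn0 e1 e2 e3.
rewrite !(nprojD, nprojZ) e1 e2 e3 e4 !(lorentzDr, lorentzZr) lorentz0r vch.
by vfield; rewrite ?s0 ?r0 ?gn0.
Qed.

End AdjointWillmore.

(** * From moving frames to the invariants of a surface *)

Section ToDefinitions.
Variables (R : realType) (n : nat).
Local Notation vec := 'rV[R[i]]_(n + 1 + 1).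
Implicit Types (U : set R[i]^o).

Lemma moving_frame_sub U V (Y N Yz M kappa : R[i] -> vec) (s q : R[i] -> R[i]) : V `<=` U ->
  moving_frame U Y N Yz M kappa s q -> moving_frame V Y N Yz M kappa s q.
Proof.
move=> VU [h1 h2 h3 h4 [s1 s2 s3 s4] h6 h7].
have isub f fz fb : isd U f fz fb -> isd V f fz fb.
  by move=> [sf h]; split; [exact: smooth_sub VU sf|move=> z /VU; exact: h].
split; [by move=> j; exact: isub|by move=> j; exact: isub|..];
  try by move=> z /VU; auto.
by split; try (by apply: smooth_sub VU _); move=> j; apply: smooth_sub VU _.
Qed.

Lemma sub_sum4 (A B C D v : vec) : (v <= A + B + C + D)%MS <->
  exists a b c d, v = a *: A + b *: B + c *: C + d *: D.
Proof.
split=> [/sub_addsmxP[[v1 v2] /= ->]|[a [b [c [d ->]]]]].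
  have /sub_addsmxP[[v3 v4] /= ->] : (v1 *m (A + B + C)%MS <= A + B + C)%MS by exact: submxMl.
  have /sub_addsmxP[[v5 v6] /= ->] : (v3 *m (A + B)%MS <= A + B)%MS by exact: submxMl.
  exists (v5 0 0), (v6 0 0), (v4 0 0), (v2 0 0).
  by rewrite -!mul_scalar_mx -!mx11_scalar.
by rewrite !addmx_sub_adds ?scalemx_sub.
Qed.

Variables (U : set R[i]^o) (Y N Yz M kappa : R[i] -> vec) (s q : R[i] -> R[i]).
Hypothesis oU : open U.
Hypothesis mf : moving_frame U Y N Yz M kappa s q.
Variables (Yr Nr : R[i] -> 'rV[R]_(n + 1 + 1)).
Hypothesis YrE : forall z, U z -> cmap Yr z = Y z.
Hypothesis NrE : forall z, U z -> cmap Nr z = N z.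
Local Notation Pn z := (nproj (Y z) (N z) (Yz z) (vconj (Yz z))).

Let hYr : isv U (cmap Yr) Yz (fun z => vconj (Yz z)).
Proof. exact (isv_ext oU (mf_Y mf) (fun z Uz => esym (YrE Uz))). Qed.

Lemma vz_lift z : U z -> vz (cmap Yr) z = Yz z /\ vzb (cmap Yr) z = vconj (Yz z).
Proof. by case/isvP: hYr => _ h /h. Qed.

Lemma vz_vz_lift z : U z -> vz (vz (cmap Yr)) z = - (s z / 2) *: Y z + kappa z /\
  vzb (vz (cmap Yr)) z = M z.
Proof.
have h := isv_ext oU (mf_Yz mf) (fun z Uz => esym (vz_lift Uz).1).
by case/isvP: h => _ h /h.
Qed.

(** The real and imaginary parts of $Y_z$ span the same complex space as $Y_z$ and $Y_{\bar z}$, and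
    $Y_{z\bar z}$ may be traded for [N]. *)
Lemma Vspace_frame z : U z -> forall v, (v <= Vspace Yr z)%MS <->
  exists a b c d, v = a *: Y z + b *: N z + c *: Yz z + d *: vconj (Yz z).
Proof.
move=> Uz v; have [e1 e2] := vz_lift Uz; have [_ e3] := vz_vz_lift Uz.
have nz2 : (2 : R[i]) != 0 by rewrite pnatr_eq0.
have ni : ('i : R[i]) != 0 by exact: neq0Ci.
have re : reV (Yz z) = 2^-1 *: (Yz z + vconj (Yz z)).
  by apply/rowP => j; rewrite !mxE complexRe ReE mulrC.
have im : imV (Yz z) = (2 * 'i)^-1 *: (Yz z - vconj (Yz z)).
  by apply/rowP => j; rewrite !mxE complexIm ImE invfM invCi; ring.
rewrite /Vspace sub_sum4 YrE// e1 e3 (mf_M mf Uz) re im.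
split=> [[a [b [c [d ->]]]]|[a [b [c [d ->]]]]].
  exists (a - d * q z), (d / 2), (b / 2 + c / (2 * 'i)), (b / 2 - c / (2 * 'i)).
  by vring.
exists (a + 2 * b * q z), (c + d), ((c - d) * 'i), (2 * b).
by vfield.
Qed.

Lemma frame_dzb xi xz xb : isv U xi xz xb -> forall z, U z ->
  Dzb Yr xi z = Pn z (xb z).
Proof.
move=> /isvP[_ h] z Uz; have [_ e] := h z Uz.
rewrite /Dzb e; have [_ ->] := frame_proj (mf_frame mf Uz) (Vspace_frame Uz).
by [].
Qed.

Lemma frame_invariants y :
  (forall z, U z -> exists r : R, 0 < r /\ Yr z = r *: row_mx (y z) 1%:M) ->
  invariants U y Yr Nr s kappa.
Proof.
move=> hr; split.
  split; first exact: isv_smooth hYr.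
  move=> z Uz; split; first exact: hr.
  by have [-> ->] := vz_lift Uz; have [_ _ []] := mf_frame mf Uz.
move=> z Uz; have [h1 h2] := frame_proj (mf_frame mf Uz) (Vspace_frame Uz).
have [[p1 p2 p3 p4] [p5 p6 p7] _] := mf_frame mf Uz.
rewrite NrE// YrE//; have [-> _] := vz_lift Uz; have [-> _] := vz_vz_lift Uz.
split => //.
- apply/(Vspace_frame Uz); exists 0, 1, 0, 0; by vring.
- by split => //; rewrite lorentzC.
by apply/h1; exact (mf_kappa mf Uz).
Qed.

Lemma frame_willmore : willmore_residual_zero U Y N Yz kappa s -> forall z, U z ->
  Dzb Yr (Dzb Yr kappa) z + ((s z)^* / 2) *: kappa z = 0.
Proof.
move=> hW z Uz; have [_ _ _ sk] := mf_smooth mf.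
have hk := isv_self sk; have [_ skb] := isv_smoothz oU hk.
have hD := isv_self (nproj_smooth oU mf skb).
rewrite -(hW _ _ _ _ hk hD z Uz); congr (_ + _).
by rewrite (frame_dzb (isv_ext oU hD (fun w Uw => esym (frame_dzb hk Uw))) Uz).
Qed.

End ToDefinitions.

(** * Existence of canonical lifts *)

Section Existence.
Variables (R : realType) (n : nat) (U : set R[i]^o) (y : R[i] -> 'rV[R]_(n + 1)).
Hypothesis oU : open U.
Local Notation vec := 'rV[R[i]]_(n + 1 + 1).

Lemma isv_cmap m (f : R[i] -> 'rV[R]_m) : vsmooth U (cmap f) ->
  isv U (cmap f) (vz (cmap f)) (fun z => vconj (vz (cmap f) z)).
Proof.
move=> sf; have h := isv_self sf; apply: (isv_eq h) => // z Uz.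
have h' := isv_ext oU (isv_conj oU h) (fun w _ => cplx_conj (f w)).
by have [_ ->] := isv_uniq h h' Uz.
Qed.

(** The lift $(y,1)$ induces the metric $g=y_z\cdot y_{\bar z}$, and scaling it by $\omega$
    multiplies the metric by $\omega^2$; the canonical factor is therefore $\omega=(2g)^{-1/2}$. *)
Lemma conformal_frame : conformal_immersion U y ->
  exists om omz omb N Yz M kappa s q,
  [/\ moving_frame U (fun z => om z *: row_mx (cplx (y z)) 1%:M) N Yz M kappa s q,
      isd U om omz omb & forall z, U z -> om z = (complex.Re (om z))%:C /\ 0 < complex.Re (om z)].
Proof.
move=> [[sy y1] hy]; have hY := isv_cmap sy.
have vzbE z (Uz : U z) : vzb (cmap y) z = vconj (vz (cmap y) z).
  by case/isvP: hY => _ /(_ z Uz)[].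
move: (vz (cmap y)) (vzb (cmap y)) hY vzbE hy => p pb hY vzbE hy; pose g z := dot (p z) (vconj (p z)).
have nz2 : (2 : R[i]) != 0 by rewrite pnatr_eq0.
have gp z (Uz : U z) : 0 < g z.
  rewrite dot_conj_gt0; apply/eqP => e; have [_] := hy z Uz.
  by rewrite e dot0l.
have [sp _] := isv_smoothz oU hY.
have hg : isd U g _ _ := isd_dot oU (isv_self sp) (isv_conj oU (isv_self sp)).
have wp z (Uz : U z) : 0 < (2 * g z)^-1 by rewrite invr_gt0 mulr_gt0// ?ltr0n ?gp.
have w0 z (Uz : U z) : 2 * g z != 0 by rewrite mulf_neq0// gt_eqF// gp.
have hw := isdV oU w0 (isdM oU (isd_cst oU 2) hg).
have [om som [omE om2]] : exists2 om, smooth U om &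
    (forall z, U z -> om z = (complex.Re (om z))%:C /\ 0 < complex.Re (om z)) /\
    (forall z, U z -> om z ^+ 2 * g z = 2^-1).
  exists (fun z => csqrt_real (2 * g z)^-1); first exact: smooth_sqrt oU wp (isd_smooth hw).
  split=> z Uz.
    split=> //; rewrite /csqrt_real /= sqrtr_gt0.
    by move: (wp z Uz); rewrite ltcE => /andP[].
  have wr : (2 * g z)^-1 = (complex.Re (2 * g z)^-1)%:C by rewrite RRe_real// gtr0_real// wp.
  have -> : csqrt_real (2 * g z)^-1 ^+ 2 = (2 * g z)^-1.
    rewrite /csqrt_real -rmorphXn sqr_sqrtr ?[RHS]wr//.
    by move: (wp z Uz); rewrite ltcE => /andP[_ /ltW].
  by rewrite invfM mulfVK// gt_eqF// gp.
have hom := isd_self som.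
have hL : isv U (fun z => row_mx (cplx (y z)) (1%:M : 'rV_1))
    (fun z => row_mx (p z) 0) (fun z => row_mx (vconj (p z)) 0).
  by apply: isv_row => //; exact: isv_cst.
have lor (a b : 'rV[R[i]]_(n + 1)) (c d : R[i]) :
    lorentz (row_mx a c%:M) (row_mx b d%:M) = dot a b - c * d.
  rewrite /lorentz /lorentz_mx mul_row_block !mulmx0 addr0 mulmx1 add0r mulmxN mulmx1.
  rewrite tr_row_mx mul_row_col tr_scalar_mx !mxE !big_ord1 !mxE /= !mulr1n mulNr.
  by rewrite /dot mxE.
have s0 : (0 : 'rV[R[i]]_1) = 0%:M by rewrite raddf0.
have pLL z (Uz : U z) : lorentz (row_mx (cplx (y z)) (1%:M : 'rV_1)) (row_mx (cplx (y z)) 1%:M) = 0.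
  by rewrite lor dot_cplx y1// mulr1 rmorph1 subrr.
have dy z (Uz : U z) : dot (cplx (y z)) (p z) = 0.
  have c1 w (Uw : U w) : dot (cmap y w) (cmap y w) = 1 by rewrite dot_cplx y1// rmorph1.
  have [h _] := isd_eq_cst oU (isd_dot oU hY hY) c1 Uz.
  by apply: half0; rewrite -{1}dotC.
have hY' := isvZ oU hom hL.
pose Yz z := ddz om z *: row_mx (cplx (y z)) 1%:M + om z *: row_mx (p z) 0 : vec.
have omr z (Uz : U z) : (om z)^* = om z by have [-> _] := omE z Uz; rewrite conj_Creal// complex_real.
have ombE z (Uz : U z) : ddzb om z = (ddz om z)^*.
  have h := isd_ext oU (isd_conj oU hom) omr.
  by have [_ ->] := isd_uniq hom h Uz.
have c1 : vconj (1%:M : 'rV[R[i]]_1) = 1%:M by rewrite /vconj map_scalar_mx rmorph1.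
have rc (a : 'rV[R[i]]_(n + 1)) (b : 'rV_1) : vconj (row_mx a b) = row_mx (vconj a) (vconj b).
  exact: map_row_mx.
have YzE z (Uz : U z) : ddzb om z *: row_mx (cplx (y z)) 1%:M + om z *: row_mx (vconj (p z)) 0 =
    vconj (Yz z).
  have -> : vconj (Yz z) = (ddz om z)^* *: vconj (row_mx (cplx (y z)) (1%:M : 'rV_1))
      + (om z)^* *: vconj (row_mx (p z) 0) by rewrite /Yz vconjD !vconjZ.
  by rewrite (ombE z Uz) (omr z Uz) (rc (cplx (y z))) (rc (p z)) cplx_conj vconj0 c1.
have hYY : isv U (fun z => om z *: row_mx (cplx (y z)) 1%:M : vec) Yz (fun z => vconj (Yz z)).
  by apply: isv_eq hY' _ _ => // z Uz; exact: YzE.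
have hreal z (Uz : U z) : vconj (om z *: row_mx (cplx (y z)) 1%:M : vec) = om z *: row_mx (cplx (y z)) 1%:M.
  by rewrite vconjZ rc (omr z Uz) cplx_conj c1.
have pc z (Uz : U z) : dot (p z) (p z) = 0 by have [] := hy z Uz.
have [|N [M [kappa [s [q mf]]]]] := moving_frame_of_lift oU hYY hreal.
  move=> z Uz; have oo := om2 z Uz.
  have dyb : dot (cplx (y z)) (vconj (p z)) = 0.
    by rewrite -[cplx _]cplx_conj dot_conj dy// conjC0.
  split.
  - by rewrite lorentzZl lorentzZr pLL// !mulr0.
  - rewrite /Yz s0 !(lorentzDl, lorentzDr, lorentzZl, lorentzZr) !lor pc// (dotC (p z)) dy// dot_cplx y1//.
    by rewrite rmorph1; ring.
  rewrite -YzE// /Yz s0 !(lorentzDl, lorentzDr, lorentzZl, lorentzZr) !lor dyb (dotC (p z)) dy// dot_cplx y1//.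
  rewrite rmorph1 -/(g z).
  have -> : forall a b : R[i], a * (b * (1 - 1 * 1) + om z * (0 - 1 * 0)) + om z * (b * (0 - 0 * 1) + om z * (g z - 0 * 0)) = om z ^+ 2 * g z by move=> a b; ring.
  by rewrite oo.
by exists om, (ddz om), (ddzb om), N, Yz, M, kappa, s, q.
Qed.

(** Reduces the Willmore property to the frame equation over an unspecified multiple of $(y,1)$, so
    that its users need not know the canonical factor. *)
Lemma conformal_willmore : conformal_immersion U y ->
  (forall (om omz omb : R[i] -> R[i]) N Yz M kappa s q, 
     moving_frame U (fun z => om z *: row_mx (cplx (y z)) 1%:M) N Yz M kappa s q ->
     isd U om omz omb -> (forall z, U z -> om z != 0) ->
     willmore_residual_zero U (fun z => om z *: row_mx (cplx (y z)) 1%:M) N Yz kappa s) ->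
  willmore U y.
Proof.
move=> cy hW; split => //.
have [om [omz [omb [N [Yz [M [kappa [s [q [mf hom omE]]]]]]]]]] := conformal_frame cy.
pose Yr z := complex.Re (om z) *: row_mx (y z) (1%:M : 'rV_1).
pose Nr z := map_mx (@complex.Re R) (N z).
have YrE z : U z -> cmap Yr z = om z *: row_mx (cplx (y z)) 1%:M.
  move=> Uz; rewrite /cmap /Yr /cplx map_mxZ map_row_mx map_scalar_mx rmorph1.
  by have [e _] := omE z Uz; rewrite [in RHS]e.
have NrE z : U z -> cmap Nr z = N z.
  by move=> Uz; apply: cplx_reP; have [] := mf_real mf Uz.
exists Yr, Nr, s, kappa; split.
  apply: (frame_invariants oU mf YrE NrE) => z Uz.
  by exists (complex.Re (om z)); have [_ ?] := omE z Uz.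
have om0 z : U z -> om z != 0.
  by move=> Uz; have [-> h] := omE z Uz; rewrite (inj_eq (@complexI R)) gt_eqF.
exact: (frame_willmore oU mf YrE (hW _ _ _ _ _ _ _ _ _ mf hom om0)).
Qed.

End Existence.

Lemma dot_row_scalar (K : comNzRingType) (n : nat) (a b : 'rV[K]_n) (c d : K) :
  dot (row_mx a c%:M) (row_mx b d%:M) = dot a b + c * d.
Proof.
by rewrite /dot tr_row_mx mul_row_col tr_scalar_mx !mxE !big_ord1 !mxE /= !mulr1n.
Qed.

(** * Stereographic projection and the light cone *)

Section Stereographic.
Variables (R : realType) (n : nat).

(** The factor between the lift [pt] of a point of $\mathbb R^n$ and the lift of its stereographic
    image with last coordinate 1. *)
Definition conf_factor (p : 'rV[R[i]]_n) : R[i] := 2 / (dot p p + 1).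

Lemma real_dot_ge0 (x : 'rV[R]_n) : 0 <= dot (cplx x) (cplx x).
Proof. by rewrite -{2}cplx_conj dot_conj_ge0. Qed.

Lemma dot1_neq0 (x : 'rV[R]_n) : dot (cplx x) (cplx x) + 1 != 0.
Proof. by rewrite gt_eqF// ltr_wpDl ?real_dot_ge0. Qed.

Lemma conf_factor_neq0 (x : 'rV[R]_n) : conf_factor (cplx x) != 0.
Proof. by rewrite mulf_neq0 ?invr_eq0 ?dot1_neq0// pnatr_eq0. Qed.

Lemma stereo_pt (x : 'rV[R]_n) :
  row_mx (cplx (stereo x)) 1%:M = conf_factor (cplx x) *: pt (cplx x).
Proof.
have d0 := dot1_neq0 x; have nz2 : (2 : R[i]) != 0 by rewrite pnatr_eq0.
have -> : cplx (stereo x) = (dot (cplx x) (cplx x) + 1)^-1 *: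
    row_mx (2 *: cplx x) (dot (cplx x) (cplx x) - 1)%:M.
  rewrite /stereo /cplx map_mxZ map_row_mx map_mxZ map_scalar_mx fmorphV rmorphD rmorphB rmorph1.
  by rewrite rmorph_nat /= -!dot_cplx.
rewrite ptE /cone /conf_factor !scale_row_mx !scale_scalar_mx scalerA.
move: (dot _ _) d0 => d d0.
have -> : 2 / (d + 1) * (d / 2 - 1 / 2) = (d + 1)^-1 * (d - 1) by field.
have -> : 2 / (d + 1) * (d / 2 + 1 / 2) = 1 by field.
by rewrite [2 / _]mulrC.
Qed.

Lemma stereo_unit (x : 'rV[R]_n) : dot (stereo x) (stereo x) = 1.
Proof.
have d0 : dot x x + 1 != 0.
  by have := dot1_neq0 x; rewrite dot_cplx -(rmorph1 (real_complex R)) -rmorphD (inj_eq (@complexI R)).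
rewrite /stereo dotZl dotZr dot_row_scalar dotZl dotZr; move: (dot x x) d0 => d d0.
by field.
Qed.

Lemma pt_translate (p q : 'rV[R[i]]_n) :
  pt (p + q) = pt p + tg p q + (dot q q / 2) *: infv.
Proof.
have nz2 : (2 : R[i]) != 0 by rewrite pnatr_eq0.
rewrite !ptE tgE infvE -coneZ -coneD -coneD scaler0 mulr0 mulr1 !addr0.
congr cone; rewrite dotDl !dotDr (dotC q p).
by move: (dot p p) (dot p q) (dot q q) => a b c; field.
Qed.

Variable U : set R[i]^o.
Hypothesis oU : open U.

Lemma isd_conf_factor x xz xb : isv U (fun z => cplx (x z)) xz xb ->
  smooth U (fun z => conf_factor (cplx (x z))).
Proof.
move=> hx; have h := isdD oU (isd_dot oU hx hx) (isd_cst oU 1).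
exact: isd_smooth (isdM oU (isd_cst oU 2) (isdV oU (fun z _ => dot1_neq0 (x z)) h)).
Qed.

(* Rescaling a null vector field only rescales its induced metric, so [L] need not be the lift by [(y, 1)]. *)
Lemma sphere_conformal (y : R[i] -> 'rV[R]_(n + 1)) (L Lz Lb : R[i] -> 'rV[R[i]]_(n + 1 + 1))
    (f : R[i] -> R[i]) :
  isv U L Lz Lb -> smooth U f -> (forall z, U z -> row_mx (cplx (y z)) 1%:M = f z *: L z) ->
  (forall z, dot (y z) (y z) = 1) ->
  vsmooth U (cmap y) /\ forall z, U z ->
    dot (vz (cmap y) z) (vz (cmap y) z) = f z ^+ 2 * lorentz (Lz z) (Lz z) /\
    dot (vz (cmap y) z) (vzb (cmap y) z) = f z ^+ 2 * lorentz (Lz z) (Lb z).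
Proof.
move=> hL sf e yy; have hf := isd_self sf.
have hfL := isvZ oU hf hL.
have hR := isv_ext oU hfL (fun z Uz => esym (e z Uz)).
have sy : vsmooth U (cmap y).
  move=> j; have [h _] := hR (lshift 1 j).
  by apply: smooth_eq h => // z _; rewrite row_mxEl.
split=> // z Uz.
have hy := isv_self sy; have hy1 := isv_row oU hy (isv_cst oU (1%:M : 'rV[R[i]]_1)).
have [e1 e2] := isv_uniq hy1 hR Uz.
have lor (a b : 'rV[R[i]]_(n + 1)) : dot a b = lorentz (row_mx a (0 : 'rV_1)) (row_mx b 0).
  rewrite /lorentz /lorentz_mx mul_row_block !mulmx0 addr0 mulmx1 add0r mul0mx.
  by rewrite tr_row_mx mul_row_col mul0mx addr0.
have LL w : U w -> lorentz (f w *: L w) (f w *: L w) = 0.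
  move=> Uw; rewrite -e// /lorentz /lorentz_mx mul_row_block !mulmx0 addr0 mulmx1 add0r mulmxN mulmx1.
  rewrite tr_row_mx mul_row_col tr_scalar_mx mulmx1 mxE -/(dot _ _) dot_cplx yy !mxE eqxx mulr1n.
  by rewrite rmorph1 subrr.
have f0 w : U w -> f w != 0.
  move=> Uw; apply/eqP => fw0; have := e w Uw; rewrite fw0 scale0r => /(congr1 (fun v : 'rV[R[i]]_(n + 1 + 1) => v 0 (rshift (n + 1) 0))).
  by rewrite row_mxEr !mxE => /eqP; rewrite oner_eq0.
have LL0 w : U w -> lorentz (L w) (L w) = 0.
  move=> Uw; have := LL w Uw; rewrite lorentzZl lorentzZr => /eqP.
  by rewrite !mulf_eq0 (negbTE (f0 w Uw)) => /eqP.
have [d1 d2] := isd_eq_cst oU (isd_lorentz oU hL hL) LL0 Uz.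
have l1 : lorentz (L z) (Lz z) = 0 by apply: half0; rewrite -{1}lorentzC.
have l2 : lorentz (L z) (Lb z) = 0 by apply: half0; rewrite -{1}lorentzC.
have l3 := LL0 z Uz.
rewrite !lor e1 e2; move: (ddz f z) (ddzb f z) (f z) (L z) (Lz z) (Lb z) l1 l2 l3 => fz fb g A B C l1 l2 l3.
by rewrite !(lorentzDl, lorentzDr, lorentzZl, lorentzZr) (lorentzC B A) l1 l2 l3; split; ring.
Qed.

End Stereographic.

(** * The adjoint surface of a null curve *)

Section AdjointCurve.
Variables (R : realType) (n : nat) (U : set R[i]^o).
Hypothesis oU : open U.
Local Notation vec := 'rV[R[i]]_(n + 1 + 1).
Variables (phi phi1 phi2 F : R[i] -> 'rV[R[i]]_n) (x : R[i] -> 'rV[R]_n).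
Hypothesis nc : null_curve U phi phi1 phi2.
Hypothesis hF : isv U F phi (fun=> 0).
Hypothesis hx : isv U (cmap x) phi (fun z => vconj (phi z)).
Local Notation a := (aa phi F).
Local Notation m := (mm phi phi1 F).
Local Notation ps := (psi phi phi1).

(** $x+2\,\mathrm{Re}(a\phi)$ equals $b+2\,\mathrm{Re}\,F_\perp$ when $x=b+2\,\mathrm{Re}\,F$. In
    this form the constant of integration enters through $a$ alone. *)
Definition hatc z : 'rV[R[i]]_n := cplx (x z) + (a z *: phi z + vconj (a z *: phi z)).
Definition hatx z : 'rV[R]_n := map_mx (@complex.Re R) (hatc z).

Lemma hatxE z : cplx (hatx z) = hatc z.
Proof.
apply: cplx_reP; rewrite /hatc !vconjD vconjK cplx_conj; congr (_ + _); exact: addrC.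
Qed.

Lemma isv_hatx : isv U (cmap hatx) (xhz phi ps a m) (fun z => vconj (xhz phi ps a m z)).
Proof.
have haf := isvZ oU (isd_aa oU nc hF) (nc_phi nc).
have h := isvD oU hx (isvD oU haf (isv_conj oU haf)).
have h1 := isv_ext oU h (fun z _ => esym (hatxE z)).
apply: isv_eq h1 _ _ => z Uz; cbv beta; rewrite scaler0 addr0 /xhz /psi.
  by rewrite vconjZ conjCK; vring.
have -> (p1 p f : 'rV[R[i]]_n) (b c m0 : R[i]) : vconj (c *: (p1 - b *: p) + m0 *: f) =
   c^* *: (vconj p1 - b^* *: vconj p) + m0^* *: vconj f by rewrite !(vconjD, vconjN, vconjZ).
rewrite vconjK vconjD !vconjZ !(rmorphB, rmorphN, rmorphM, rmorph1) /=.
by vring.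
Qed.

Hypothesis imm : forall z, U z -> dot (F z) (vconj (phi z)) != 0 \/ dot (F z) (vconj (phi1 z)) != 0.

Lemma aa_mm_neq0 z : U z -> a z != 0 \/ m z != 0.
Proof.
move=> Uz; have r0 := rho_neq0 nc Uz.
have [e|a0] := eqVneq (a z) 0; [right|by left].
have f0 : dot (F z) (vconj (phi z)) = 0.
  move/eqP: e; rewrite /aa oppr_eq0 mulf_eq0 invr_eq0 (negbTE r0) orbF => /eqP.
  by [].
have [|f1] := imm Uz; first by rewrite f0 eqxx.
rewrite -conjC_eq0 mm_conj oppr_eq0 mulf_eq0 invr_eq0 (negbTE r0) orbF /psi vconjD vconjN vconjZ.
by rewrite dotDr dotNr dotZr f0 mulr0 subr0.
Qed.

Lemma gmet_gt0 z : U z -> 0 < gmet (rho phi) (sigma phi phi1) a m z.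
Proof.
move=> Uz; have rp : 0 < rho phi z by rewrite lt_def (rho_neq0 nc Uz) dot_conj_ge0.
have tp : 0 < tau phi phi1 z by rewrite lt_def (tau_neq0 nc Uz) dot_conj_ge0.
rewrite /gmet -(tauE nc Uz); have [h|h] := aa_mm_neq0 Uz.
  by apply: ltr_pwDl; [rewrite mulr_gt0// mul_conjC_gt0|rewrite mulr_ge0 ?mul_conjC_ge0 ?ltW].
by apply: ltr_wpDl; [rewrite mulr_ge0 ?mul_conjC_ge0 ?ltW|rewrite mulr_gt0// mul_conjC_gt0].
Qed.

Let phiE z : phi1 z = ps z + beta phi phi1 z *: phi z.
Proof. by rewrite /psi subrK. Qed.

Let h_phi : isv U phi (fun z => ps z + beta phi phi1 z *: phi z) (fun=> 0).
Proof. by apply: isv_eq (nc_phi nc) _ _ => z _ //; exact: phiE. Qed.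

Let d_phi z : U z -> [/\ dot (phi z) (phi z) = 0, dot (phi z) (ps z) = 0,
  dot (phi z) (chi oU nc z) = 0 & dot (phi z) (vconj (phi z)) = rho phi z].
Proof.
move=> Uz; have [p1 _ _] := psi_dot oU nc Uz; have [c1 _ _ _ _] := chi_dot oU nc Uz.
by split; [exact: (nc_00 nc)|rewrite dotC|rewrite dotC|].
Qed.

Let d_ps z : U z -> [/\ dot (ps z) (ps z) = 0, dot (ps z) (chi oU nc z) = 0,
  dot (ps z) (vconj (phi z)) = 0 & dot (ps z) (vconj (ps z)) = sigma phi phi1 z * rho phi z].
Proof.
move=> Uz; have [_ p2 p3] := psi_dot oU nc Uz; have [_ c2 _ _ _] := chi_dot oU nc Uz.
by split=> //; [rewrite dotC|rewrite -(tauE nc Uz)].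
Qed.

Let d_ch z : U z -> dot (chi oU nc z) (vconj (phi z)) = 0 /\ dot (chi oU nc z) (vconj (ps z)) = 0.
Proof. by move=> Uz; have [_ _ c3 c4 _] := chi_dot oU nc Uz. Qed.

Lemma hat_residual (om omz omb : R[i] -> R[i]) (Y N Yz M kappa : R[i] -> vec) s q :
  moving_frame U Y N Yz M kappa s q -> isd U om omz omb -> (forall z, U z -> om z != 0) ->
  (forall z, U z -> Y z = om z *: row_mx (cplx (stereo (hatx z))) 1%:M) ->
  willmore_residual_zero U Y N Yz kappa s.
Proof.
move=> mf hom om0 YE0; have [kz hk] := isd_kk_ex oU nc hF.
have sf := isd_conf_factor oU isv_hatx.
have ho := isd_self (smoothM oU (isd_smooth hom) sf).
have o0 z : U z -> om z * conf_factor (cplx (hatx z)) != 0.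
  by move=> Uz; rewrite mulf_neq0 ?conf_factor_neq0 ?om0.
have YE z : U z -> Y z = (om z * conf_factor (cplx (hatx z))) *: pt (cplx (hatx z)).
  by move=> Uz; rewrite YE0// stereo_pt scalerA.
have g0 z : U z -> gmet (rho phi) (sigma phi phi1) a m z != 0.
  by move=> Uz; rewrite gt_eqF// gmet_gt0.
exact (adjoint_willmore oU h_phi (isv_psi oU nc) (isv_chi oU nc) (isd_rho oU nc) (isd_sigma oU nc)
  (isd_aa oU nc hF) (isd_mm oU nc hF) hk (sigma_conj phi phi1) (rho_neq0 nc)
  (sigma_neq0 nc) d_phi d_ps d_ch isv_hatx (fun z _ => cplx_conj (hatx z)) g0 mf o0 ho YE).
Qed.

Lemma hat_conformal : conformal_immersion U (fun z => stereo (hatx z)).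
Proof.
have sf := isd_conf_factor oU isv_hatx.
have hp := isv_pt oU isv_hatx.
have [sy hy] := sphere_conformal oU hp sf (fun z _ => stereo_pt (hatx z)) (fun z => stereo_unit (hatx z)).
split; first by split=> // z _; exact: stereo_unit.
move=> z Uz; have [-> ->] := hy z Uz; rewrite !lor_lift.
have [-> -> _ _ _] := xhz_dots a m d_phi d_ps d_ch Uz.
rewrite mulr0; split => //; apply/eqP; rewrite mulf_neq0 ?expf_neq0 ?conf_factor_neq0//.
by rewrite gt_eqF// gmet_gt0.
Qed.

End AdjointCurve.

Lemma lift_square (R : realType) (n : nat) (p u v : 'rV[R[i]]_n) (c b1 b2 d : R[i]) :
  dot u u = 0 -> dot v v = 0 ->
  let w := c *: pt p - b1 *: tg p v - b2 *: tg p u + d *: infv in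
  lorentz w w = 2 * (b1 * b2 * dot u v - c * d).
Proof.
move=> u0 v0 w; rewrite /w -(scaleNr b1) -(scaleNr b2).
move: (- b1) (- b2) (opprK b1) (opprK b2) => e1 e2 <- <- {b1 b2 w}.
by rewrite !lor_lin !lor_lift u0 v0 (dotC v); move: (dot u v) => t; ring.
Qed.

(** * The invariants of a minimal surface *)

Section MinimalFrame.
Variables (R : realType) (n : nat) (U : set R[i]^o).
Hypothesis oU : open U.
Local Notation vec := 'rV[R[i]]_(n + 1 + 1).
Variables (phi phi1 phi2 F : R[i] -> 'rV[R[i]]_n) (x : R[i] -> 'rV[R]_n).
Hypothesis nc : null_curve U phi phi1 phi2.
Hypothesis hx : isv U (cmap x) phi (fun z => vconj (phi z)).
Local Notation a := (aa phi F).
Local Notation ps := (psi phi phi1).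
Local Notation rh := (rho phi).
Local Notation be := (beta phi phi1).
Local Notation bz := (betaz oU nc).
Local Notation X z := (pt (cmap x z)).
Local Notation TG z v := (tg (cmap x z) v).

Variables (Y N Yz M kappa : R[i] -> vec) (s q om omz0 omb0 : R[i] -> R[i]).
Hypothesis mf : moving_frame U Y N Yz M kappa s q.
Hypotheses (om0 : forall z, U z -> om z != 0) (hom0 : isd U om omz0 omb0).
Hypothesis YE : forall z, U z -> Y z = om z *: X z.
Local Notation normal z := (normal_at (Y z) (N z) (Yz z) (vconj (Yz z))).
Local Notation Pn z := (nproj (Y z) (N z) (Yz z) (vconj (Yz z))).

Let nz2 : (2 : R[i]) != 0. Proof. by rewrite pnatr_eq0. Qed.

Let om2 z : U z -> om z * om z * rh z = 2^-1.
Proof.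
move=> Uz; have [_ _ [_ _ <-]] := mf_frame mf Uz.
have [-> ->] := lift_Yz oU hx mf hom0 YE Uz.
rewrite !(lorentzDl, lorentzDr, lorentzZl, lorentzZr) !lor_lift /rho.
by move: (dot _ _) => d; ring.
Qed.

(** Logarithmic differentiation of the normalisation $\omega^2\rho=\frac12$. *)
Lemma isd_om : isd U om (fun z => - (be z * om z) / 2) (fun z => - ((be z)^* * om z) / 2).
Proof.
have hh := isdM oU (isdM oU hom0 hom0) (isd_rho oU nc).
apply: isd_eq hom0 _ _ => z Uz; have [e1 e2] := isd_eq_cst oU hh om2 Uz;
have o0 := om0 Uz; have r0 := rho_neq0 nc Uz.
  apply: (mulfI nz2); apply: (mulfI o0); apply: (mulfI r0).
  move: e1; move: (om z) (omz0 z) (be z) (rh z) => o oz b r e1.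
  by rewrite -[RHS]addr0 -[in RHS]e1; field.
apply: (mulfI nz2); apply: (mulfI o0); apply: (mulfI r0).
move: e2; move: (om z) (omb0 z) ((be z)^*) (rh z) => o oz b r e3.
by rewrite -[RHS]addr0 -[in RHS]e3; field.
Qed.

Let phi1E z : phi1 z = ps z + be z *: phi z.
Proof. by rewrite /psi subrK. Qed.

Lemma lift_Yz_min z : U z ->
  Yz z = - (be z * om z) / 2 *: X z + om z *: TG z (phi z) /\
  vconj (Yz z) = - ((be z)^* * om z) / 2 *: X z + om z *: TG z (vconj (phi z)).
Proof. by move=> Uz; exact (lift_Yz oU hx mf isd_om YE Uz). Qed.

Lemma isv_tgphi : isv U (fun z => TG z (phi z)) (fun z => TG z (phi1 z)) (fun z => rh z *: infv).
Proof.
apply: isv_eq (isv_tg oU hx (nc_phi nc)) _ _ => z Uz; cbv beta.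
  by rewrite (nc_00 nc)// scale0r addr0.
by rewrite tg0 add0r dotC.
Qed.

Lemma normal_psi z : U z -> normal z (TG z (ps z)).
Proof.
move=> Uz; have [p1 p2 p3] := psi_dot oU nc Uz.
have vz0 : vzb phi z = 0 by have /isvP[_ /(_ z Uz)[]] := nc_phi nc.
apply: (normal_pt oU hx mf isd_om YE Uz vz0).
- by rewrite lor_lift.
- by rewrite lor_lift.
- by rewrite lor_lift.
by rewrite tg0 add0r lorentzZr lor_lift mulr0.
Qed.

Lemma Yzz_min z : U z -> - (s z / 2) *: Y z + kappa z =
   (- bz z / 2 + be z * be z / 4) * om z *: X z + om z *: TG z (ps z).
Proof.
move=> Uz; have hb := isd_beta oU nc.
have h := isvD oU (isvZ oU (isdM oU (isdN oU (isdM oU hb isd_om)) (isd_cst oU 2^-1)) (isv_pt oU hx))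
   (isvZ oU isd_om isv_tgphi).
have h' := isv_ext oU (mf_Yz mf) (fun w Uw => (lift_Yz_min Uw).1).
have [-> _] := isv_uniq h' h Uz.
rewrite phi1E tgD tgZ; cbv beta; move: (bz z) (be z) (om z) => b1 b o; by vfield.
Qed.

Lemma kappa_min z : U z -> kappa z = om z *: TG z (ps z).
Proof.
move=> Uz; have e := Yzz_min Uz; have fr := mf_frame mf Uz.
have e1 : Pn z (- (s z / 2) *: Y z + 0 *: N z + 0 *: Yz z + 0 *: vconj (Yz z) + kappa z) = kappa z.
  by rewrite nproj_span// (nproj_id (mf_kappa mf Uz)).
rewrite -e1; have -> : - (s z / 2) *: Y z + 0 *: N z + 0 *: Yz z + 0 *: vconj (Yz z) + kappa z
  = - (s z / 2) *: Y z + kappa z by vring.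
have -> : - (s z / 2) *: Y z + kappa z = ((- bz z / 2 + be z * be z / 4) * om z) *: X z
   + 0 *: TG z (phi z) + 0 *: TG z (vconj (phi z)) + om z *: TG z (ps z) by rewrite e; vring.
rewrite (nproj_pt oU hx mf om0 isd_om YE _ _ _ _ Uz) nprojZ.
by rewrite (nproj_id (normal_psi Uz)).
Qed.

(** Once [kappa] is cancelled in [Yzz_min], pairing with [infv] compares the coefficients of the
    lift. *)
Lemma s_min z : U z -> s z = bz z - 2^-1 * be z ^+ 2.
Proof.
move=> Uz; have := Yzz_min Uz; rewrite (kappa_min Uz) => /addIr.
rewrite YE// scalerA => e; have := congr1 (fun v => lorentz v infv) e.
rewrite /= !lorentzZl lor_lift !mulrN1 => /oppr_inj; have o0 := om0 Uz.
move: (om z) (bz z) (be z) (s z) o0 => o b1 b s0 o0 e1.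
have e2 : (- (s0 / 2)) = (- b1 / 2 + b * b / 4) by apply: (mulIf o0).
have -> : s0 = - 2 * (- (s0 / 2)) by field.
by rewrite e2; field.
Qed.

Lemma Dkappa_min kz kb : isv U kappa kz kb -> forall z, U z ->
  Pn z (kb z) = - ((be z)^* / 2) *: kappa z.
Proof.
move=> hk z Uz; have hps := isv_psi oU nc; have [p1 p2 p3] := psi_dot oU nc Uz.
have h := isvZ oU isd_om (isv_tg oU hx hps).
have hk' := isv_ext oU hk kappa_min.
have [_ ->] := isv_uniq hk' h Uz.
rewrite (dotC _ (ps z)) p3 scale0r addr0 tgZ.
have -> : (- ((be z)^* * om z) / 2) *: TG z (ps z) + om z *: (- sigma phi phi1 z *: TG z (phi z))
  = 0 *: X z + (- (om z * sigma phi phi1 z)) *: TG z (phi z) + 0 *: TG z (vconj (phi z))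
   + (- ((be z)^* * om z) / 2) *: TG z (ps z) by vring.
rewrite (nproj_pt oU hx mf om0 isd_om YE _ _ _ _ Uz) nprojZ (nproj_id (normal_psi Uz)).
by rewrite kappa_min//; vring.
Qed.

(** Two applications of $D_{\bar z}\kappa=-\frac{\bar\beta}2\kappa$ give $-\frac12\bar\beta_{\bar
    z}\kappa+\frac14\bar\beta^2\kappa$, which is $-\frac{\bar s}2\kappa$. *)
Lemma minimal_residual : willmore_residual_zero U Y N Yz kappa s.
Proof.
move=> kz kb Dz Db hk hD z Uz.
have hb := isd_conj oU (isd_beta oU nc).
have h := isvZ oU (isdN oU (isdM oU hb (isd_cst oU 2^-1))) hk.
have hD' := isv_ext oU hD (Dkappa_min hk).
have [_ ->] := isv_uniq hD' h Uz.
rewrite nprojD !nprojZ (nproj_id (mf_kappa mf Uz)) (Dkappa_min hk Uz) (s_min Uz).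
have cE (b1 b : R[i]) : (b1 - 2^-1 * b ^+ 2)^* = b1^* - 2^-1 * b^* ^+ 2.
  by rewrite rmorphB rmorphM rmorphXn /= fmorphV rmorph_nat.
move: (bz z) (be z) => b1 b; rewrite cE; move: (b1^*) (b^*) => c1 c.
by vfield.
Qed.

(** Both sides are expanded in the lift of $x$, its two derivatives and [infv]. The summand $\beta$
    of $\mu$ cancels the terms in $\beta$ that $N$ and $Y_z$ carry, and $2/a$ produces the
    translation by $2\,\mathrm{Re}(a\phi)$. *)
Lemma adjoint_min z : U z -> a z != 0 -> let mu := be z + 2 / a z in
  (2^-1 * `|mu| ^+ 2) *: Y z + mu^* *: Yz z + mu *: vconj (Yz z) + N z =
  (2 * om z / (a z * (a z)^*)) *: pt (hatc phi F x z).
Proof.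
move=> Uz a0 mu; have o0 := om0 Uz; have r0 := rho_neq0 nc Uz.
have ab0 : (a z)^* != 0 by rewrite conjC_eq0.
have [eP eQ] := lift_Yz_min Uz.
(* [N] is a combination of [X], the two tangent vectors and [infv]; <N, N> = 0 fixes the coefficient of [X]. *)
have eM : M z = (ddzb (fun w => - (be w * om w) / 2) z) *: X z
   + (- (be z * om z) / 2) *: TG z (vconj (phi z)) + (- ((be z)^* * om z) / 2) *: TG z (phi z)
   + (om z * rh z) *: infv.
  have [_ sb] := isd_smoothz oU isd_om; have [sz _] := isd_smoothz oU isd_om.
  have h := isvD oU (isvZ oU (isd_self sz) (isv_pt oU hx)) (isvZ oU isd_om isv_tgphi).
  have h' := isv_ext oU (mf_Yz mf) (fun w Uw => (lift_Yz_min Uw).1).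
  have [_ ->] := isv_uniq h' h Uz.
  by vring.
have eN : exists c, N z = c *: X z - (be z * om z) *: TG z (vconj (phi z))
    - ((be z)^* * om z) *: TG z (phi z) + (om z)^-1 *: infv.
  exists (2 * ddzb (fun w => - (be w * om w) / 2) z + 2 * q z * om z).
  have -> : N z = 2 *: M z + (2 * q z) *: Y z by rewrite (mf_M mf Uz); vfield.
  rewrite eM (YE Uz).
  have -> : (om z)^-1 = 2 * (om z * rh z).
    by apply: (mulfI o0); rewrite divff// mulrCA !mulrA -[2 * _ * _]mulrA -mulrA om2// divff.
  move: (ddzb _ _) (om z) (be z) ((be z)^*) (rh z) (q z) => d o b b' r q0. by vfield.
case: eN => c eN.
have ec : c = om z * (be z * (be z)^*) / 2.
  have [[_ + _ _] _ _] := mf_frame mf Uz.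
  have f0 := nc_00 nc Uz.
  have fb0 : dot (vconj (phi z)) (vconj (phi z)) = 0 by rewrite dot_conj f0 conjC0.
  rewrite eN (lift_square _ _ _ _ _ f0 fb0) -/(rh z) => e.
  have o2 := om2 Uz.
  move: (om z) (be z) ((be z)^*) (rh z) o0 o2 e => o b b' r o0 o2 e.
  apply: (mulIf (invr_neq0 o0)); apply: (mulfI nz2).
  have -> : 2 * (o * (b * b') / 2 / o) = 2 * (b * b') * (o * o * r) by rewrite o2; field.
  apply/eqP; rewrite -subr_eq0 -oppr_eq0 opprB; apply/eqP; rewrite -[RHS]e; field.
  by [].
have eh : pt (hatc phi F x z) = X z + a z *: TG z (phi z) + (a z)^* *: TG z (vconj (phi z))
    + (a z * (a z)^* * rh z) *: infv.
  have f0 := nc_00 nc Uz.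
  have fb0 : dot (vconj (phi z)) (vconj (phi z)) = 0 by rewrite dot_conj f0 conjC0.
  rewrite /hatc -[cplx (x z)]/(cmap x z) pt_translate tgD vconjZ !tgZ; congr (_ + _ *: _); first by rewrite addrA.
  rewrite !(dotDl, dotDr, dotZl, dotZr) f0 fb0 (dotC (vconj (phi z))) -/(rh z).
  by move: ((a z)^*) (a z) (rh z) => a1 a2 r; field.
have mE (b a1 : R[i]) : (b + 2 / a1)^* = b^* + 2 / a1^*.
  by rewrite rmorphD rmorphM /= fmorphV rmorph_nat.
rewrite normCK eQ eN eP eh ec (YE Uz) /mu mE.
have o2 := om2 Uz.
have -> : rh z = (2 * om z * om z)^-1.
  by apply: (mulfI o0); apply: (mulfI o0); rewrite mulrA o2; field.
move: (om z) (be z) ((be z)^*) (a z) ((a z)^*) o0 a0 ab0 => o b b' a1 a2 o0 a0 ab0.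
by vfield; rewrite o0 a0 ab0.
Qed.

End MinimalFrame.

(** Applied to $Y_{zz}+\frac s2Y$ for a lift of the adjoint surface: only the second derivative of
    the surface contributes to $\langle\kappa,\kappa\rangle$. *)
Lemma lift_jet_square (R : realType) (n : nat) (p u w : 'rV[R[i]]_n) (b1 b2 b3 b4 b5 k : R[i]) :
  dot u u = 0 -> dot u w = 0 ->
  let v := b1 *: pt p + b2 *: tg p u + (b3 *: tg p u + b4 *: tg p w) + k *: (b5 *: pt p) in
  lorentz v v = b4 ^+ 2 * dot w w.
Proof.
move=> u0 uw v; rewrite /v scalerA; move: (k * b5) => {v k b5} k.
rewrite !(lorentzDl, lorentzDr, lorentzZl, lorentzZr) !lor_lift u0 uw (dotC w) uw.
by move: (dot w w) => d; ring.
Qed.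

Lemma open_nonzero (R : realType) (U : set R[i]^o) (f : R[i] -> R[i]) :
  open U -> smooth U f -> open ([set z | U z /\ f z != 0] : set R[i]^o).
Proof.
move=> oU sf; rewrite openE => z [Uz f0]; rewrite /interior.
have n1 : \forall w \near (z : R[i]^o), U w by exact: open_nbhs_nbhs.
have c : cts f z by exact: smooth_cts sf Uz.
have n2 : \forall w \near (z : R[i]^o), `|f z - f w| < `|f z|.
  have p0 : 0 < `|f z| by rewrite normr_gt0.
  exact: (c _ (nbhs_distC (f z) p0)).
apply: filterS2 n1 n2 => w Uw lt; split => //; apply: contraTneq lt => ->.
by rewrite subr0 ltxx.
Qed.

(** * The adjoint surface of a minimal surface *)

Section MinimalAdjoint.
Variables (R : realType) (n : nat) (U : set R[i]^o).
Hypothesis oU : open U.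
Local Notation vec := 'rV[R[i]]_(n + 1 + 1).
Variables (phi phi1 phi2 F : R[i] -> 'rV[R[i]]_n) (x : R[i] -> 'rV[R]_n).
Hypothesis nc : null_curve U phi phi1 phi2.
Hypothesis hF : isv U F phi (fun=> 0).
Hypothesis hx : isv U (cmap x) phi (fun z => vconj (phi z)).
Local Notation a := (aa phi F).
Local Notation m := (mm phi phi1 F).
Local Notation y := (fun z => stereo (x z)).

Lemma conf_factor_conj (p : 'rV[R]_n) : (conf_factor (cplx p))^* = conf_factor (cplx p).
Proof.
have h : dot (cplx p) (cplx p) + 1 = (dot p p + 1)%:C by rewrite dot_cplx rmorphD rmorph1.
by rewrite /conf_factor rmorphM fmorphV /= rmorph_nat h conj_Creal// complex_real.
Qed.

Lemma minimal_conformal : conformal_immersion U y.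
Proof.
have sf := isd_conf_factor oU hx.
have hp := isv_pt oU hx.
have [sy hy] := sphere_conformal oU hp sf (fun z _ => stereo_pt (x z)) (fun z => stereo_unit (x z)).
split; first by split=> // z _; exact: stereo_unit.
move=> z Uz; have [-> ->] := hy z Uz; rewrite !lor_lift (nc_00 nc)// mulr0; split => //.
by apply/eqP; rewrite mulf_neq0 ?expf_neq0 ?conf_factor_neq0// (rho_neq0 nc Uz).
Qed.

Lemma minimal_willmore : willmore U y.
Proof.
apply: (conformal_willmore oU minimal_conformal) => om omz omb N Yz M kappa s q mf hom om0.
have sf := isd_conf_factor oU hx.
have ho := isd_self (smoothM oU (isd_smooth hom) sf).
have o0 z : U z -> om z * conf_factor (cplx (x z)) != 0.
  by move=> Uz; rewrite mulf_neq0 ?conf_factor_neq0 ?om0.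
have YE z : U z -> om z *: row_mx (cplx (y z)) 1%:M = (om z * conf_factor (cplx (x z))) *: pt (cplx (x z)).
  by move=> _; rewrite stereo_pt scalerA.
exact (minimal_residual oU nc hx mf o0 ho YE).
Qed.

(** If [aa] vanished on an open set, $a_z=-1-a\beta$ would read $0=-1$. *)
Lemma aa_dense (V : set R[i]^o) : open V -> V `<=` U -> V !=set0 -> exists2 z, V z & a z != 0.
Proof.
move=> oV VU [z0 Vz0]; apply: contrapT => /forall2NP h.
have ha := isd_aa oU nc hF.
have ha' : isd V a (fun z => - 1 - a z * beta phi phi1 z) (fun z => (m z)^*).
  by case: ha => sa ea; split => [|z /VU]; [exact: smooth_sub VU sa|exact: ea].
have e z : V z -> a z = 0 by move=> Vz; have [//|/negP] := h z; rewrite negbK => /eqP.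
have [+ _] := isd_eq_cst oV ha' e Vz0.
by rewrite e// mul0r subr0 => /eqP; rewrite oppr_eq0 oner_eq0.
Qed.

Lemma adjoint_of_minimal : vsmooth U (cmap (fun z => stereo (hatx phi F x z))) ->
  adjoint_surface U y (fun z => stereo (hatx phi F x z)).
Proof.
move=> syh; split; first exact: minimal_willmore.
  by split => // z _; exact: stereo_unit.
pose U' := [set z | U z /\ a z != 0] : set R[i]^o.
have U'U : U' `<=` U by move=> z [].
have oU' : open U' by exact: open_nonzero oU (isd_smooth (isd_aa oU nc hF)).
exists U'; split => //.
  move=> z Uz V nV; have oV : open (U `&` V°) by apply: openI => //; exact: open_interior.
  have [w [Uw Vw] w0] : exists2 w, (U `&` V°) w & a w != 0.
    by apply: (aa_dense oV); [move=> ? []|exists z; split => //; exact: nbhs_singleton (nbhs_interior nV)].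
  by exists w; split; [split|exact: interior_subset Vw].
have [om [omz [omb [N [Yz [M [kappa [s [q [mf hom omE]]]]]]]]]] := conformal_frame oU minimal_conformal.
have mf' := moving_frame_sub U'U mf.
pose Yr z := complex.Re (om z) *: row_mx (y z) (1%:M : 'rV_1).
pose Nr z := map_mx (@complex.Re R) (N z).
have YrE z : U z -> cmap Yr z = om z *: row_mx (cplx (y z)) 1%:M.
  move=> Uz; have [e _] := omE z Uz; rewrite /Yr /cmap /cplx map_mxZ map_row_mx map_scalar_mx /= rmorph1.
  by rewrite -/(cplx _) -e.
have NrE z : U z -> cmap Nr z = N z.
  by move=> Uz; have [_ rN _] := mf_real mf Uz; exact: cplx_reP.
have om0 z : U z -> om z != 0 by move=> Uz; have [-> h] := omE z Uz; rewrite gt_eqF// ltcR.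
exists Yr, Nr, s, kappa; split.
  apply: (frame_invariants oU' mf' (fun z h => YrE z (U'U _ h)) (fun z h => NrE z (U'U _ h))) => z [Uz _].
  by exists (complex.Re (om z)); split => //; have [] := omE z Uz.
have sf := isd_conf_factor oU hx.
have ho := isd_self (smoothM oU (isd_smooth hom) sf).
have o0 z : U z -> om z * conf_factor (cplx (x z)) != 0.
  by move=> Uz; rewrite mulf_neq0 ?conf_factor_neq0 ?om0.
have YE z : U z -> om z *: row_mx (cplx (y z)) 1%:M = (om z * conf_factor (cplx (x z))) *: pt (cmap x z).
  by move=> _; rewrite stereo_pt scalerA.
have sub f fz fb : isd U f fz fb -> isd U' f fz fb.
  by move=> [sff ef]; split => [|z /U'U]; [exact: smooth_sub U'U sff|exact: ef].
have hmu := isdD oU' (sub _ _ _ (isd_beta oU nc))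
  (isdM oU' (isd_cst oU' 2) (isdV oU' (fun z (h : U' z) => h.2) (sub _ _ _ (isd_aa oU nc hF)))).
(* The solution $\mu=\beta$ of the Riccati equation belongs to the point at infinity; its other
   solutions are $\beta+2/a$ with $a_z=-1-a\beta$. *)
exists (fun z => beta phi phi1 z + 2 * (a z)^-1); split; first exact: isd_smooth hmu.
move=> z [Uz a0]; have ab0 : (a z)^* != 0 by rewrite conjC_eq0.
have [vzY vzbY] := vz_lift oU mf YrE Uz.
split.
- pose k := 2 * (om z * conf_factor (cplx (x z))) / (a z * (a z)^*) / conf_factor (cplx (hatx phi F x z)).
  have k0 : k != 0.
    have nz2 : (2 : R[i]) != 0 by rewrite pnatr_eq0.
    have aa0 := mulf_neq0 a0 ab0.
    exact: (mulf_neq0 (mulf_neq0 (mulf_neq0 nz2 (o0 z Uz)) (invr_neq0 aa0)) (invr_neq0 (conf_factor_neq0 _))).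
  have rk : k^* = k.
    have ro : (om z)^* = om z by have [-> _] := omE z Uz; rewrite conj_Creal// complex_real.
    have gE (o c a1 h : R[i]) : o^* = o -> c^* = c -> h^* = h ->
        (2 * (o * c) / (a1 * a1^*) / h)^* = 2 * (o * c) / (a1 * a1^*) / h.
      move=> e1 e2 e3; rewrite !rmorphM !fmorphV !rmorphM /= e1 e2 e3 conjCK rmorph_nat.
      by rewrite (mulrC _ a1).
    exact: gE ro (conf_factor_conj _) (conf_factor_conj _).
  have kE : (complex.Re k)%:C = k.
    move: rk; case: (k) => u v /eqP; rewrite eq_complex /= => /andP[_ /eqP e].
    by congr Complex; lra.
  exists (complex.Re k); split; first by rewrite -(inj_eq (@complexI R)) kE.
  rewrite vzY vzbY YrE// NrE// (adjoint_min oU nc hx mf o0 ho YE Uz a0) -hatxE kE /cplx map_row_mx.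
  rewrite map_scalar_mx /= rmorph1 -/(cplx _) stereo_pt scalerA mulfVK ?conf_factor_neq0//.
- have [-> _] := hmu.2 z (conj Uz a0); rewrite (s_min oU nc hx mf o0 ho YE Uz).
  move: (betaz oU nc z) (beta phi phi1 z) (a z) a0 => b1 b a1 a0.
  by rewrite mul0r add0r; field.
have [_ _ _ sk] := mf_smooth mf'; have [_ _ _ skU] := mf_smooth mf.
cbv zeta; rewrite (frame_dzb oU' mf' (fun z h => YrE z (U'U _ h)) (isv_self sk) (conj Uz a0)).
rewrite (Dkappa_min oU nc hx mf o0 ho YE (isv_self skU) Uz).
rewrite -scalerDl lorentzZl lorentzZr (kappa_min oU nc hx mf o0 ho YE Uz) lorentzZl lorentzZr lor_lift.
by have [_ -> _] := psi_dot oU nc Uz; rewrite !mulr0.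
Qed.

(** Among the bilinear products of $\psi$, $\chi$ and $\bar\phi$, which span $\hat x_{zz}$, only
    $\chi\cdot\chi$ can be nonzero. *)
Lemma xhzz_square z : U z ->
  let w := xhzz phi (psi phi phi1) (chi oU nc) (beta phi phi1) (gam oU nc) a m (kk oU nc F) z in
  dot w w = a z ^+ 2 * dot (phi2 z) (phi2 z).
Proof.
move=> Uz w; have [p1 p2 p3] := psi_dot oU nc Uz.
have [c1 c2 c3 c4 c5] := chi_dot oU nc Uz.
have f0 := nc_00 nc Uz.
have fb0 : dot (vconj (phi z)) (vconj (phi z)) = 0 by rewrite dot_conj f0 conjC0.
have p2' : dot (vconj (phi z)) (psi phi phi1 z) = 0 by rewrite dotC.
have c2' : dot (psi phi phi1 z) (chi oU nc z) = 0 by rewrite dotC.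
have c3' : dot (vconj (phi z)) (chi oU nc z) = 0 by rewrite dotC.
rewrite /w /xhzz /xhz -c5.
move: (gam oU nc z - beta phi phi1 z) (a z) (m z) (kk oU nc F z) p2 p3 c2 c3 p2' c2' c3' fb0 => g a1 m1 k1.
move: (psi phi phi1 z) (chi oU nc z) (vconj (phi z)) => P C B p2 p3 c2 c3 p2' c2' c3' fb0.
by rewrite !dot_lin p2 p3 c2 c3 p2' c2' c3' fb0; move: (dot C C) => t; ring.
Qed.

(** For any canonical lift $\langle\kappa,\kappa\rangle=\omega^2a^2\,\phi''\cdot\phi''$. The last
    factor is nonzero near [z0], and $a$ is nonzero somewhere in that neighbourhood. *)
Lemma adjoint_not_superconformal z0 : U z0 -> dot (phi2 z0) (phi2 z0) != 0 ->
  ~ superconformal U (fun z => stereo (hatx phi F x z)).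
Proof.
move=> Uz0 n0 [Y [N [s [kappa [[[sY hY] hinv] hk]]]]].
have hc := isv_hatx oU nc hF hx.
have hYv := isv_cmap oU sY.
(* The factor of an arbitrary lift, recovered by pairing with [infv]. *)
pose om z := - lorentz (cmap Y z) infv.
have hom : isd U om _ _ := isdN oU (isd_lorentz oU hYv (isv_cst oU infv)).
have omE z : U z -> om z != 0 /\ cmap Y z = om z *: pt (cmap (hatx phi F x) z).
  move=> Uz; have [[r [r0 e]] _] := hY z Uz.
  have e1 : cmap Y z = (r%:C * conf_factor (cplx (hatx phi F x z))) *: pt (cmap (hatx phi F x) z).
    rewrite /cmap e /cplx map_mxZ map_row_mx map_scalar_mx rmorph1 -/(cplx _) -/(cplx (stereo _)).
    by rewrite stereo_pt scalerA.
  rewrite /om e1 lorentzZl lor_lift mulrN1 opprK; split => //.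
  by rewrite mulf_neq0 ?conf_factor_neq0// gt_eqF// ltcR.
have YE z (Uz : U z) := (omE z Uz).2; have om0 z (Uz : U z) := (omE z Uz).1.
have hom1 := isd_self (isd_smoothz oU hom).1.
pose xz := xhz phi (psi phi phi1) a m.
have h_phi : isv U phi (fun z => psi phi phi1 z + beta phi phi1 z *: phi z) (fun=> 0).
  by apply: isv_eq (nc_phi nc) _ _ => z _ //; rewrite /psi subrK.
have hz := isv_xhz oU h_phi (isv_psi oU nc) (isd_aa oU nc hF) (isd_mm oU nc hF).
have xz0 z : U z -> dot (xz z) (xz z) = 0.
  move=> Uz; have [p1 p2 p3] := psi_dot oU nc Uz.
  have fb0 : dot (vconj (phi z)) (vconj (phi z)) = 0 by rewrite dot_conj (nc_00 nc)// conjC0.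
  rewrite /xz /xhz; move: (psi phi phi1 z) (vconj (phi z)) (a z) (m z) p2 p3 fb0 => P B a1 m1 p2 p3 fb0.
  by rewrite !(dotDl, dotDr, dotZl, dotZr) p2 p3 (dotC B) p3 fb0 !mulr0 !addr0.
have e0 z : U z -> a z ^+ 2 * dot (phi2 z) (phi2 z) = 0.
  move=> Uz; rewrite -(xhzz_square Uz); set W := xhzz _ _ _ _ _ _ _ _ z.
  have [d1 _] := isd_eq_cst oU (isd_dot oU hz hz) xz0 Uz.
  have xW : dot (xz z) W = 0 by apply: half0; rewrite -{1}dotC.
  have hY1 := isv_ext oU hYv YE.
  have hY2 := isvZ oU hom (isv_pt oU hc).
  have e1 w : U w -> vz (cmap Y) w = _ := fun Uw => (isv_uniq hY1 hY2 Uw).1.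
  have hYz := isv_self (isv_smoothz oU hYv).1.
  have h2 := isvD oU (isvZ oU hom1 (isv_pt oU hc)) (isvZ oU hom (isv_tg oU hc hz)).
  have [e2 _] := isv_uniq (isv_ext oU hYz e1) h2 Uz.
  have [_ _ _ e3] := hinv z Uz; have k0 := hk z Uz.
  have ek : kappa z = vz (vz (cmap Y)) z + (s z / 2) *: cmap Y z by rewrite e3; vring.
  move: k0; rewrite ek e2 (YE z Uz) -/W -/(xz z) (xz0 z Uz) scale0r addr0.
  have o0 := om0 z Uz; have x0 := xz0 z Uz.
  rewrite (lift_jet_square _ _ _ _ _ _ _ x0 xW) => /eqP.
  by rewrite mulf_eq0 expf_eq0 /= (negbTE o0) => /eqP.
have sa := isd_smooth (isd_aa oU nc hF).
have sp : smooth U (fun z => dot (phi2 z) (phi2 z)).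
  have hp := isv_self (isv_smoothz oU (nc_phi1 nc)).1.
  exact: isd_smooth (isd_dot oU hp hp).
pose V := [set z | U z /\ dot (phi2 z) (phi2 z) != 0] : set R[i]^o.
have oV : open V by exact: open_nonzero.
have [z [Uz n1] a1] : exists2 z, V z & a z != 0.
  by apply: (aa_dense oV); [move=> ? []|exists z0].
by have /eqP := e0 z Uz; rewrite mulf_eq0 expf_eq0 /= (negbTE a1) (negbTE n1).
Qed.

End MinimalAdjoint.

(** * The rational null curve *)

Section GramData.
Variables (R : realType) (n : nat).
Implicit Types (l : R[i]).

(* The Gram matrix of the coefficients, read off from $x_z\cdot x_z = x_{zz}\cdot x_{zz} = 0$. *)
Record gram l (u3 u2 v3 v2 w2 w3 : 'rV[R[i]]_n) : Prop := Gram {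
  gram_u3 : [/\ dot u3 u3 = 0, dot u3 u2 = 0, dot u3 v3 = l & dot u3 v2 = 2 * l];
  gram_u3w : dot u3 w2 = - l /\ dot u3 w3 = - l;
  gram_u2 : [/\ dot u2 u2 = 0, dot u2 v3 = - 2 * l & dot u2 v2 = - (5 / 2) * l];
  gram_u2w : dot u2 w2 = l / 2 /\ dot u2 w3 = - l;
  gram_v3 : [/\ dot v3 v3 = 0, dot v3 v2 = 0, dot v3 w2 = 2 * l & dot v3 w3 = - l];
  gram_v2 : [/\ dot v2 v2 = 0, dot v2 w2 = - l / 2 & dot v2 w3 = l];
  gram_w : [/\ dot w2 w2 = 0, dot w2 w3 = 0 & dot w3 w3 = 0] }.

(** The Gram matrix for [l = 1], as a bilinear form in coordinates. *)
Definition gform (a1 a2 a3 a4 a5 a6 b1 b2 b3 b4 b5 b6 : R[i]) : R[i] :=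
  (a1 * b3 + a3 * b1) + 2 * (a1 * b4 + a4 * b1) - (a1 * b5 + a5 * b1) - (a1 * b6 + a6 * b1)
  - 2 * (a2 * b3 + a3 * b2) - 5 / 2 * (a2 * b4 + a4 * b2) + 2^-1 * (a2 * b5 + a5 * b2)
  - (a2 * b6 + a6 * b2) + 2 * (a3 * b5 + a5 * b3) - (a3 * b6 + a6 * b3)
  - 2^-1 * (a4 * b5 + a5 * b4) + (a4 * b6 + a6 * b4).

(** The new vectors are the coefficients of the same curve in the coordinate $1/z$; see
    [rphi_inv]. *)
Lemma gram_swap l u3 u2 v3 v2 w2 w3 : gram l u3 u2 v3 v2 w2 w3 ->
  gram l (- w3) (- w2) v3 (v3 - v2) (- u2) (- u3).
Proof.
case=> [[e1 e2 e3 e4] [e5 e6] [f1 f2 f3] [f4 f5] [g1 g2 g3 g4] [h1 h2 h3] [k1 k2 k3]].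
have nz2 : (2 : R[i]) != 0 by rewrite pnatr_eq0.
have sw (a b : 'rV[R[i]]_n) c : dot a b = c -> dot b a = c by rewrite dotC.
have t := (e1, e2, e3, e4, e5, e6, f1, f2, f3, f4, f5, g1, g2, g3, g4, h1, h2, h3, k1, k2, k3,
  (sw _ _ _ e2, sw _ _ _ e3, sw _ _ _ e4, sw _ _ _ e5, sw _ _ _ e6, sw _ _ _ f2, sw _ _ _ f3,
   sw _ _ _ f4, sw _ _ _ f5, sw _ _ _ g2, sw _ _ _ g3, sw _ _ _ g4, sw _ _ _ h2, sw _ _ _ h3, sw _ _ _ k2)).
by split; split; rewrite ?(dotDl, dotDr, dotNl, dotNr) !t; field.
Qed.

Variables (l : R[i]) (u3 u2 v3 v2 w2 w3 : 'rV[R[i]]_n).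

Definition comb (a1 a2 a3 a4 a5 a6 : R[i]) : 'rV[R[i]]_n :=
  a1 *: u3 + a2 *: u2 + a3 *: v3 + a4 *: v2 + a5 *: w2 + a6 *: w3.

Lemma isv_comb (U : set R[i]^o) (oU : open U) (a1 a2 a3 a4 a5 a6 b1 b2 b3 b4 b5 b6 c1 c2 c3 c4 c5 c6 : R[i] -> R[i]) :
  isd U a1 b1 c1 -> isd U a2 b2 c2 -> isd U a3 b3 c3 -> isd U a4 b4 c4 -> isd U a5 b5 c5 ->
  isd U a6 b6 c6 ->
  isv U (fun z => comb (a1 z) (a2 z) (a3 z) (a4 z) (a5 z) (a6 z))
    (fun z => comb (b1 z) (b2 z) (b3 z) (b4 z) (b5 z) (b6 z))
    (fun z => comb (c1 z) (c2 z) (c3 z) (c4 z) (c5 z) (c6 z)).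
Proof.
move=> h1 h2 h3 h4 h5 h6; have c v := isv_cst oU (v : 'rV[R[i]]_n).
have h := isvD oU (isvD oU (isvD oU (isvD oU (isvD oU (isvZ oU h1 (c u3)) (isvZ oU h2 (c u2)))
  (isvZ oU h3 (c v3))) (isvZ oU h4 (c v2))) (isvZ oU h5 (c w2))) (isvZ oU h6 (c w3)).
by apply: isv_eq h _ _ => z _; rewrite !scaler0 !addr0.
Qed.

Lemma eq_comb a1 a2 a3 a4 a5 a6 b1 b2 b3 b4 b5 b6 : a1 = b1 -> a2 = b2 -> a3 = b3 -> a4 = b4 ->
  a5 = b5 -> a6 = b6 -> comb a1 a2 a3 a4 a5 a6 = comb b1 b2 b3 b4 b5 b6.
Proof. by move=> -> -> -> -> -> ->. Qed.

Lemma combZ k a1 a2 a3 a4 a5 a6 :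
  k *: comb a1 a2 a3 a4 a5 a6 = comb (k * a1) (k * a2) (k * a3) (k * a4) (k * a5) (k * a6).
Proof. by rewrite /comb !scalerDr !scalerA. Qed.

Lemma combD a1 a2 a3 a4 a5 a6 b1 b2 b3 b4 b5 b6 :
  comb a1 a2 a3 a4 a5 a6 + comb b1 b2 b3 b4 b5 b6 =
  comb (a1 + b1) (a2 + b2) (a3 + b3) (a4 + b4) (a5 + b5) (a6 + b6).
Proof. by rewrite /comb; vring. Qed.

Hypothesis G : gram l u3 u2 v3 v2 w2 w3.

Lemma dot_comb a1 a2 a3 a4 a5 a6 b1 b2 b3 b4 b5 b6 :
  dot (comb a1 a2 a3 a4 a5 a6) (comb b1 b2 b3 b4 b5 b6) = l * gform a1 a2 a3 a4 a5 a6 b1 b2 b3 b4 b5 b6.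
Proof.
case: G => [[e1 e2 e3 e4] [e5 e6] [f1 f2 f3] [f4 f5] [g1 g2 g3 g4] [h1 h2 h3] [k1 k2 k3]].
have nz2 : (2 : R[i]) != 0 by rewrite pnatr_eq0.
rewrite /comb !(dotDl, dotDr, dotZl, dotZr).
rewrite (dotC u2 u3) (dotC v3 u3) (dotC v3 u2) (dotC v2 u3) (dotC v2 u2) (dotC v2 v3).
rewrite (dotC w2 u3) (dotC w2 u2) (dotC w2 v3) (dotC w2 v2).
rewrite (dotC w3 u3) (dotC w3 u2) (dotC w3 v3) (dotC w3 v2) (dotC w3 w2).
rewrite e1 e2 e3 e4 e5 e6 f1 f2 f3 f4 f5 g1 g2 g3 g4 h1 h2 h3 k1 k2 k3 /gform.
by field.
Qed.

Hypothesis l0 : l != 0.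

Lemma comb_eq0 a1 a2 a3 a4 a5 a6 : comb a1 a2 a3 a4 a5 a6 = 0 ->
  [/\ a1 = 0, a2 = 0 & a3 = 0] /\ [/\ a4 = 0, a5 = 0 & a6 = 0].
Proof.
move=> e; have f b1 b2 b3 b4 b5 b6 : gform a1 a2 a3 a4 a5 a6 b1 b2 b3 b4 b5 b6 = 0.
  by apply: (mulfI l0); rewrite -dot_comb e dot0l mulr0.
have nz2 : (2 : R[i]) != 0 by rewrite pnatr_eq0.
have key (x y : R[i]) : x = 15 * y -> x = 0 -> y = 0.
  by move=> -> h; apply: (@mulfI _ 15%:R); rewrite ?pnatr_eq0// mulr0.
split; split.
(* The six argument lists are the rows of 15 times the inverse of the Gram matrix with [l = 1]. *)
- by apply: key (f 1 (-1) 1 1 (-5) (-7)); rewrite /gform; field.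
- by apply: key (f (-1) (-2) (-1) (-4) (-4) (-5)); rewrite /gform; field.
- by apply: key (f 1 (-1) 1 1 5 (-2)); rewrite /gform; field.
- by apply: key (f 1 (-4) 1 (-2) (-4) 1); rewrite /gform; field.
- by apply: key (f (-5) (-4) 5 (-4) (-2) (-1)); rewrite /gform; field.
by apply: key (f (-7) (-5) (-2) 1 (-1) 1); rewrite /gform; field.
Qed.

End GramData.

Section RationalCurve.
Variables (R : realType) (n : nat) (l : R[i]) (u3 u2 v3 v2 w2 w3 : 'rV[R[i]]_n).
Local Notation comb := (comb u3 u2 v3 v2 w2 w3).
Local Notation P := (@punctured R).
Implicit Types z : R[i].

Definition dlt z : R[i] := z * (z - 1).
Definition dlt1 z : R[i] := 2 * z - 1.

Definition rphi z := comb (z ^- 3) (z ^- 2) ((z - 1) ^- 3) ((z - 1) ^- 2) 1 z.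
Definition rphi1 z := comb (- 3 * z ^- 4) (- 2 * z ^- 3) (- 3 * (z - 1) ^- 4) (- 2 * (z - 1) ^- 3) 0 1.
Definition rphi2 z := comb (12 * z ^- 5) (6 * z ^- 4) (12 * (z - 1) ^- 5) (6 * (z - 1) ^- 4) 0 0.
Definition rprim z := comb (- z ^- 2 / 2) (- z ^- 1) (- (z - 1) ^- 2 / 2) (- (z - 1) ^- 1) z (z ^+ 2 / 2).

(* Numerators: [rpi = dlt ^+ 3 *: rphi] and [rnum = dlt *: (rprim + dlt * dlt1 / 2 *: rphi)]. *)
Definition rpi z := comb ((z - 1) ^+ 3) (z * (z - 1) ^+ 3) (z ^+ 3) (z ^+ 3 * (z - 1))
  (dlt z ^+ 3) (z * dlt z ^+ 3).
Definition rpi1 z := comb (3 * (z - 1) ^+ 2) ((z - 1) ^+ 3 + 3 * z * (z - 1) ^+ 2) (3 * z ^+ 2)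
  (3 * z ^+ 2 * (z - 1) + z ^+ 3) (3 * dlt z ^+ 2 * dlt1 z) (dlt z ^+ 3 + 3 * z * dlt z ^+ 2 * dlt1 z).
Definition rnum z := comb ((z - 1) * (2 * z - 3) / 2) (1 / 2 + z - 5 / 2 * z ^+ 2 + z ^+ 3)
  (z / 2 + z ^+ 2) (- z - z ^+ 2 / 2 + z ^+ 3)
  (- (3 / 2) * z ^+ 2 + 3 * z ^+ 3 - 5 / 2 * z ^+ 4 + z ^+ 5)
  (- z ^+ 3 + 5 / 2 * z ^+ 4 - 5 / 2 * z ^+ 5 + z ^+ 6).

Let nz2 : (2 : R[i]) != 0. Proof. by rewrite pnatr_eq0. Qed.

Lemma dlt_eq0 z : (dlt z == 0) = (z == 0) || (z == 1).
Proof. by rewrite mulf_eq0 subr_eq0. Qed.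

Lemma puncturedP z : P z <-> dlt z != 0.
Proof. by rewrite dlt_eq0 negb_or /punctured /=; split => [[-> ->]|/andP[]]. Qed.

Lemma open_punctured : open P.
Proof.
have h := open_nonzero (f := dlt) openT
  (smoothM openT (smooth_id openT) (smoothB openT (smooth_id openT) (smooth_cst 1 openT))).
have -> : P = [set z | setT z /\ dlt z != 0] :> set R[i]^o.
  by apply/seteqP; split => z; [move/puncturedP|move=> [_ ?]; apply/puncturedP].
exact: h.
Qed.

Lemma isd_expV (U : set R[i]^o) (oU : open U) f k : isd U f (fun=> 1) (fun=> 0) ->
  (forall z, U z -> f z != 0) -> isd U (fun z => f z ^- k) (fun z => - k%:R * f z ^- k.+1) (fun=> 0).
Proof.
move=> hf f0; elim: k => [|k IH].
  have h : isd U (fun=> 1) (fun z => - 0%:R * f z ^- 1) (fun=> 0).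
    by apply: isd_eq (isd_cst oU 1) _ _ => z _ //; rewrite oppr0 mul0r.
  by apply: (isd_ext oU h) => z _; rewrite expr0 invr1.
have h : isd U (fun z => f z ^- k * (f z)^-1) (fun z => - k.+1%:R * f z ^- k.+2) (fun=> 0).
  apply: isd_eq (isdM oU IH (isdV oU f0 hf)) _ _ => z Uz; have h := f0 z Uz; cbv beta.
    by rewrite !exprS [in RHS]mulrS; move: (f z) h (k%:R) => t h c; field; rewrite h expf_neq0.
  by rewrite oppr0 !mul0r mulr0 addr0.
by apply: (isd_ext oU h) => z _; rewrite [in RHS]exprS invfM mulrC.
Qed.

Let hz : isd P id (fun=> 1) (fun=> 0). Proof. exact: isd_id open_punctured. Qed.
Let hz1 : isd P (fun z => z - 1) (fun=> 1) (fun=> 0).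
Proof.
by apply: isd_eq (isdD open_punctured hz (isdN open_punctured (isd_cst open_punctured 1))) _ _ => z _;
  rewrite oppr0 addr0.
Qed.
Let z0 z : P z -> z != 0. Proof. by case. Qed.
Let z1 z : P z -> z - 1 != 0. Proof. by case=> _; rewrite subr_eq0. Qed.
Let hV k := isd_expV open_punctured k hz z0.
Let hV1 k := isd_expV open_punctured k hz1 z1.
Let hc c := isd_cst open_punctured (c : R[i]).

Let hM c f fz : isd P f fz (fun=> 0) -> isd P (fun z => c * f z) (fun z => c * fz z) (fun=> 0).
Proof.
by move=> h; apply: isd_eq (isdM open_punctured (hc c) h) _ _ => z _; rewrite ?mul0r ?add0r ?mulr0.
Qed.

Lemma comb0 : comb 0 0 0 0 0 0 = 0.
Proof. by rewrite /comb !scale0r !addr0. Qed.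

Lemma isv_rphi : isv P rphi rphi1 (fun=> 0).
Proof.
by apply: isv_eq (isv_comb u3 u2 v3 v2 w2 w3 open_punctured (hV 3) (hV 2) (hV1 3) (hV1 2) (hc 1) hz) _ _ => z _;
  rewrite ?comb0.
Qed.

Lemma isv_rphi1 : isv P rphi1 rphi2 (fun=> 0).
Proof.
have h := isv_comb u3 u2 v3 v2 w2 w3 open_punctured (hM (-3) (hV 4)) (hM (-2) (hV 3))
   (hM (-3) (hV1 4)) (hM (-2) (hV1 3)) (hc 0) (hc 1).
apply: (isv_eq h) => z _; rewrite ?comb0//.
have e1 : -3 * (- 4%:R) = 12 :> R[i] by ring.
have e2 : -2 * (- 3%:R) = 6 :> R[i] by ring.
by rewrite /rphi2 !mulrA e1 e2.
Qed.

Lemma isv_rprim : isv P rprim rphi (fun=> 0).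
Proof.
have h2 := isdM open_punctured (isdM open_punctured hz hz) (hc 2^-1).
have h := isv_comb u3 u2 v3 v2 w2 w3 open_punctured (hM (- 2^-1) (hV 2)) (hM (-1) (hV 1))
   (hM (- 2^-1) (hV1 2)) (hM (-1) (hV1 1)) hz h2.
refine (isv_eq (isv_ext open_punctured h _) _ _) => z Pz.
- rewrite /rprim; move: (z - 1) => t.
  have e (s : R[i]) : - 2^-1 * s = - s / 2 by field.
  by rewrite !e !mulN1r !expr1 expr2.
2: by rewrite !(mul0r, mulr0, addr0) comb0.
rewrite /rphi; have a0 := z0 Pz; have b0 := z1 Pz; move: (z - 1) b0 => t b0.
have e1 : - 2^-1 * (- 2%:R * z ^- 3) = z ^- 3 by field.
have e2 : -1 * (- 1%:R * z ^- 2) = z ^- 2 by field.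
have e3 : - 2^-1 * (- 2%:R * t ^- 3) = t ^- 3 by field.
have e4 : -1 * (- 1%:R * t ^- 2) = t ^- 2 by field.
have e5 : (1 * z + z * 1) * 2^-1 + z * z * 0 = z by field.
by rewrite e1 e2 e3 e4 e5.
Qed.

Lemma rpiE z : P z -> rpi z = dlt z ^+ 3 *: rphi z.
Proof.
move=> Pz; have a0 := z0 Pz; have b0 := z1 Pz.
by rewrite /rphi combZ /rpi /dlt; apply: eq_comb; field; rewrite ?a0 ?b0.
Qed.

Lemma rpi1E z : P z -> rpi1 z = dlt z ^+ 3 *: rphi1 z + (3 * dlt z ^+ 2 * dlt1 z) *: rphi z.
Proof.
move=> Pz; have a0 := z0 Pz; have b0 := z1 Pz.
by rewrite /rphi1 /rphi !combZ combD /rpi1 /dlt /dlt1; apply: eq_comb; field; rewrite ?a0 ?b0.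
Qed.

(** Near a pole [rprim] begins with $-\frac12$ times the vector with which [rphi] begins, one order
    lower. As [dlt1] is $\pm1$ at the poles, the added multiple of [rphi] cancels this double pole
    and a single factor [dlt] clears the rest. *)
Lemma rnumE z : P z -> rnum z = dlt z *: rprim z + (dlt z ^+ 2 * dlt1 z / 2) *: rphi z.
Proof.
move=> Pz; have a0 := z0 Pz; have b0 := z1 Pz.
by rewrite /rprim /rphi !combZ combD /rnum /dlt /dlt1; apply: eq_comb; field; rewrite ?a0 ?b0 ?nz2.
Qed.

Hypothesis G : gram l u3 u2 v3 v2 w2 w3.
Hypothesis l0 : l != 0.

Lemma rphi_null : null_curve P rphi rphi1 rphi2.
Proof.
split; [exact: isv_rphi|exact: isv_rphi1|..].
- move=> z Pz; rewrite (dot_comb G) /gform; have a0 := z0 Pz; have b0 := z1 Pz.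
  by field; rewrite a0 b0.
- move=> z Pz; rewrite (dot_comb G) /gform; have a0 := z0 Pz; have b0 := z1 Pz.
  by field; rewrite a0 b0.
move=> z Pz; split; first by apply/eqP => /(comb_eq0 G l0)[_ [_ /eqP + _]]; rewrite oner_eq0.
move=> c; apply/eqP => e; have : comb (- 3 * z ^- 4 - c * z ^- 3) (- 2 * z ^- 3 - c * z ^- 2)
   (- 3 * (z - 1) ^- 4 - c * (z - 1) ^- 3) (- 2 * (z - 1) ^- 3 - c * (z - 1) ^- 2) (0 - c * 1) (1 - c * z) = 0.
  have := subrr (rphi1 z); rewrite {2}e -scaleNr /rphi1 /rphi combZ combD => <-; apply: eq_comb; ring.
case/(comb_eq0 G l0) => _ [_ /eqP]; rewrite mulr1 sub0r oppr_eq0 => /eqP -> /eqP.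
by rewrite mul0r subr0 oner_eq0.
Qed.

Lemma rphi2_square z : P z -> dot (rphi2 z) (rphi2 z) = - 180 * l / dlt z ^+ 4.
Proof.
move=> Pz; have a0 := z0 Pz; have b0 := z1 Pz.
by rewrite (dot_comb G) /gform /dlt; field; rewrite ?a0 ?b0.
Qed.

Lemma rpi_neq0 z : rpi z != 0.
Proof.
apply/eqP => /(comb_eq0 G l0)[[/eqP + _ /eqP +] _]; rewrite !expf_eq0 /= subr_eq0 => /eqP ->.
by rewrite oner_eq0.
Qed.

Lemma rpi_square z : dot (rpi z) (rpi z) = 0.
Proof. by rewrite (dot_comb G) /gform /dlt; field. Qed.

Lemma rnum_square z : dot (rnum z) (rnum z) = dlt z * (l * (15 * z ^+ 2 - 21 / 2 * z + 3)).
Proof. by rewrite (dot_comb G) /gform /dlt; field. Qed.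

Lemma rnum_rpi z : dot (rnum z) (rpi z) = dlt z * (l * (15 / 2 * z ^+ 3 - 9 * z ^+ 2 + 6 * z - 3 / 2)).
Proof. by rewrite (dot_comb G) /gform /dlt; field. Qed.

(** At 0 the coefficient of [u2], at 1 that of [v2], vanishes in [rpi] but not in [rnum]. So the
    component of the numerator orthogonal to [rpi] survives at the poles, which makes the extended
    surface immersed there. *)
Lemma rnum_indep z k : dlt z = 0 -> rnum z != k *: rpi z.
Proof.
move=> d0; apply/eqP => e; have : rnum z + (- k) *: rpi z = 0 by rewrite e scaleNr subrr.
rewrite combZ combD => /(comb_eq0 G l0)[[_ h2 _] [h4 _ _]].
move/eqP: d0 h2 h4; rewrite dlt_eq0 => /orP[] /eqP ->.
  by move=> /eqP + _; rewrite /dlt !(mulr0, mul0r, expr0n, addr0, subr0) /= mulf_eq0 invr_eq0 oner_eq0 (negbTE nz2).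
move=> _ /eqP; rewrite subrr !expr1n !mulr0 addr0.
have -> : - 1 - 1 / 2 + 1 = - (2^-1) :> R[i] by field.
by rewrite oppr_eq0 invr_eq0 (negbTE nz2).
Qed.

End RationalCurve.

(** * Extension across the poles *)

Section Poles.
Variables (R : realType) (n : nat).
Local Notation vec := 'rV[R[i]]_(n + 1 + 1).
Variables (de de1 : R[i] -> R[i]).
Hypothesis hde : isd setT de de1 (fun=> 0).
Hypothesis de_simple : forall z, de z = 0 -> de1 z != 0.
Local Notation U := ([set z | de z != 0] : set R[i]^o).

Lemma open_offpoles : open U.
Proof.
have h := open_nonzero openT (isd_smooth hde).
have -> // : U = [set z | setT z /\ de z != 0] :> set R[i]^o.
by apply/seteqP; split => z //= [].
Qed.

(** The zeros of [de] have empty interior, since the derivative [de1] does not vanish at them. *)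
Lemma eq0_offpoles g : smooth setT g -> (forall z, de z != 0 -> g z = 0) -> forall z, g z = 0.
Proof.
move=> sg g0 z; apply/eqP/negP => /negP gz.
pose V := [set w | setT w /\ g w != 0] : set R[i]^o.
have oV : open V := open_nonzero openT sg.
have dV w : V w -> de w = 0 by move=> [_ gw]; apply/eqP/negP => /negP/g0/eqP; exact/negP.
have hV : isd V de de1 (fun=> 0).
  by case: hde => s e; split => [|w _]; [exact: smooth_sub s|exact: e].
have [e _] := isd_eq_cst oV hV dV (conj I gz).
by have := de_simple (dV z (conj I gz)); rewrite e eqxx.
Qed.

Variables (r pi : R[i] -> 'rV[R[i]]_n) (r1 r2 : R[i] -> R[i]).
Hypotheses (sr : vsmooth setT r) (sp : vsmooth setT pi) (sr1 : smooth setT r1) (sr2 : smooth setT r2).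
Hypothesis pi0 : forall z, pi z != 0.
Hypothesis r_indep : forall z k, de z = 0 -> r z != k *: pi z.
Hypothesis pi_pi : forall z, dot (pi z) (pi z) = 0.
Hypothesis r_r : forall z, dot (r z) (r z) = de z * r1 z.
Hypothesis r_pi : forall z, dot (r z) (pi z) = de z * r2 z.

Variables (phi phi1 phi2 F : R[i] -> 'rV[R[i]]_n) (x : R[i] -> 'rV[R]_n) (b : 'rV[R]_n).
Hypothesis nc : null_curve U phi phi1 phi2.
Hypothesis hF : isv U F phi (fun=> 0).
Hypothesis xE : forall z, U z -> cmap x z = F z + vconj (F z) + cplx b.
Hypothesis imm : forall z, U z -> dot (F z) (vconj (phi z)) != 0 \/ dot (F z) (vconj (phi1 z)) != 0.
Hypothesis piE : forall z, U z -> exists2 k, k != 0 & pi z = k *: phi z.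
Hypothesis rE : forall z, U z -> exists k, r z = de z *: F z + k *: phi z.

Let nz2 : (2 : R[i]) != 0. Proof. by rewrite pnatr_eq0. Qed.

Let hx : isv U (cmap x) phi (fun z => vconj (phi z)).
Proof.
have oU := open_offpoles.
have h := isvD oU (isvD oU hF (isv_conj oU hF)) (isv_cst oU (cplx b)).
refine (isv_eq (isv_ext oU h _) _ _) => z Uz; first by rewrite xE.
  by rewrite vconj0 !addr0.
by rewrite add0r addr0.
Qed.

(** [q] is the component of [r] orthogonal to [pi] for the Hermitian product; off the poles it is
    $\delta F_\perp$. With $h=2\,\mathrm{Re}\,F_\perp$ one has $P=|\delta|^2h$, $A=|\delta|^2$ and
    $B=|\delta|^2\,h\cdot h/2$, so [L] is $|\delta|^2$ times the lift of $h+b$. The apparently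
    singular term $\bar\delta\,(q\cdot q)/\delta$ in $B$ is the smooth [e], because [r_r], [r_pi]
    and [pi_pi] exhibit a factor $\delta$ in $q\cdot q$. *)
Let nu z := dot (r z) (vconj (pi z)) / dot (pi z) (vconj (pi z)).
Let q z := r z - nu z *: pi z.
Let e z := (de z)^* * (r1 z - 2 * nu z * r2 z).
Let A z := de z * (de z)^*.
Let P z := (de z)^* *: q z + de z *: vconj (q z).
Let B z := dot (q z) (vconj (q z)) + 2^-1 * (e z + (e z)^*).
Let L z := cone (P z + A z *: cplx b) (A z) (B z + dot (P z) (cplx b) + A z * (dot (cplx b) (cplx b) / 2)).

(** At the poles the surface passes through the point at infinity, the centre of the stereographic
    projection. *)
Let y z : 'rV[R]_(n + 1) := if de z == 0 then row_mx 0 1%:M else stereo (hatx phi F x z).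

Let pp0 z : dot (pi z) (vconj (pi z)) != 0. Proof. by rewrite dot_conj_eq0 pi0. Qed.

Let snu : smooth setT nu.
Proof.
have hp := isv_self sp.
have h := isdM openT (isd_dot openT (isv_self sr) (isv_conj openT hp))
  (isdV openT (fun z _ => pp0 z) (isd_dot openT hp (isv_conj openT hp))).
exact: isd_smooth h.
Qed.

Let sq : vsmooth setT q.
Proof.
have h := isvD openT (isv_self sr) (isvN openT (isvZ openT (isd_self snu) (isv_self sp))).
exact: isv_smooth h.
Qed.

(** Derivatives are recorded only as far as the metric at a pole requires: the second entry of the
    cone has vanishing derivatives there, so the metric is that of the first entry. *)
Let isv_L : exists Pz Pb Bz Bb, isv setT L (fun z => cone (Pz z) (de1 z * (de z)^* ) (Bz z))
    (fun z => cone (Pb z) (de z * (de1 z)^* ) (Bb z)) /\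
  forall z, de z = 0 -> Pz z = de1 z *: vconj (q z) /\ Pb z = (de1 z)^* *: q z.
Proof.
have hq := isv_self sq; have hqb := isv_conj openT hq; have hdb := isd_conj openT hde.
have hP := isvD openT (isvZ openT hdb hq) (isvZ openT hde hqb).
have hA := isdM openT hde hdb.
have he := isdM openT hdb (isdD openT (isd_self sr1) (isdN openT (isdM openT (isdM openT (isd_cst openT 2)
  (isd_self snu)) (isd_self sr2)))).
have hB := isdD openT (isd_dot openT hq hqb) (isdM openT (isd_cst openT 2^-1) (isdD openT he (isd_conj openT he))).
have hb := isv_cst openT (cplx b).
have h := isv_cone openT (isvD openT hP (isvZ openT hA hb)) hA
  (isdD openT (isdD openT hB (isd_dot openT hP hb)) (isdM openT hA (isd_cst openT (dot (cplx b) (cplx b) / 2)))).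
eexists; eexists; eexists; eexists; split.
  apply: (isv_eq h) => z _; cbv beta; first by rewrite conjC0 mulr0 addr0; reflexivity.
  by rewrite mul0r add0r; reflexivity.
by move=> z d0; cbv beta; rewrite d0 !(conjC0, mul0r, mulr0, scale0r, scaler0, add0r, addr0).
Qed.

Let L_hat z : de z != 0 -> L z = A z *: pt (hatc phi F x z).
Proof.
move=> d0; have db0 : (de z)^* != 0 by rewrite conjC_eq0.
have [k k0 piz] := piE d0; have [k' rz] := rE d0.
have r0 := rho_neq0 nc d0.
have qE : q z = de z *: (F z + aa phi F z *: phi z).
  rewrite /q /nu rz piz vconjZ !(dotDl, dotZl, dotZr) -/(rho phi z) /aa.
  have kb0 : k^* != 0 by rewrite conjC_eq0.
  move: (dot (F z) _) (rho phi z) (k^*) r0 kb0 => d rr kb r0 kb0.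
  by vfield; rewrite ?k0 ?r0 ?kb0.
pose h := (F z + aa phi F z *: phi z) + vconj (F z + aa phi F z *: phi z).
have hatE : hatc phi F x z = h + cplx b.
  by rewrite /hatc -[cplx (x z)]/(cmap x z) xE// /h !vconjD; vring.
have PE : P z = A z *: h.
  rewrite /P qE vconjZ /h /A; move: (F z + _) ((de z)^*) => v c.
  by vring.
have qq : dot (q z) (q z) = de z * (r1 z - 2 * nu z * r2 z).
  rewrite /q; move: (nu z) => v.
  rewrite dotDl !dotDr !(dotNl, dotNr, dotZl, dotZr) r_r r_pi (dotC (pi z)) r_pi pi_pi.
  by move: (r1 z) (r2 z) (de z) => a1 a2 a3; ring.
have BE : B z = A z * (dot h h / 2).
  have -> : dot h h = dot (q z) (q z) / de z ^+ 2 + (dot (q z) (q z))^* / (de z)^* ^+ 2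
      + 2 * dot (q z) (vconj (q z)) / A z.
    rewrite -dot_conj /h qE vconjZ /A; move: (F z + _) => v.
    rewrite !(dotDl, dotDr, dotZl, dotZr) (dotC (vconj v) v).
    move: (dot v v) (dot v (vconj v)) (dot (vconj v) (vconj v)) ((de z)^*) db0 => s1 s2 s3 db db0.
    by field; rewrite d0 db0.
  rewrite qq /B /e /A; move: (r1 z - _) => t; rewrite !rmorphM /= conjCK.
  move: (dot (q z) _) (t^*) ((de z)^*) db0 => s tb db db0.
  by field; rewrite d0 db0.
rewrite hatE pt_translate /L PE BE !ptE tgE infvE dotZl -coneZ -!coneD -coneZ; congr cone.
- by rewrite scaler0 addr0 -scalerDr.
- by rewrite !mulr0 !addr0 mulr1.
by rewrite mulr1; move: (dot h h) (dot h _) (dot _ _) (A z) => t1 t2 t3 t4; ring.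
Qed.

Let y_unit z : dot (y z) (y z) = 1.
Proof.
rewrite /y; case: eqP => _; last exact: stereo_unit.
by rewrite dot_row_scalar dot0l add0r mulr1.
Qed.

Let q0 z : de z = 0 -> dot (q z) (vconj (q z)) != 0.
Proof. by move=> d0; rewrite dot_conj_eq0 subr_eq0 r_indep. Qed.

Let L_y z : exists2 k, k != 0 & L z = k *: row_mx (cplx (y z)) 1%:M.
Proof.
rewrite /y; case: (eqVneq (de z) 0) => [d0|d0].
  exists (B z).
    by rewrite /B /e d0 conjC0 mul0r conjC0 addr0 mulr0 addr0 q0.
  rewrite /L /P /A d0 !(conjC0, scale0r, mul0r, mulr0, add0r, addr0, dot0l).
  rewrite /cone /cplx map_row_mx map_mx0 map_scalar_mx rmorph1 scale_row_mx scale_row_mx scaler0.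
  by rewrite !scale_scalar_mx !mul0r subr0 addr0 mulr1.
exists (A z * (conf_factor (cplx (hatx phi F x z)))^-1).
  by rewrite mulf_neq0 ?invr_neq0 ?conf_factor_neq0// mulf_neq0// conjC_eq0.
by rewrite stereo_pt scalerA mulfVK ?conf_factor_neq0// hatxE L_hat.
Qed.

(** Dividing [L] by its last coordinate gives the lift $(y,1)$, whatever the factor was. *)
Let lastc (v : vec) := v 0 (rshift (n + 1) 0).

Let y_L z : lastc (L z) != 0 /\ row_mx (cplx (y z)) 1%:M = (lastc (L z))^-1 *: L z.
Proof.
have [k k0 e0] := L_y z.
have -> : lastc (L z) = k by rewrite e0 /lastc mxE row_mxEr mxE eqxx mulr1n mulr1.
by split => //; rewrite e0 scalerA mulVf// scale1r.
Qed.

Let sf : smooth setT (fun z => (lastc (L z))^-1).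
Proof.
have [Pz [Pb [Bz [Bb [hL _]]]]] := isv_L.
exact: isd_smooth (isdV openT (fun z _ => (y_L z).1) (hL (rshift (n + 1) 0))).
Qed.

Let y_smooth : vsmooth setT (cmap y).
Proof.
have [Pz [Pb [Bz [Bb [hL _]]]]] := isv_L.
by have [] := sphere_conformal openT hL sf (fun z _ => (y_L z).2) y_unit.
Qed.

Let y_hat z : U z -> y z = stereo (hatx phi F x z).
Proof. by move=> /negbTE d0; rewrite /y d0. Qed.

Let isv_restrict m (g gz gb : R[i] -> 'rV[R[i]]_m) : isv setT g gz gb -> isv U g gz gb.
Proof. by move=> h j; case: (h j) => s e'; split => [|z _]; [exact: smooth_sub s|exact: e']. Qed.

(** Conformality extends from the complement of the poles by density. At a pole the metric is a
    nonzero multiple of $|\delta'|^2$ times the squared length of [q], and neither vanishes. *)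
Let y_conformal : conformal_immersion setT y.
Proof.
have oU := open_offpoles.
have [[_ _] hc] := hat_conformal oU nc hF hx imm.
have [Pz [Pb [Bz [Bb [hL eL]]]]] := isv_L.
have [_ hf] := sphere_conformal openT hL sf (fun z _ => (y_L z).2) y_unit.
have hy := isv_self y_smooth.
have hy' := isv_ext oU (isv_restrict hy) (G := cmap (fun z => stereo (hatx phi F x z)))
  (fun z Uz => congr1 (fun v => cplx v) (y_hat Uz)).
have eq z : U z -> vz (cmap (fun z => stereo (hatx phi F x z))) z = vz (cmap y) z /\
    vzb (cmap (fun z => stereo (hatx phi F x z))) z = vzb (cmap y) z.
  by move=> Uz; case/isvP: hy' => _ /(_ z Uz).
split; first by split=> // z _; exact: y_unit.
move=> z _; split.
  have [sz _] := isv_smoothz openT hy; have hz := isv_self sz.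
  apply: (eq0_offpoles (isd_smooth (isd_dot openT hz hz))) => w Uw.
  by have [<- _] := eq w Uw; have [] := hc w Uw.
have [d0|d0] := eqVneq (de z) 0; last first.
  by have [<- <-] := eq z d0; have [] := hc z d0.
have [_ ->] := hf z I; have [-> ->] := eL z d0; rewrite lorentz_cone d0 conjC0 !(mulr0, mul0r, subr0).
rewrite dotZl dotZr (dotC (vconj _)); apply/eqP.
have [f0 _] := y_L z; have d1 := de_simple d0.
by rewrite !mulf_neq0 ?invr_neq0 ?expf_neq0 ?conjC_eq0 ?invr_neq0 ?q0.
Qed.

Lemma willmore_across_poles : exists y : R[i] -> 'rV[R]_(n + 1), [/\ willmore setT y,
  forall z, de z != 0 -> y z = stereo (hatx phi F x z) &
  forall z, de z = 0 -> y z = row_mx 0 1%:M].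
Proof.
exists y; split; [|exact: y_hat|by move=> z d0; rewrite /y d0 eqxx].
apply: (conformal_willmore openT y_conformal) => om omz omb N Yz M kappa s' q' mf hom om0.
move=> kz kb Dz Db hk hD z _.
have oU := open_offpoles.
have mfU := moving_frame_sub (@subsetT _ U) mf.
have homU : isd U om omz omb.
  by case: hom => s1 e1; split => [|w _]; [exact: smooth_sub s1|exact: e1].
have res := hat_residual oU nc hF hx imm mfU homU (fun w _ => om0 w I)
  (fun w Uw => congr1 (fun v => om w *: row_mx (cplx v) 1%:M) (y_hat Uw)) (isv_restrict hk) (isv_restrict hD).
have [_ sDb] := isv_smoothz openT hD.
have [/isd_self ss _ _ sk] := mf_smooth mf.
have hE := isvD openT (isv_self (nproj_smooth openT mf sDb))
  (isvZ openT (isdM openT (isd_conj openT ss) (isd_cst openT 2^-1)) hk).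
apply/rowP => j; rewrite [RHS]mxE; move: z.
apply: (eq0_offpoles (isd_smooth (hE j))) => z Uz.
by rewrite (res z Uz) mxE.
Qed.

End Poles.

(** * Immersed adjoint surfaces *)

Section SquareBound.
Variable R : realType.

Definition in_square (z : R[i]) := `|complex.Re z| <= 1 /\ `|complex.Im z| <= 1.

(** The square is the image of the compact set $[-1,1]^2$ under [e], and a maximum is attained
    there. *)
Lemma cts_square_bounded (h : R[i] -> R[i]) : (forall z, cts h z) ->
  exists M : R, forall z, in_square z -> complex.Re (h z) <= M.
Proof.
move=> ch; pose e (p : R * R) : R[i] := p.1%:C + 'i * p.2%:C.
pose f (p : R * R) := complex.Re (h (e p)).
pose A : set (R * R) := `[-1, 1]%classic `*` `[-1, 1]%classic.
have cf : continuous f.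
  move=> p; have c11 : (q.1)%:C @[q --> p] --> (p.1%:C : R[i]^o).
    by apply: (@cvg_comp _ _ _ fst _ _ (nbhs p.1)); [exact: cvg_fst|exact: real_complex_continuous].
  have c12 : (q.2)%:C @[q --> p] --> (p.2%:C : R[i]^o).
    by apply: (@cvg_comp _ _ _ snd _ _ (nbhs p.2)); [exact: cvg_snd|exact: real_complex_continuous].
  have fp : Filter (nbhs p) by exact: nbhs_filter.
  have c13 := @cvgM R[i] _ (nbhs p) fp (fun=> 'i) (fun q : R * R => (q.2)%:C : R[i]^o) _ _ (@cvg_cst R[i]^o 'i _ _ fp) c12.
  have c1 : e q @[q --> p] --> (e p : R[i]^o) := @cvgD R[i] R[i]^o _ (nbhs p) fp _ _ _ _ c11 c13.
  have c2 : h (e q) @[q --> p] --> (h (e p) : R[i]^o) := cvg_comp _ _ c1 (ch (e p)).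
  exact: cvg_comp c2 (@Re_continuous _ (h (e p))).
have A0 : A !=set0 by exists (0, 0); split => /=; rewrite in_itv /=; lra.
have cA : compact A by apply: compact_setX; exact: segment_compact.
have [c _ hc] := compact_EVT_max A0 cA (continuous_subspaceT cf).
exists (f c) => z [h1 h2]; have -> : z = e (complex.Re z, complex.Im z) by rewrite /e /= [LHS]complexE complexiE.
apply: (hc (complex.Re z, complex.Im z)); rewrite inE; split => /=; rewrite in_itv /=.
  by rewrite -ler_norml.
by rewrite -ler_norml.
Qed.

End SquareBound.

Lemma smooth_dlt (R : realType) : smooth setT (@dlt R).
Proof. exact: smoothM openT (smooth_id openT) (smoothB openT (smooth_id openT) (smooth_cst 1 openT)). Qed.

Lemma smooth_dlt1 (R : realType) : smooth setT (@dlt1 R).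
Proof.
exact: smoothB openT (smoothM openT (smooth_cst 2 openT) (smooth_id openT)) (smooth_cst 1 openT).
Qed.

Ltac smooth_poly := repeat first [exact: smooth_dlt | exact: smooth_dlt1 | exact: (smooth_id openT)
  | exact: (smooth_cst _ openT) | apply: (smoothX _ openT) | apply: (smoothD openT)
  | apply: (smoothM openT) | apply: (smoothN openT)].

(** * Generic position of the constant of integration *)

Section GenericPosition.
Variables (R : realType) (n : nat) (l : R[i]) (u3 u2 v3 v2 w2 w3 : 'rV[R[i]]_n).
Hypothesis G : gram l u3 u2 v3 v2 w2 w3.
Hypothesis l0 : l != 0.
Local Notation PI := (rpi u3 u2 v3 v2 w2 w3).
Local Notation PI1 := (rpi1 u3 u2 v3 v2 w2 w3).
Local Notation phi := (rphi u3 u2 v3 v2 w2 w3).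
Local Notation phi1 := (rphi1 u3 u2 v3 v2 w2 w3).
Local Notation prim := (rprim u3 u2 v3 v2 w2 w3).
Local Notation num := (rnum u3 u2 v3 v2 w2 w3).

Lemma vsmooth_comb (a1 a2 a3 a4 a5 a6 : R[i] -> R[i]) : smooth setT a1 -> smooth setT a2 ->
  smooth setT a3 -> smooth setT a4 -> smooth setT a5 -> smooth setT a6 ->
  vsmooth setT (fun z => comb u3 u2 v3 v2 w2 w3 (a1 z) (a2 z) (a3 z) (a4 z) (a5 z) (a6 z)).
Proof.
move=> h1 h2 h3 h4 h5 h6; exact: isv_smooth (isv_comb u3 u2 v3 v2 w2 w3 openT (isd_self h1)
  (isd_self h2) (isd_self h3) (isd_self h4) (isd_self h5) (isd_self h6)).
Qed.

Lemma smooth_rpi : vsmooth setT PI.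
Proof. by apply: vsmooth_comb; smooth_poly. Qed.

Lemma smooth_rpi1 : vsmooth setT PI1.
Proof. by apply: vsmooth_comb; smooth_poly. Qed.

Lemma smooth_rnum : vsmooth setT num.
Proof. by apply: vsmooth_comb; smooth_poly. Qed.

Variables (c be : 'rV[R[i]]_n) (k : R[i]).
Hypothesis k0 : k != 0.
Hypothesis be3 : [/\ dot be u3 = 0, dot be v3 = 0 & dot be w3 = 0].
Hypothesis be2 : [/\ dot be u2 = k, dot be v2 = 2 * k & dot be w2 = k].

(** With the prescribed values of [be], pairing with [rpi] gives $k\,\delta\,g$; [g1] is the
    derivative of [g]. *)
Let g z : R[i] := (z - 1) ^+ 2 + 2 * z ^+ 2 + z ^+ 2 * (z - 1) ^+ 2.
Let g1 z : R[i] := 4 * z ^+ 3 - 6 * z ^+ 2 + 8 * z - 2.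

Let bez z : dot be (PI z) = k * (dlt z * g z) /\ dot be (PI1 z) = k * (dlt1 z * g z + dlt z * g1 z).
Proof.
case: be3 be2 => b1 b2 b3 [b4 b5 b6].
rewrite /rpi /rpi1 /comb !dotDr !dotZr b1 b2 b3 b4 b5 b6 /dlt /dlt1 /g /g1.
by split; ring.
Qed.

Let g_simple z : g z = 0 -> g1 z <> 0.
Proof.
(* A Bezout identity between $g$ and $g'$, which excludes a common zero. *)
move=> e e1; have : (19 / 10 - 2 * z + 6 / 5 * z ^+ 2) * g z
  + (9 / 20 - 11 / 10 * z + 13 / 20 * z ^+ 2 - 3 / 10 * z ^+ 3) * g1 z = 1.
  by rewrite /g /g1; field.
by rewrite e e1 !mulr0 addr0 => /eqP; rewrite eq_sym oner_eq0.
Qed.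

(** Orthogonality of the primitive shifted by [t *: vconj be] to [rpi] and [rpi1] is a pair of
    equations affine in [t]. The first has coefficients [E] and [dlt ^+ 2 * b0]; the second, after
    elimination of the component along [rpi] and division by [dlt], has [Dr] and [dlt * Da]. [D] is
    their determinant divided by [dlt], hence zero at a common solution; including it in [den] keeps
    [den] nonzero at the poles, where the other two terms vanish. *)
Let N z := dot (PI z) (vconj (PI z)).
Let M z := dot (PI z) (vconj (PI1 z)).
Let r z := num z + dlt z *: c.
Let rp z := dot (r z) (vconj (PI z)).
Let Dr z := N z * dot (r z) (vconj (PI1 z)) - M z * rp z.
Let b0 z := (dot be (PI z))^*.
Let Da z := N z * (dot be (PI1 z))^* - M z * b0 z.
Let E z := dlt z * rp z - dlt1 z / 2 * N z.
Let D z := E z * Da z - dlt z * b0 z * Dr z.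
Let den z := (dlt z * Da z) * (dlt z * Da z)^* + (dlt z ^+ 2 * b0 z) * (dlt z ^+ 2 * b0 z)^* + D z * (D z)^*.
Let nmr z := Dr z * (Dr z)^* + E z * (E z)^*.

Let N0 z : N z != 0. Proof. by rewrite dot_conj_eq0 (rpi_neq0 G l0). Qed.

(** Off the poles a zero would make [be] annihilate both [rpi] and [rpi1], hence $g$ and $g'$ vanish
    together. At a pole the term with [D] is nonzero. *)
Let den0 z : den z != 0.
Proof.
have s3 (p q s : R[i]) : p * p^* + q * q^* + s * s^* = 0 -> [/\ p = 0, q = 0 & s = 0].
  move/eqP; rewrite paddr_eq0 ?addr_ge0 ?mul_conjC_ge0// paddr_eq0 ?mul_conjC_ge0//.
  by rewrite !mul_conjC_eq0 => /andP[/andP[/eqP -> /eqP ->] /eqP ->].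
have nz2 : (2 : R[i]) != 0 by rewrite pnatr_eq0.
apply/eqP => /s3[]; have [e1 e2] := bez z.
have [d0|d0] := eqVneq (dlt z) 0.
  move=> _ _; rewrite /D /E /Da /b0 e1 e2 d0 !(mul0r, mulr0, conjC0, subr0, addr0, sub0r).
  have d10 : dlt1 z != 0 /\ g z != 0.
    move/eqP: d0; rewrite dlt_eq0 /dlt1 /g => /orP[] /eqP ->.
      by rewrite !(mulr0, mul0r, expr0n, addr0, sub0r) /= sqrrN expr1n oppr_eq0 oner_eq0.
    have -> : 2 * 1 - 1 = 1 :> R[i] by ring.
    have -> : (1 - 1) ^+ 2 + 2 * 1 ^+ 2 + 1 ^+ 2 * (1 - 1) ^+ 2 = 2 :> R[i] by ring.
    by rewrite nz2 oner_eq0.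
  have [d1 g0] := d10; move: (N z) (N0 z) (g z) (dlt1 z) g0 d1 => N' N'0 g' d1' g0 d1.
  apply/eqP; rewrite mulf_neq0 ?oppr_eq0 ?mulf_neq0 ?conjC_eq0 ?invr_eq0//.
  by rewrite mulf_neq0// mulf_neq0.
move=> ea eb _; have bz : dot be (PI z) = 0.
  by move/eqP: eb; rewrite (mulf_eq0 (dlt z ^+ 2)) expf_eq0 (negbTE d0) /b0 conjC_eq0 => /eqP.
have b1z : dot be (PI1 z) = 0.
  move/eqP: ea; rewrite (mulf_eq0 (dlt z)) (negbTE d0) /Da /b0 bz conjC0 mulr0 subr0.
  by rewrite (mulf_eq0 (N z)) (negbTE (N0 z)) conjC_eq0 => /eqP.
have gz : g z = 0.
  by move/eqP: bz; rewrite e1 (mulf_eq0 k) (negbTE k0) (mulf_eq0 (dlt z)) (negbTE d0) => /eqP.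
apply: (g_simple gz); move/eqP: b1z.
by rewrite e2 gz mulr0 add0r (mulf_eq0 k) (negbTE k0) (mulf_eq0 (dlt z)) (negbTE d0) => /eqP.
Qed.

Let smooth_quot : smooth setT (fun z => nmr z / den z).
Proof.
have sd := isd_self (smooth_dlt R); have sd1 := isd_self (smooth_dlt1 R).
have sp := isv_self smooth_rpi; have sp1 := isv_self smooth_rpi1.
have hr := isvD openT (isv_self smooth_rnum) (isvZ openT sd (isv_cst openT c)).
have hN : isd setT N _ _ := isd_dot openT sp (isv_conj openT sp).
have hM : isd setT M _ _ := isd_dot openT sp (isv_conj openT sp1).
have hrp : isd setT rp _ _ := isd_dot openT hr (isv_conj openT sp).
have hDr : isd setT Dr _ _ := isdD openT (isdM openT hN (isd_dot openT hr (isv_conj openT sp1)))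
  (isdN openT (isdM openT hM hrp)).
have hb : isd setT b0 _ _ := isd_conj openT (isd_dot openT (isv_cst openT be) sp).
have hDa : isd setT Da _ _ := isdD openT (isdM openT hN (isd_conj openT (isd_dot openT (isv_cst openT be) sp1)))
  (isdN openT (isdM openT hM hb)).
have hE : isd setT E _ _ := isdD openT (isdM openT sd hrp)
  (isdN openT (isdM openT (isdM openT sd1 (isd_cst openT 2^-1)) hN)).
have hD : isd setT D _ _ := isdD openT (isdM openT hE hDa) (isdN openT (isdM openT (isdM openT sd hb) hDr)).
have s1 := smoothM openT (smooth_dlt R) (isd_smooth hDa).
have s2 := smoothM openT (smoothX 2 openT (smooth_dlt R)) (isd_smooth hb).
have s3 := isd_smooth hD; have s4 := isd_smooth hDr; have s5 := isd_smooth hE.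
have sn (f : R[i] -> R[i]) : smooth setT f -> smooth setT (fun z => f z * (f z)^*).
  by move=> sf; exact: smoothM openT sf (smooth_conj openT sf).
have s6 := smoothD openT (smoothD openT (sn _ s1) (sn _ s2)) (sn _ s3).
exact: smoothM openT (smoothD openT (sn _ s4) (sn _ s5)) (smoothV openT (fun z _ => den0 z) s6).
Qed.

(** At a bad point [D] vanishes and the two equations give [nmr z = t ^+ 2 * den z], so $t^2$ is
    bounded by the maximum of the quotient on the square. *)
Lemma generic_position : exists B : R, forall t : R, B < t ^+ 2 -> forall z, punctured z -> in_square z ->
  let F := prim z + (c + t%:C *: vconj be) in
  dot F (vconj (phi z)) != 0 \/ dot F (vconj (phi1 z)) != 0.
Proof.
have [B hB] := cts_square_bounded (fun z => smooth_cts smooth_quot (I : setT z)).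
exists B => t Bt z Pz sz F; apply: contrapT => /not_orP[/negP/negPn/eqP f0 /negP/negPn/eqP f1].
suff e : nmr z / den z = (t ^+ 2)%:C by have := hB z sz; rewrite e /= leNgt Bt.
have d0 : dlt z != 0 by apply/puncturedP.
have db0 : (dlt z)^* != 0 by rewrite conjC_eq0.
have nz2 : (2 : R[i]) != 0 by rewrite pnatr_eq0.
have fp : dot F (vconj (PI z)) = 0 by rewrite rpiE// vconjZ dotZr f0 mulr0.
have fp1 : dot F (vconj (PI1 z)) = 0.
  by rewrite rpi1E// vconjD !vconjZ dotDr !dotZr f0 f1 !mulr0 addr0.
have FE : dlt z ^+ 2 *: F = dlt z *: r z - (dlt1 z / 2) *: PI z + (t%:C * dlt z ^+ 2) *: vconj be.
  rewrite /F /r rnumE// rpiE//; move: (dlt z) (dlt1 z) (t%:C) => d d' s.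
  by move: (prim z) (phi z) => p q; vfield.
have lin (p1 p2 p3 v : 'rV[R[i]]_n) (a1 a2 a3 : R[i]) :
    dot (a1 *: p1 - a2 *: p2 + a3 *: p3) v = a1 * dot p1 v - a2 * dot p2 v + a3 * dot p3 v.
  by rewrite !(dotDl, dotNl, dotZl).
have E2 : E z + t%:C * (dlt z ^+ 2 * b0 z) = 0.
  have := congr1 (fun v => dot v (vconj (PI z))) FE; rewrite /= dotZl fp mulr0 lin.
  by rewrite dot_conj -/(rp z) -/(N z) -/(b0 z) => e; rewrite [RHS]e -(mulrA t%:C).
have E1 : dlt z * (Dr z + t%:C * (dlt z * Da z)) = 0.
  have := congr1 (fun v => N z * dot v (vconj (PI1 z)) - M z * dot v (vconj (PI z))) FE.
  rewrite /= !dotZl fp fp1 !mulr0 subrr !lin !dot_conj => e; rewrite [RHS]e.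
  rewrite /Dr /Da /rp -/(N z) -/(M z) -/(b0 z).
  move: (N z) (M z) (b0 z) (dot (r z) _) (dot (r z) _) ((dot be (PI1 z))^*) (dlt z) (dlt1 z) (t%:C).
  by move=> x1 x2 x3 x4 x5 x6 x7 x8 x9; field.
have {}E1 : Dr z = - (t%:C * (dlt z * Da z)).
  by move/eqP: E1; rewrite mulf_eq0 (negbTE d0) addr_eq0 => /eqP.
have {}E2 : E z = - (t%:C * (dlt z ^+ 2 * b0 z)) by move/eqP: E2; rewrite addr_eq0 => /eqP.
have D0 : D z = 0.
  by rewrite /D E1 E2; move: (dlt z) (t%:C) (b0 z) (Da z) => x1 x2 x3 x4; ring.
have dn := den0 z; apply: (mulIf dn); rewrite mulfVK// /nmr /den D0 E1 E2 conjC0 mulr0 addr0.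
have tc : (t%:C)^* = t%:C :> R[i] by rewrite conj_Creal// complex_real.
rewrite !rmorphN !(rmorphM _ t%:C) /= tc rmorphXn /=.
move: (dlt z * Da z) (dlt z ^+ 2 * b0 z) => x1 x2; move: (x1^*) (x2^*) (t%:C) => x3 x4 x5.
by ring.
Qed.

End GenericPosition.

(** * Connectedness of the punctured plane *)

Section Connectedness.
Variable R : realType.
Local Notation P := (@punctured R).

Lemma constant_line (f : R[i] -> R[i]) v z t : v = 1 \/ v = 'i ->
  isd P f (fun=> 0) (fun=> 0) -> (forall t : R, P (z + t%:C * v)) -> f (z + t%:C * v) = f z.
Proof.
move=> vE hf Pz; have [sf ef] := hf.
have p0 w : P w -> pd v f w = 0.
  move=> Pw; have [] := ef w Pw; rewrite /ddz /ddzb.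
  have nz2 : (2 : R[i]) != 0 by rewrite pnatr_eq0.
  have ni : ('i : R[i]) != 0 by exact: neq0Ci.
  move=> /eqP; rewrite mulf_eq0 invr_eq0 (negbTE nz2) subr_eq0 => /eqP e.
  move/eqP; rewrite mulf_eq0 invr_eq0 (negbTE nz2) e -mulr2n -mulr_natl !mulf_eq0 (negbTE nz2) (negbTE ni) /=.
  move/eqP=> e2; move: e; rewrite e2 mulr0 => e1.
  by case: vE => ->.
have d w : is_derive w (1 : R) (fun s : R => complex.Re (f (z + s%:C * v))) 0 /\
           is_derive w (1 : R) (fun s : R => complex.Im (f (z + s%:C * v))) 0.
  have [h1 hi] := smooth_is_pd sf (Pz w).
  have h : is_pd v f (z + w%:C * v) (pd v f (z + w%:C * v)).
    by case: vE => e; move: h1 hi; rewrite e.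
  by have := is_pd_shift h; rewrite (p0 _ (Pz w)).
have e1 := is_derive_0_is_cst t 0 (fun w => (d w).1).
have e2 := is_derive_0_is_cst t 0 (fun w => (d w).2).
move: e1 e2; rewrite mul0r addr0; case: (f _) (f _) => a b [c e] /=.
by move=> -> ->.
Qed.

(** A point off the real axis is joined to 2 by a horizontal segment up to real part 2 and then a
    vertical one; a real point is first moved vertically by $i$. None of these lines meets 0 or
    1. *)
Lemma constant_punctured (f : R[i] -> R[i]) z : isd P f (fun=> 0) (fun=> 0) -> P z -> f z = f 2.
Proof.
move=> hf Pz.
have Re_add (w v : R[i]) : complex.Re (w + v) = complex.Re w + complex.Re v by case: w v => a b [].
have Im_add (w v : R[i]) : complex.Im (w + v) = complex.Im w + complex.Im v by case: w v => a b [].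
have punc w : complex.Im w != 0 \/ (complex.Re w != 0 /\ complex.Re w != 1) -> P w.
  move=> h; split; apply/eqP => e; move: h; rewrite e /= eqxx; first by case=> [//|[]].
  by case=> [//|[_]]; rewrite eqxx.
have ver w t : complex.Re w != 0 -> complex.Re w != 1 -> f (w + t%:C * 'i) = f w.
  move=> r0 r1; apply: constant_line => //; first by right.
  move=> s; apply: punc; right; rewrite Re_add.
  have -> : complex.Re (s%:C * 'i) = 0 by rewrite -complexiE /=; ring.
  by rewrite addr0.
have hor w t : complex.Im w != 0 -> f (w + t%:C * 1) = f w.
  move=> r0; apply: constant_line => //; first by left.
  by move=> s; apply: punc; left; rewrite Im_add mulr1 addr0.
have off w : complex.Im w != 0 -> f w = f 2.
  move=> w0; rewrite -(hor w (2 - complex.Re w)) // -(ver 2 (complex.Im w)).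
  - congr f; case: (w) => a b; rewrite -complexiE; apply/eqP; rewrite eq_complex /=.
    by apply/andP; split; apply/eqP; ring.
  - by rewrite /= addr_eq0; apply/eqP; lra.
  by apply/eqP => /=; lra.
have [i0|i0] := eqVneq (complex.Im z) 0; last exact: off.
have [r0 r1] : complex.Re z != 0 /\ complex.Re z != 1.
  case: Pz => z0 z1; split; [apply: contraNneq z0|apply: contraNneq z1] => e;
  by rewrite [z]complexE e i0 mulr0 addr0.
rewrite -(ver z 1 r0 r1) off//.
by rewrite Im_add i0 add0r mul1r -complexiE /= oner_eq0.
Qed.

End Connectedness.

(** * The extended adjoint surface in one chart *)

Section SphereExtension.
Variables (R : realType) (n : nat) (l : R[i]).
Local Notation P := (@punctured R).

Lemma isd_dlt : isd setT (@dlt R) (@dlt1 R) (fun=> 0).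
Proof.
have h := isd_id openT : isd (R := R) setT id _ _.
refine (isd_eq (isdM openT h (isdD openT h (isdN openT (isd_cst openT 1)))) _ _) => z _.
  by rewrite /dlt1; ring.
by rewrite oppr0 addr0 mulr0 mul0r addr0.
Qed.

Lemma dlt_simple (z : R[i]) : dlt z = 0 -> dlt1 z != 0.
Proof.
move/eqP; rewrite dlt_eq0 /dlt1 => /orP[] /eqP ->; first by rewrite mulr0 sub0r oppr_eq0 oner_eq0.
by have -> : 2 * 1 - 1 = 1 :> R[i] by [ring]; rewrite oner_eq0.
Qed.

Section Chart.
Variables (a3 a2 b3 b2 c2 c3 c : 'rV[R[i]]_n) (x : R[i] -> 'rV[R]_n) (b : 'rV[R]_n).
Hypotheses (G : gram l a3 a2 b3 b2 c2 c3) (l0 : l != 0).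
Local Notation phi := (rphi a3 a2 b3 b2 c2 c3).
Local Notation phi1 := (rphi1 a3 a2 b3 b2 c2 c3).
Local Notation F := (fun z => rprim a3 a2 b3 b2 c2 c3 z + c).
Hypothesis xE : forall z, P z -> cmap x z = F z + vconj (F z) + cplx b.
Hypothesis imm : forall z, P z -> dot (F z) (vconj (phi z)) != 0 \/ dot (F z) (vconj (phi1 z)) != 0.

Lemma isv_prim : isv P F phi (fun=> 0).
Proof.
refine (isv_eq (isvD (@open_punctured R) (isv_rprim a3 a2 b3 b2 c2 c3) (isv_cst (@open_punctured R) c)) _ _).
  by move=> z _; rewrite addr0.
by move=> z _; rewrite addr0.
Qed.

Lemma chart_sphere : exists y : R[i] -> 'rV[R]_(n + 1), [/\ willmore setT y,
  forall z, P z -> y z = stereo (hatx phi F x z) &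
  forall z, dlt z = 0 -> y z = row_mx 0 1%:M].
Proof.
have PE : P = [set z | dlt z != 0] :> set R[i]^o by apply/seteqP; split => z /puncturedP.
have sd := smooth_dlt R; have hd := isd_self sd.
pose r z := rnum a3 a2 b3 b2 c2 c3 z + dlt z *: c.
have sr : vsmooth setT r.
  exact: isv_smooth (isvD openT (isv_self (smooth_rnum a3 a2 b3 b2 c2 c3)) (isvZ openT hd (isv_cst openT c))).
(* Adding [c] to the primitive adds [dlt z *: c] to the numerator, which preserves divisibility by
   [dlt]; [r1] and [r2] are the quotients of the two pairings. *)
pose r1 z := l * (15 * z ^+ 2 - 21 / 2 * z + 3) + 2 * dot (rnum a3 a2 b3 b2 c2 c3 z) c + dlt z * dot c c.
pose r2 z := l * (15 / 2 * z ^+ 3 - 9 * z ^+ 2 + 6 * z - 3 / 2) + dot (rpi a3 a2 b3 b2 c2 c3 z) c.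
have sp : smooth setT (fun z : R[i] => l * (15 * z ^+ 2 - 21 / 2 * z + 3)) by smooth_poly.
have sp' : smooth setT (fun z : R[i] => l * (15 / 2 * z ^+ 3 - 9 * z ^+ 2 + 6 * z - 3 / 2)) by smooth_poly.
have hc := isv_cst openT c.
have sr1 : smooth setT r1.
  exact: isd_smooth (isdD openT (isdD openT (isd_self sp) (isdM openT (isd_cst openT 2)
    (isd_dot openT (isv_self (smooth_rnum a3 a2 b3 b2 c2 c3)) hc))) (isdM openT hd (isd_cst openT (dot c c)))).
have sr2 : smooth setT r2.
  exact: isd_smooth (isdD openT (isd_self sp') (isd_dot openT (isv_self (smooth_rpi a3 a2 b3 b2 c2 c3)) hc)).
have nc := rphi_null G l0; have hF := isv_prim; rewrite PE in nc hF.
have [] := willmore_across_poles isd_dlt dlt_simple sr (smooth_rpi a3 a2 b3 b2 c2 c3) sr1 sr2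
  (rpi_neq0 G l0) _ (rpi_square G) _ _ nc hF (x := x) (b := b) _ _ _ _.
- move=> z k d0; rewrite /r d0 scale0r addr0; exact: rnum_indep G l0 _ _ d0.
- move=> z; rewrite /r /r1; have e := rnum_square G z; move: e.
  move: (rnum _ _ _ _ _ _ z) (dlt z) (l * _) => v d t e.
  by rewrite !(dotDl, dotDr, dotZl, dotZr) e (dotC c v); move: (dot v c) (dot c c) => s1 s2; ring.
- move=> z; rewrite /r /r2; have e := rnum_rpi G z; move: e.
  move: (rnum _ _ _ _ _ _ z) (rpi _ _ _ _ _ _ z) (dlt z) (l * _) => v w d t e.
  by rewrite dotDl dotZl e (dotC c w); ring.
- by move=> z /puncturedP; exact: xE.
- by move=> z /puncturedP; exact: imm.
- by move=> z Uz; exists (dlt z ^+ 3); [rewrite expf_neq0|exact/rpiE/puncturedP].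
- move=> z Uz; exists (dlt z ^+ 2 * dlt1 z / 2); rewrite /r rnumE; last exact/puncturedP.
  by move: (rprim _ _ _ _ _ _ z) (phi z) => p q; rewrite scalerDr addrAC.
by move=> y [hw hy hn]; exists y; split => // z Pz; apply/hy/puncturedP.
Qed.

End Chart.
End SphereExtension.

(** * The symmetry z |-> 1/z *)

Section Inversion.
Variables (R : realType) (n : nat) (u3 u2 v3 v2 w2 w3 : 'rV[R[i]]_n).
Local Notation P := (@punctured R).
Local Notation phi := (rphi u3 u2 v3 v2 w2 w3).
Local Notation phi1 := (rphi1 u3 u2 v3 v2 w2 w3).
Local Notation psi := (rphi (- w3) (- w2) v3 (v3 - v2) (- u2) (- u3)).
Local Notation psi1 := (rphi1 (- w3) (- w2) v3 (v3 - v2) (- u2) (- u3)).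

Lemma comb_swap a1 a2 a3 a4 a5 a6 : comb (- w3) (- w2) v3 (v3 - v2) (- u2) (- u3) a1 a2 a3 a4 a5 a6 =
  comb u3 u2 v3 v2 w2 w3 (- a6) (- a5) (a3 + a4) (- a4) (- a2) (- a1).
Proof. by rewrite /comb; vring. Qed.

Lemma punctured_inv (z : R[i]) : P z -> P z^-1.
Proof. by move=> [z0 z1]; split; [rewrite invr_eq0|rewrite invr_eq1]. Qed.

Let sub_inv (z : R[i]) : z != 0 -> z - 1 != 0 -> z^-1 - 1 = - (z - 1) / z /\ z^-1 - 1 != 0.
Proof.
move=> z0 z1; have e : z^-1 - 1 = - (z - 1) / z by field.
by split => //; rewrite e mulf_neq0 ?oppr_eq0 ?invr_eq0.
Qed.

Let nz2 : (2 : R[i]) != 0. Proof. by rewrite pnatr_eq0. Qed.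

(** The factor is the derivative of $1/z$: the swapped coefficients describe the same curve in the
    new coordinate. *)
Lemma rphi_inv z : P z -> psi z = (- z ^- 2) *: phi z^-1.
Proof.
move=> [z0 z1']; have z1 : z - 1 != 0 by rewrite subr_eq0.
have [e e0] := sub_inv z0 z1; rewrite /rphi comb_swap combZ; apply: eq_comb; rewrite ?e;
by field; rewrite ?z0 ?z1 ?oppr_eq0.
Qed.

Lemma rphi1_inv z : P z -> psi1 z = (2 * z ^- 3) *: phi z^-1 + z ^- 4 *: phi1 z^-1.
Proof.
move=> [z0 z1']; have z1 : z - 1 != 0 by rewrite subr_eq0.
have [e e0] := sub_inv z0 z1; rewrite /rphi /rphi1 comb_swap !combZ combD; apply: eq_comb; rewrite ?e;
by field; rewrite ?z0 ?z1 ?oppr_eq0.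
Qed.

(** Primitives of one curve agree up to a constant. It has to be carried along, since the adjoint
    surface depends on it. *)
Lemma rprim_inv z : P z -> rprim u3 u2 v3 v2 w2 w3 z^-1 =
  rprim (- w3) (- w2) v3 (v3 - v2) (- u2) (- u3) z + (v2 - 2^-1 *: v3).
Proof.
move=> [z0 z1']; have z1 : z - 1 != 0 by rewrite subr_eq0.
have [e e0] := sub_inv z0 z1; have -> : v2 - 2^-1 *: v3 = comb u3 u2 v3 v2 w2 w3 0 0 (- 2^-1) 1 0 0.
  by rewrite /comb; vring.
rewrite /rprim comb_swap combD; apply: eq_comb; rewrite ?e;
by field; rewrite ?z0 ?z1 ?oppr_eq0 ?nz2.
Qed.

Lemma perp_inv (F : 'rV[R[i]]_n) z : P z ->
  dot F (vconj (phi z^-1)) != 0 \/ dot F (vconj (phi1 z^-1)) != 0 ->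
  dot F (vconj (psi z)) != 0 \/ dot F (vconj (psi1 z)) != 0.
Proof.
move=> Pz; have [z0 _] := Pz; have c0 k : (z ^- k)^* != 0 by rewrite conjC_eq0 invr_eq0 expf_neq0.
rewrite (rphi_inv Pz) (rphi1_inv Pz); move: (phi z^-1) (phi1 z^-1) => p p1.
rewrite vconjD !vconjZ dotDr !dotZr rmorphN /= mulNr oppr_eq0.
have [->|f0 _] := eqVneq (dot F (vconj p)) 0; last by left; rewrite mulf_neq0.
by case=> [|f1]; rewrite ?eqxx//; right; rewrite mulr0 add0r mulf_neq0.
Qed.

(** The coefficient [aa] scales inversely to [phi], so the projection of the primitive on [phi] does
    not depend on the coordinate. *)
Lemma hatc_inv (F F1 : R[i] -> 'rV[R[i]]_n) (x x1 : R[i] -> 'rV[R]_n) z : P z ->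
  F1 z = F z^-1 -> x1 z = x z^-1 -> hatc psi F1 x1 z = hatc phi F x z^-1.
Proof.
move=> Pz eF ex; have [z0 _] := Pz.
suff e : aa psi F1 z *: psi z = aa phi F z^-1 *: phi z^-1.
  by rewrite /hatc ex; exact (congr1 (fun v => cplx (x z^-1) + (v + vconj v)) e).
rewrite /aa /rho eF (rphi_inv Pz); move: (phi z^-1) (F z^-1) => p f.
rewrite vconjZ dotZl !dotZr scalerA; congr (_ *: _).
have k0 : - z ^- 2 != 0 by rewrite oppr_eq0 invr_eq0 expf_neq0.
have kb0 : (- z ^- 2)^* != 0 by rewrite conjC_eq0.
move: (- z ^- 2) ((- z ^- 2)^*) k0 kb0 => k kb k0 kb0; rewrite !invfM mulrA mulrACA.
by move: (dot _ _) ((dot _ _)^-1) => d r; field; rewrite ?k0 ?kb0.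
Qed.

End Inversion.

(** * Assembling the Willmore sphere *)

Section AdjointSphere.
Variables (R : realType) (n : nat) (l : R[i]) (u3 u2 v3 v2 w2 w3 : 'rV[R[i]]_n) (x : R[i] -> 'rV[R]_n).
Local Notation P := (@punctured R).
Local Notation phi := (rphi u3 u2 v3 v2 w2 w3).
Local Notation phi1 := (rphi1 u3 u2 v3 v2 w2 w3).
Local Notation prim := (rprim u3 u2 v3 v2 w2 w3).
Hypotheses (G : gram l u3 u2 v3 v2 w2 w3) (l0 : l != 0).
Hypotheses (sx : vsmooth P (cmap x)) (xz : forall z, P z -> vz (cmap x) z = phi z).

Let oP := @open_punctured R.

Lemma isv_x : isv P (cmap x) phi (fun z => vconj (phi z)).
Proof. by apply: isv_eq (isv_cmap oP sx) _ _ => z Pz; rewrite xz. Qed.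

(** The difference of $x$ and twice the real part of the primitive has vanishing derivatives, so it
    is constant by connectedness; its value is taken at 2. *)
Lemma x_primitive : exists b : 'rV[R]_n, forall z, P z -> cmap x z = prim z + vconj (prim z) + cplx b.
Proof.
have hF := isv_rprim u3 u2 v3 v2 w2 w3.
have h := isvD oP isv_x (isvN oP (isvD oP hF (isv_conj oP hF))).
have h0 : isv P (fun z => cmap x z - (prim z + vconj (prim z))) (fun=> 0) (fun=> 0).
  by apply: isv_eq h _ _ => z _; rewrite ?vconj0 ?addr0 ?add0r subrr.
exists (map_mx (@complex.Re R) (cmap x 2 - (prim 2 + vconj (prim 2)))) => z Pz.
have -> : cplx (map_mx (@complex.Re R) (cmap x 2 - (prim 2 + vconj (prim 2)))) =
    cmap x 2 - (prim 2 + vconj (prim 2)).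
  apply: cplx_reP; rewrite vconjD vconjN vconjD vconjK cplx_conj; congr (_ - _); exact: addrC.
have <- : cmap x z - (prim z + vconj (prim z)) = cmap x 2 - (prim 2 + vconj (prim 2)).
  apply/rowP => j; have hj := isd_eq (h0 j) (gz := fun=> 0) (gb := fun=> 0)
    (fun _ _ => mxE _ _ _ _) (fun _ _ => mxE _ _ _ _).
  exact: (constant_punctured hj Pz).
by move: (prim z + _) => p; rewrite addrC subrK.
Qed.

(* The bilinear form being nondegenerate on the coefficients, some vector pairs with them as
   required by [generic_position]; the prescribed values are symmetric under z |-> 1/z. *)
Lemma generic_dual : exists be : 'rV[R[i]]_n, [/\ dot be u3 = 0, dot be v3 = 0 & dot be w3 = 0] /\
  [/\ dot be u2 = 15 * l, dot be v2 = 2 * (15 * l) & dot be w2 = 15 * l].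
Proof.
(* 15 times the inverse Gram matrix for [l = 1], applied to the vector $(0,1,0,2,1,0)$ of wanted
   pairings. *)
exists (comb u3 u2 v3 v2 w2 w3 (-4) (-14) 6 (-12) (-14) (-4)).
have e3 : u3 = comb u3 u2 v3 v2 w2 w3 1 0 0 0 0 0 by rewrite /comb; vring.
have e2 : u2 = comb u3 u2 v3 v2 w2 w3 0 1 0 0 0 0 by rewrite /comb; vring.
have f3 : v3 = comb u3 u2 v3 v2 w2 w3 0 0 1 0 0 0 by rewrite /comb; vring.
have f2 : v2 = comb u3 u2 v3 v2 w2 w3 0 0 0 1 0 0 by rewrite /comb; vring.
have g2 : w2 = comb u3 u2 v3 v2 w2 w3 0 0 0 0 1 0 by rewrite /comb; vring.
have g3 : w3 = comb u3 u2 v3 v2 w2 w3 0 0 0 0 0 1 by rewrite /comb; vring.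
have d v (a1 a2 a3 a4 a5 a6 : R[i]) : v = comb u3 u2 v3 v2 w2 w3 a1 a2 a3 a4 a5 a6 ->
    dot (comb u3 u2 v3 v2 w2 w3 (-4) (-14) 6 (-12) (-14) (-4)) v =
    l * gform (-4) (-14) 6 (-12) (-14) (-4) a1 a2 a3 a4 a5 a6 by move=> ->; exact: dot_comb G _ _ _ _ _ _ _ _ _ _ _ _.
by split; split; [rewrite (d _ _ _ _ _ _ _ e3)|rewrite (d _ _ _ _ _ _ _ f3)|rewrite (d _ _ _ _ _ _ _ g3)
  |rewrite (d _ _ _ _ _ _ _ e2)|rewrite (d _ _ _ _ _ _ _ f2)|rewrite (d _ _ _ _ _ _ _ g2)]; rewrite /gform; field.
Qed.

(** A point outside the square has modulus at least 1, so its inverse lies in the unit disc. Hence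
    the squares of the two charts cover the sphere, and a bound on each is enough. *)
Lemma not_in_square (z : R[i]) : ~ in_square z -> in_square z^-1.
Proof.
case: z => a b; rewrite /in_square /= => h.
have n1 : 1 <= a ^+ 2 + b ^+ 2.
  rewrite leNgt; apply/negP => lt; apply: h; have := sqr_ge0 a; have := sqr_ge0 b => h1 h2.
  by split; rewrite -(@expr_le1 _ 2)// real_normK ?num_real//; lra.
have n0 : 0 < a ^+ 2 + b ^+ 2 by exact: lt_le_trans n1.
have := sqr_ge0 a; have := sqr_ge0 b => h1 h2.
by split; rewrite -(@expr_le1 _ 2)// real_normK ?num_real// ?sqrrN expr_div_n ler_pdivrMr ?exprn_gt0// mul1r;
  rewrite expr2; nra.
Qed.

Lemma gram_adjoint_sphere : has_adjoint_sphere x.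
Proof.
have [b xE] := x_primitive; have [be [be3 be2]] := generic_dual.
pose c1 := v2 - 2^-1 *: v3 : 'rV[R[i]]_n.
have k0 : 15 * l != 0 by rewrite mulf_neq0// pnatr_eq0.
have [B0 hB0] := generic_position G l0 0 k0 be3 be2.
have G1 := gram_swap G.
have k1 : - (15 * l) != 0 by rewrite oppr_eq0.
(* The same [be] serves the chart at infinity, with [k] replaced by its opposite. *)
have be3' : [/\ dot be (- w3) = 0, dot be v3 = 0 & dot be (- u3) = 0].
  by case: be3 => b1 b2 b3; split; rewrite ?dotNr ?b1 ?b3 ?oppr0.
have be2' : [/\ dot be (- w2) = - (15 * l), dot be (v3 - v2) = 2 * - (15 * l) & dot be (- u2) = - (15 * l)].
  case: be3 be2 => b1 b2 b3 [b4 b5 b6]; split; rewrite ?dotDr ?dotNr ?b4 ?b5 ?b6 ?b2 //.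
  by rewrite add0r mulrN.
have [B1 hB1] := generic_position G1 l0 c1 k1 be3' be2'.
(* The summand 1 ensures $t\le t^2$, so that $t^2$ exceeds both bounds. *)
pose t : R := `|B0| + `|B1| + 1.
have tt : t <= t ^+ 2.
  by rewrite ler_eXnr// /t; have := normr_ge0 B0; have := normr_ge0 B1; lra.
have t0 : B0 < t ^+ 2.
  by apply: lt_le_trans tt; rewrite /t; have := ler_norm B0; have := normr_ge0 B1; lra.
have t1 : B1 < t ^+ 2.
  by apply: lt_le_trans tt; rewrite /t; have := ler_norm B1; have := normr_ge0 B0; lra.
pose c : 'rV[R[i]]_n := 0 + t%:C *: vconj be.
pose c' : 'rV[R[i]]_n := c1 + t%:C *: vconj be.
pose F z := prim z + c; pose F1 z := rprim (- w3) (- w2) v3 (v3 - v2) (- u2) (- u3) z + c'.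
have FF z : P z -> F1 z = F z^-1 by move=> Pz; rewrite /F rprim_inv// /F1 /c' /c add0r addrA.
have imm z : P z -> dot (F z) (vconj (phi z)) != 0 \/ dot (F z) (vconj (phi1 z)) != 0.
  move=> Pz; have [sz|/not_in_square sz] := pselect (in_square z); first exact: hB0 t0 z Pz sz.
  have Pi := punctured_inv Pz.
  have h1 : dot (F1 z^-1) (vconj (rphi (- w3) (- w2) v3 (v3 - v2) (- u2) (- u3) z^-1)) != 0 \/
    dot (F1 z^-1) (vconj (rphi1 (- w3) (- w2) v3 (v3 - v2) (- u2) (- u3) z^-1)) != 0 := hB1 t t1 _ Pi sz.
  have := perp_inv Pz h1; rewrite (FF _ Pi) invrK !opprK.
  by have -> : v3 - (v3 - v2) = v2 by rewrite opprB addrC subrK.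
have imm1 z : P z -> dot (F1 z) (vconj (rphi (- w3) (- w2) v3 (v3 - v2) (- u2) (- u3) z)) != 0 \/
    dot (F1 z) (vconj (rphi1 (- w3) (- w2) v3 (v3 - v2) (- u2) (- u3) z)) != 0.
  by move=> Pz; rewrite FF//; apply: perp_inv => //; apply/imm/punctured_inv.
(* The shift of the primitive by [c] is compensated in [b], so that $x$ itself is unchanged. *)
pose b' := b - map_mx (@complex.Re R) (c + vconj c).
have b'E : cplx b' = cplx b - (c + vconj c).
  have e : cplx (map_mx (@complex.Re R) (c + vconj c)) = c + vconj c.
    by apply: cplx_reP; rewrite vconjD vconjK addrC.
  by rewrite -e /cplx -map_mxB.
have xE0 z : P z -> cmap x z = (prim z + c) + vconj (prim z + c) + cplx b'.
  by move=> Pz; rewrite xE// b'E vconjD; vring.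
pose x1 z := x z^-1.
have xE1 z : P z -> cmap x1 z = F1 z + vconj (F1 z) + cplx b'.
  by move=> Pz; rewrite /cmap /x1 -/(cmap x z^-1) (xE0 _ (punctured_inv Pz)) FF.
have [y0 [w0 e0 n0]] := chart_sphere G l0 xE0 imm.
have [y1 [w1 e1 n1]] := chart_sphere G1 l0 xE1 imm1.
have y01 z : z != 0 -> y0 z^-1 = y1 z.
  (* The point 1 is a pole in both charts, where both surfaces take the value at infinity. *)
  move=> z0; have [->|z1] := eqVneq z 1.
    by rewrite invr1 n0 ?n1// /dlt subrr mulr0.
  have Pz : P z by [].
  rewrite (e0 _ (punctured_inv Pz)) (e1 _ Pz).
  exact (congr1 (fun v => stereo (map_mx (@complex.Re R) v)) (esym (hatc_inv u3 u2 v3 v2 w2 w3 Pz (FF z Pz) (erefl (x1 z))))).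
have nc := rphi_null G l0; have hF := isv_prim u3 u2 v3 v2 w2 w3 c.
exists (fun z => stereo (hatx phi F x z)); split.
- have [[sy _] _] := hat_conformal oP nc hF isv_x imm.
  exact (adjoint_of_minimal oP nc hF isv_x sy).
- exists (fun o => if o is Some z then y0 z else y1 0); split; first exact: e0.
  split; first exact: w0.
  have -> // : chart1 (fun o => if o is Some z then y0 z else y1 0) = y1.
  by apply/funext => z; rewrite /chart1; case: eqVneq => [->//|/y01].
have P2 : P 2 by split; rewrite ?pnatr_eq0// -subr_eq0; have -> : 2 - 1 = 1 :> R[i] by [ring]; rewrite oner_eq0.
apply: (adjoint_not_superconformal oP nc hF isv_x P2).
have d2 : dlt 2 = 2 :> R[i] by rewrite /dlt; ring.
rewrite (rphi2_square G P2) d2 !mulf_neq0 ?invr_eq0 ?expf_neq0 ?oppr_eq0 ?pnatr_eq0//.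
Qed.

End AdjointSphere.

(** * The Gram matrix of the coefficients *)

Section GramEquations.
Variable R : realType.
Local Notation P := (@punctured R).

(** The integers 2, 3, ... avoid the punctures and provide more roots than the degree allows. *)
Lemma poly_punctured_eq0 (p : {poly R[i]}) : (forall z, P z -> p.[z] = 0) -> p = 0.
Proof.
move=> h; apply/eqP/negPn/negP => p0.
pose rs : seq R[i] := [seq k.+2%:R | k <- iota 0 (size p)].
have := @max_poly_roots _ p rs p0; rewrite size_map size_iota ltnn => H; apply: notF; apply: H.
  apply/allP => _ /mapP[k _ ->]; apply/rootP/h; split; first by rewrite pnatr_eq0.
  by rewrite -[1]/(1%:R) eqr_nat.
rewrite map_inj_uniq ?iota_uniq// => j k /eqP.
by rewrite eqr_nat => /eqP[].
Qed.

Variables d11 d12 d13 d14 d15 d16 d22 d23 d24 d25 d26 d33 d34 d35 d36 d44 d45 d46 d55 d56 d66 : R[i].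

Definition quad6 (a1 a2 a3 a4 a5 a6 : R[i]) : R[i] :=
  a1 ^+ 2 * d11 + 2 * a1 * a2 * d12 + 2 * a1 * a3 * d13 + 2 * a1 * a4 * d14 + 2 * a1 * a5 * d15 + 2 *
  a1 * a6 * d16 + a2 ^+ 2 * d22 + 2 * a2 * a3 * d23 + 2 * a2 * a4 * d24 + 2 * a2 * a5 * d25 + 2 * a2 *
  a6 * d26 + a3 ^+ 2 * d33 + 2 * a3 * a4 * d34 + 2 * a3 * a5 * d35 + 2 * a3 * a6 * d36 + a4 ^+ 2 * d44
  + 2 * a4 * a5 * d45 + 2 * a4 * a6 * d46 + a5 ^+ 2 * d55 + 2 * a5 * a6 * d56 + a6 ^+ 2 * d66.

Hypothesis null0 : forall z, P z -> quad6 ((z - 1) ^+ 3) (z * (z - 1) ^+ 3) (z ^+ 3) (z ^+ 3 * (z - 1))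
  (dlt z ^+ 3) (z * dlt z ^+ 3) = 0.
Hypothesis null1 : forall z, P z -> quad6 (- 3 * (z - 1) ^+ 4) (- 2 * z * (z - 1) ^+ 4) (- 3 * z ^+ 4)
  (- 2 * z ^+ 4 * (z - 1)) 0 (dlt z ^+ 4) = 0.

(* The multipliers below come from eliminating the 21 unknown products from the coefficients of the
   two polynomials in z. *)
Lemma gram_equations :
  d11 = 0 /\ d12 = 0 /\ d22 = 0 /\ d66 = 0 /\ d56 = 0 /\ d55 = 0 /\ d33 = 0 /\ d34 = 0 /\ d44 = 0 /\
  d14 = 2 * d13 /\ d15 = - d13 /\ d16 = - d13 /\ d23 = (-2) * d13 /\ d24 = (- (5 / 2)) * d13 /\ d25 =
  (1 / 2) * d13 /\ d26 = - d13 /\ d35 = 2 * d13 /\ d36 = - d13 /\ d45 = (- (1 / 2)) * d13 /\ d46 = d13.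
Proof.
(* Adds a multiple of a known equation to the goal; each derivation below is a chain of such
   additions closed by [field]. *)
have L (c p q : R[i]) : p = q -> forall a b, a + c * (p - q) = b -> a = b.
  by move=> -> a b; rewrite subrr mulr0 addr0.
(* The coefficients, by increasing degree, of the polynomials in [null0] and, for [sB], in
   [null1]. *)
pose sA := [:: d11; - 6 * d11 + 2 * d12; 15 * d11 - 12 * d12 + d22; - 20 * d11 + 30 * d12 - 2 * d13 + 2 * d14 +
    2 * d15 - 6 * d22; 15 * d11 - 40 * d12 + 6 * d13 - 8 * d14 - 12 * d15 + 2 * d16 + 15 * d22 - 2 * d23
    + 2 * d24 + 2 * d25; - 6 * d11 + 30 * d12 - 6 * d13 + 12 * d14 + 30 * d15 - 12 * d16 - 20 * d22 + 6
    * d23 - 8 * d24 - 12 * d25 + 2 * d26; d11 - 12 * d12 + 2 * d13 - 8 * d14 - 40 * d15 + 30 * d16 + 15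
    * d22 - 6 * d23 + 12 * d24 + 30 * d25 - 12 * d26 + d33 - 2 * d34 - 2 * d35 + d44 + 2 * d45 + d55; 2
    * d12 + 2 * d14 + 30 * d15 - 40 * d16 - 6 * d22 + 2 * d23 - 8 * d24 - 40 * d25 + 30 * d26 + 2 * d34
    + 6 * d35 - 2 * d36 - 2 * d44 - 8 * d45 + 2 * d46 - 6 * d55 + 2 * d56; - 12 * d15 + 30 * d16 + d22 +
    2 * d24 + 30 * d25 - 40 * d26 - 6 * d35 + 6 * d36 + d44 + 12 * d45 - 8 * d46 + 15 * d55 - 12 * d56 +
    d66; 2 * d15 - 12 * d16 - 12 * d25 + 30 * d26 + 2 * d35 - 6 * d36 - 8 * d45 + 12 * d46 - 20 * d55 +
    30 * d56 - 6 * d66; 2 * d16 + 2 * d25 - 12 * d26 + 2 * d36 + 2 * d45 - 8 * d46 + 15 * d55 - 40 * d56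
    + 15 * d66; 2 * d26 + 2 * d46 - 6 * d55 + 30 * d56 - 20 * d66; d55 - 12 * d56 + 15 * d66; 2 * d56 -
    6 * d66; d66].
pose sB := [:: 9 * d11; - 72 * d11 + 12 * d12; 252 * d11 - 96 * d12 + 4 * d22; - 504 * d11 + 336 * d12 - 32 *
    d22; 630 * d11 - 672 * d12 + 18 * d13 - 12 * d14 - 6 * d16 + 112 * d22; - 504 * d11 + 840 * d12 - 72
    * d13 + 60 * d14 + 48 * d16 - 224 * d22 + 12 * d23 - 8 * d24 - 4 * d26; 252 * d11 - 672 * d12 + 108
    * d13 - 120 * d14 - 168 * d16 + 280 * d22 - 48 * d23 + 40 * d24 + 32 * d26; - 72 * d11 + 336 * d12 -
    72 * d13 + 120 * d14 + 336 * d16 - 224 * d22 + 72 * d23 - 80 * d24 - 112 * d26; 9 * d11 - 96 * d12 +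
    18 * d13 - 60 * d14 - 420 * d16 + 112 * d22 - 48 * d23 + 80 * d24 + 224 * d26 + 9 * d33 - 12 * d34 -
    6 * d36 + 4 * d44 + 4 * d46 + d66; 12 * d12 + 12 * d14 + 336 * d16 - 32 * d22 + 12 * d23 - 40 * d24
    - 280 * d26 + 12 * d34 + 24 * d36 - 8 * d44 - 20 * d46 - 8 * d66; - 168 * d16 + 4 * d22 + 8 * d24 +
    224 * d26 - 36 * d36 + 4 * d44 + 40 * d46 + 28 * d66; 48 * d16 - 112 * d26 + 24 * d36 - 40 * d46 -
    56 * d66; - 6 * d16 + 32 * d26 - 6 * d36 + 20 * d46 + 70 * d66; - 4 * d26 - 4 * d46 - 56 * d66; 28 *
    d66; - 8 * d66; d66].
have eA : Poly sA = 0.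
  apply: poly_punctured_eq0 => z Pz; rewrite -[RHS](null0 Pz) horner_Poly /= /quad6 /dlt.
  by ring.
have eB : Poly sB = 0.
  apply: poly_punctured_eq0 => z Pz; rewrite -[RHS](null1 Pz) horner_Poly /= /quad6 /dlt.
  by ring.
have cA k : sA`_k = 0 by rewrite -coef_Poly eA coef0.
have cB k : sB`_k = 0 by rewrite -coef_Poly eB coef0.
have hA0 := cA 0%N; rewrite /= in hA0.
have hA1 := cA 1%N; rewrite /= in hA1.
have hA2 := cA 2%N; rewrite /= in hA2.
have hA3 := cA 3%N; rewrite /= in hA3.
have hA4 := cA 4%N; rewrite /= in hA4.
have hA5 := cA 5%N; rewrite /= in hA5.
have hA9 := cA 9%N; rewrite /= in hA9.
have hA10 := cA 10%N; rewrite /= in hA10.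
have hA11 := cA 11%N; rewrite /= in hA11.
have hA12 := cA 12%N; rewrite /= in hA12.
have hA13 := cA 13%N; rewrite /= in hA13.
have hA14 := cA 14%N; rewrite /= in hA14.
have hB4 := cB 4%N; rewrite /= in hB4.
have hB5 := cB 5%N; rewrite /= in hB5.
have hB6 := cB 6%N; rewrite /= in hB6.
have hB7 := cB 7%N; rewrite /= in hB7.
have hB8 := cB 8%N; rewrite /= in hB8.
have hB9 := cB 9%N; rewrite /= in hB9.
have hB10 := cB 10%N; rewrite /= in hB10.
have hB11 := cB 11%N; rewrite /= in hB11.
have hB12 := cB 12%N; rewrite /= in hB12.
have hB13 := cB 13%N; rewrite /= in hB13.
clear cA cB eA eB sA sB.
have e11 : d11 = 0.
  by apply: (L (-1) _ _ hA0); field.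
have e12 : d12 = 0.
  by apply: (L (-3) _ _ e11); apply: (L (- (1 / 2)) _ _ hA1); field.
have e22 : d22 = 0.
  by apply: (L 15 _ _ e11); apply: (L (-12) _ _ e12); apply: (L (-1) _ _ hA2); field.
have e66 : d66 = 0.
  by apply: (L (-1) _ _ hA14); field.
have e56 : d56 = 0.
  by apply: (L (-3) _ _ e66); apply: (L (- (1 / 2)) _ _ hA13); field.
have e55 : d55 = 0.
  by apply: (L 15 _ _ e66); apply: (L (-12) _ _ e56); apply: (L (-1) _ _ hA12); field.
have e33 : d33 = 0.
  by apply: (L (-201) _ _ e11); apply: (L (532 / 3) _ _ e12); apply: (L (- (196 / 9)) _ _ e22); apply:
    (L (- (35 / 3)) _ _ e66); apply: (L (- (5 / 36)) _ _ hB11); apply: (L (- (7 / 18)) _ _ hB13); apply: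
    (L (- (1 / 9)) _ _ hB10); apply: (L (1 / 6) _ _ hB5); apply: (L (- (1 / 9)) _ _ hB8); apply: (L (-
    (1 / 12)) _ _ hB7); apply: (L (- (1 / 9)) _ _ hB9); apply: (L (4 / 9) _ _ hB4); apply: (L (- (2 /
    9)) _ _ hB12); field.
have e34 : d34 = 0.
  by apply: (L 588 _ _ e11); apply: (L (-517) _ _ e12); apply: (L (190 / 3) _ _ e22); apply: (L 18 _ _
    e66); apply: (L (- (4 / 3)) _ _ hB4); apply: (L (- (7 / 12)) _ _ hB5); apply: (L (- (1 / 12)) _ _
    hB9); apply: (L (- (1 / 6)) _ _ hB6); apply: (L (5 / 12) _ _ hB13); apply: (L (- (1 / 6)) _ _ hB10);
    apply: (L (- (1 / 6)) _ _ hB11); field.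
have e44 : d44 = 0.
  by apply: (L (- (1422 / 5)) _ _ e11); apply: (L (1344 / 5) _ _ e12); apply: (L (- (177 / 5)) _ _
    e22); apply: (L (- (602 / 5)) _ _ e66); apply: (L (-4) _ _ hB13); apply: (L (- (9 / 10)) _ _ hB11);
    apply: (L (- (1 / 4)) _ _ hB10); apply: (L (- (21 / 10)) _ _ hB12); apply: (L (- (3 / 20)) _ _ hB6);
    apply: (L (- (1 / 10)) _ _ hB7); apply: (L (1 / 2) _ _ hB4); field.
have e14 : d14 = 2 * d13.
  by apply: (L (-161) _ _ e11); apply: (L 154 _ _ e12); apply: (L (- (70 / 3)) _ _ e22); apply: (L (7
    / 4) _ _ hA3); apply: (L (1 / 2) _ _ hA4); apply: (L (1 / 12) _ _ hA5); apply: (L (1 / 3) _ _ hB4);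
    apply: (L (1 / 24) _ _ hB5); field.
have e15 : d15 = - d13.
  by apply: (L (-10) _ _ e11); apply: (L 15 _ _ e12); apply: (L (-3) _ _ e22); apply: (L 1 _ _ e14);
    apply: (L (- (1 / 2)) _ _ hA3); field.
have e16 : d16 = - d13.
  by apply: (L (-105) _ _ e11); apply: (L 112 _ _ e12); apply: (L (- (56 / 3)) _ _ e22); apply: (L 2 _
    _ e14); apply: (L (1 / 6) _ _ hB4); field.
have e23 : d23 = (-2) * d13.
  by apply: (L (-360) _ _ e11); apply: (L 546 _ _ e12); apply: (L (-126) _ _ e22); apply: (L 25 _ _
    e14); apply: (L 12 _ _ e16); apply: (L (- (1 / 24)) _ _ hB7); apply: (L (- (1 / 4)) _ _ hB6); apply:
    (L (- (5 / 6)) _ _ hB5); field.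
have e24 : d24 = (- (5 / 2)) * d13.
  by apply: (L (195 / 2) _ _ e11); apply: (L (-161) _ _ e12); apply: (L 42 _ _ e22); apply: (L (- (65
    / 6)) _ _ e14); apply: (L (-7) _ _ e16); apply: (L (- (11 / 6)) _ _ e23); apply: (L (7 / 36) _ _
    hB5); apply: (L (- (1 / 144)) _ _ hB7); field.
have e25 : d25 = (1 / 2) * d13.
  by apply: (L (15 / 2) _ _ e11); apply: (L (-20) _ _ e12); apply: (L (15 / 2) _ _ e22); apply: (L
    (-4) _ _ e14); apply: (L (-6) _ _ e15); apply: (L 1 _ _ e16); apply: (L (-1) _ _ e23); apply: (L 1 _
    _ e24); apply: (L (- (1 / 2)) _ _ hA4); field.
have e26 : d26 = - d13.
  by apply: (L 126 _ _ e11); apply: (L (-210) _ _ e12); apply: (L 56 _ _ e22); apply: (L (-15) _ _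
    e14); apply: (L (-12) _ _ e16); apply: (L (-3) _ _ e23); apply: (L 2 _ _ e24); apply: (L (1 / 4) _ _
    hB5); field.
have e35 : d35 = 2 * d13.
  by apply: (L (-28) _ _ e66); apply: (L 35 _ _ e56); apply: (L 1 _ _ e15); apply: (L (-3) _ _ e16);
    apply: (L (-2) _ _ e25); apply: (L 3 _ _ e26); apply: (L (- (10 / 3)) _ _ hA11); apply: (L (-2) _ _
    hA10); apply: (L (- (1 / 6)) _ _ hB12); apply: (L (- (1 / 2)) _ _ hA9); field.
have e36 : d36 = - d13.
  by apply: (L 7 _ _ e66); apply: (L 3 _ _ e16); apply: (L (-4) _ _ e26); apply: (L (- (1 / 6)) _ _
    hB12); apply: (L (- (1 / 12)) _ _ hB11); field.
have e45 : d45 = (- (1 / 2)) * d13.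
  by apply: (L (131 / 10) _ _ e66); apply: (L (-20) _ _ e56); apply: (L (15 / 2) _ _ e55); apply: (L
    (- (19 / 5)) _ _ e16); apply: (L 1 _ _ e25); apply: (L (26 / 5) _ _ e26); apply: (L (- (7 / 5)) _ _
    e36); apply: (L (1 / 10) _ _ hB11); apply: (L (- (1 / 2)) _ _ hA10); field.
have e46 : d46 = d13.
  by apply: (L 14 _ _ e66); apply: (L 1 _ _ e26); apply: (L (1 / 4) _ _ hB13); field.
by do !split.
Qed.

End GramEquations.

(** * From the conditions on x to the Gram matrix *)

Section SpecialSurfaces.
Variables (R : realType).
Local Notation P := (@punctured R).
Let oP := @open_punctured R.

Lemma dot_comb_quad n (u3 u2 v3 v2 w2 w3 : 'rV[R[i]]_n) a1 a2 a3 a4 a5 a6 :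
  dot (comb u3 u2 v3 v2 w2 w3 a1 a2 a3 a4 a5 a6) (comb u3 u2 v3 v2 w2 w3 a1 a2 a3 a4 a5 a6) =
  quad6 (dot u3 u3) (dot u3 u2) (dot u3 v3) (dot u3 v2) (dot u3 w2) (dot u3 w3)
    (dot u2 u2) (dot u2 v3) (dot u2 v2) (dot u2 w2) (dot u2 w3) (dot v3 v3) (dot v3 v2)
    (dot v3 w2) (dot v3 w3) (dot v2 v2) (dot v2 w2) (dot v2 w3) (dot w2 w2) (dot w2 w3) (dot w3 w3)
    a1 a2 a3 a4 a5 a6.
Proof.
rewrite /comb /quad6 !(dotDl, dotDr, dotZl, dotZr).
rewrite (dotC u2 u3) (dotC v3 u3) (dotC v3 u2) (dotC v2 u3) (dotC v2 u2) (dotC v2 v3).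
rewrite (dotC w2 u3) (dotC w2 u2) (dotC w2 v3) (dotC w2 v2).
rewrite (dotC w3 u3) (dotC w3 u2) (dotC w3 v3) (dotC w3 v2) (dotC w3 w2).
by gen_pairings; ring.
Qed.

Lemma surface_derivatives n (x : R[i] -> 'rV[R]_n) (u3 u2 v3 v2 w2 w3 : 'rV[R[i]]_n) :
  (forall z, P z -> vz (cmap x) z = rphi u3 u2 v3 v2 w2 w3 z) ->
  forall z, P z -> vz (vz (cmap x)) z = rphi1 u3 u2 v3 v2 w2 w3 z /\
    vz (vz (vz (cmap x))) z = rphi2 u3 u2 v3 v2 w2 w3 z.
Proof.
move=> e.
have h1 := isv_ext oP (isv_rphi u3 u2 v3 v2 w2 w3) (fun z Pz => esym (e z Pz)).
have e1 z : P z -> vz (vz (cmap x)) z = rphi1 u3 u2 v3 v2 w2 w3 z.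
  by move=> Pz; case/isvP: h1 => _ /(_ z Pz)[].
have h2 := isv_ext oP (isv_rphi1 u3 u2 v3 v2 w2 w3) (fun z Pz => esym (e1 z Pz)).
by move=> z Pz; split; [exact: e1|case/isvP: h2 => _ /(_ z Pz)[]].
Qed.

(** The equations for $x_z$ and $x_{zz}$, cleared of poles by [dlt z ^+ 3] and [dlt z ^+ 4], feed
    [gram_equations]. The value [l = 0] would make $x_{zzz}$ null everywhere. *)
Lemma special_gram n (x : R[i] -> 'rV[R]_n) : special_surface x ->
  exists l u3 u2 v3 v2 w2 w3, [/\ l != 0, gram l u3 u2 v3 v2 w2 w3 &
    forall z, P z -> vz (cmap x) z = rphi u3 u2 v3 v2 w2 w3 z].
Proof.
move=> [[_ hm] [u3 [u2 [v3 [v2 [w2 [w3 hf]]]]]] hs hv].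
have e z : P z -> vz (cmap x) z = rphi u3 u2 v3 v2 w2 w3 z.
  move=> Pz; rewrite (hf z Pz) /rphi /comb.
  by move: (z ^- 3) (z ^- 2) ((z - 1) ^- 3) ((z - 1) ^- 2) => a b c f; rewrite scale1r.
have d := surface_derivatives e.
have n0 z : P z -> dot (rpi u3 u2 v3 v2 w2 w3 z) (rpi u3 u2 v3 v2 w2 w3 z) = 0.
  move=> Pz; have [h _ _] := hm z Pz; rewrite (e z Pz) in h; rewrite (rpiE _ _ _ _ _ _ Pz).
  by move: (rphi _ _ _ _ _ _ z) h => p h; rewrite dotZl dotZr h !mulr0.
have n1 z : P z -> let w := comb u3 u2 v3 v2 w2 w3 (- 3 * (z - 1) ^+ 4) (- 2 * z * (z - 1) ^+ 4)
    (- 3 * z ^+ 4) (- 2 * z ^+ 4 * (z - 1)) 0 (dlt z ^+ 4) in dot w w = 0.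
  move=> Pz w; have h := hs z Pz; rewrite (d z Pz).1 in h.
  have [a0 b0] := Pz; rewrite -subr_eq0 in b0.
  have -> : w = dlt z ^+ 4 *: rphi1 u3 u2 v3 v2 w2 w3 z.
    by rewrite /w /rphi1 combZ /dlt; apply: eq_comb; field; rewrite ?a0 ?b0.
  by move: (rphi1 _ _ _ _ _ _ z) h => p h; rewrite dotZl dotZr h !mulr0.
have := gram_equations (fun z Pz => etrans (esym (dot_comb_quad _ _ _ _ _ _ _ _ _ _ _ _)) (n0 z Pz))
  (fun z Pz => etrans (esym (dot_comb_quad _ _ _ _ _ _ _ _ _ _ _ _)) (n1 z Pz)).
case=> [d11 [d12 [d22 [d66 [d56 [d55 [d33 [d34 [d44 [d14 [d15 [d16 [d23 [d24 [d25 [d26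
  [d35 [d36 [d45 d46]]]]]]]]]]]]]]]]]]].
pose l := dot u3 v3.
have nz2 : (2 : R[i]) != 0 by rewrite pnatr_eq0.
have G : gram l u3 u2 v3 v2 w2 w3.
  have e1 : 1 / 2 * l = l / 2 by move: (l) => t; field.
  have e2 : - (1 / 2) * l = - l / 2 by move: (l) => t; field.
  exact (Gram (And4 d11 d12 (erefl l) d14) (conj d15 d16) (And3 d22 d23 d24) (conj (etrans d25 e1) d26)
    (And4 d33 d34 d35 d36) (And3 d44 (etrans d45 e2) d46) (And3 d55 d56 d66)).
exists l, u3, u2, v3, v2, w2, w3; split; [|exact G|exact e].
apply/eqP => l0; apply: hv => z Pz; rewrite (d z Pz).2 (rphi2_square G Pz) l0.
by rewrite mulr0 mul0r.
Qed.

End SpecialSurfaces.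

(** * The model surface in R^6 and uniqueness *)

Section RealParts.
Variables (R : realType) (n : nat).
Local Notation P := (@punctured R).
Let oP := @open_punctured R.

Definition re_curve (F : R[i] -> 'rV[R[i]]_n) (z : R[i]) : 'rV[R]_n :=
  map_mx (@complex.Re R) (F z + vconj (F z)).

Lemma isv_re_curve F phi : isv P F phi (fun=> 0) ->
  isv P (cmap (re_curve F)) phi (fun z => vconj (phi z)).
Proof.
move=> hF; have h := isvD oP hF (isv_conj oP hF).
have e z : P z -> F z + vconj (F z) = cmap (re_curve F) z.
  by move=> _; apply/esym/cplx_reP; rewrite vconjD vconjK addrC.
by refine (isv_eq (isv_ext oP h e) _ _) => z _; rewrite ?vconj0 ?addr0 ?add0r.
Qed.

Lemma gram_special l u3 u2 v3 v2 w2 w3 : l != 0 -> gram l u3 u2 v3 v2 w2 w3 ->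
  special_surface (re_curve (rprim u3 u2 v3 v2 w2 w3)).
Proof.
move=> l0 G; have h := isv_re_curve (isv_rprim u3 u2 v3 v2 w2 w3).
have nc := rphi_null G l0.
have [sx ex] := (isvP _ _ _ _).1 h.
have e z : P z -> vz (cmap (re_curve (rprim u3 u2 v3 v2 w2 w3))) z = rphi u3 u2 v3 v2 w2 w3 z.
  by move=> Pz; have [] := ex z Pz.
have d := surface_derivatives e.
have h1 := isv_ext oP (isv_rphi u3 u2 v3 v2 w2 w3) (fun z Pz => esym (e z Pz)).
split.
- split; first exact: sx.
  move=> z Pz; have [e1 e2] := ex z Pz; rewrite e1 e2; split.
  + exact: (nc_00 nc Pz).
  + exact/eqP/(rho_neq0 nc Pz).
  + by case/isvP: h1 => _ /(_ z Pz)[].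
- exists u3, u2, v3, v2, w2, w3 => z Pz; rewrite (e z Pz) /rphi /comb.
  by move: (z ^- 3) (z ^- 2) ((z - 1) ^- 3) ((z - 1) ^- 2) => a b c f; rewrite scale1r.
- by move=> z Pz; rewrite (d z Pz).1; exact: (nc_11 nc Pz).
have P2 : P 2 by split; rewrite ?pnatr_eq0// -subr_eq0; have -> : 2 - 1 = 1 :> R[i] by [ring]; rewrite oner_eq0.
move=> hv; have /eqP := hv 2 P2; rewrite (d 2 P2).2 (rphi2_square G P2).
have d2 : dlt 2 = 2 :> R[i] by rewrite /dlt; ring.
by apply/negP; rewrite d2 !mulf_neq0 ?invr_eq0 ?expf_neq0 ?oppr_eq0 ?pnatr_eq0.
Qed.

End RealParts.

(** * Coefficient matrices and a model in C^6 *)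

Section Coordinates.
Variable R : realType.

Definition vec6 (a1 a2 a3 a4 a5 a6 : R[i]) : 'rV[R[i]]_6 := \row_(j < 6) [:: a1; a2; a3; a4; a5; a6]`_j.

Lemma dot_vec6 a1 a2 a3 a4 a5 a6 b1 b2 b3 b4 b5 b6 :
  dot (vec6 a1 a2 a3 a4 a5 a6) (vec6 b1 b2 b3 b4 b5 b6) =
  a1 * b1 + a2 * b2 + a3 * b3 + a4 * b4 + a5 * b5 + a6 * b6.
Proof. by rewrite dotE !big_ord_recr big_ord0 /= !mxE /= add0r. Qed.

Lemma vec6P (v : 'rV[R[i]]_6) : exists a1 a2 a3 a4 a5 a6, v = vec6 a1 a2 a3 a4 a5 a6.
Proof.
pose c k := v 0 (inord k).
exists (c 0%N), (c 1%N), (c 2%N), (c 3%N), (c 4%N), (c 5%N); apply/rowP => j; rewrite !mxE.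
have -> : v 0 j = c j by rewrite /c inord_val.
by case: j => [[|[|[|[|[|[|//]]]]]]].
Qed.

Definition rows6 n (u3 u2 v3 v2 w2 w3 : 'rV[R[i]]_n) : 'M[R[i]]_(6, n) :=
  \matrix_(i < 6) [:: u3; u2; v3; v2; w2; w3]`_i.

Lemma comb_rows n (u3 u2 v3 v2 w2 w3 : 'rV[R[i]]_n) a1 a2 a3 a4 a5 a6 :
  comb u3 u2 v3 v2 w2 w3 a1 a2 a3 a4 a5 a6 = vec6 a1 a2 a3 a4 a5 a6 *m rows6 u3 u2 v3 v2 w2 w3.
Proof. by rewrite mulmx_sum_row !big_ord_recr big_ord0 /= !rowK !mxE /= add0r. Qed.

(** Both sides are [l * l'] times the same form: any two solutions have proportional Gram
    matrices. *)
Lemma gram_rows_dot m n l l' (u3 u2 v3 v2 w2 w3 : 'rV[R[i]]_n) (a3 a2 b3 b2 c2 c3 : 'rV[R[i]]_m) :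
  gram l u3 u2 v3 v2 w2 w3 -> gram l' a3 a2 b3 b2 c2 c3 -> forall v w,
  l' * dot (v *m rows6 u3 u2 v3 v2 w2 w3) (w *m rows6 u3 u2 v3 v2 w2 w3) =
  l * dot (v *m rows6 a3 a2 b3 b2 c2 c3) (w *m rows6 a3 a2 b3 b2 c2 c3).
Proof.
move=> G G' v w; have [x1 [x2 [x3 [x4 [x5 [x6 ->]]]]]] := vec6P v.
have [y1 [y2 [y3 [y4 [y5 [y6 ->]]]]]] := vec6P w.
by rewrite -!comb_rows (dot_comb G) (dot_comb G') mulrCA.
Qed.

Lemma gram_rows_unit l (u3 u2 v3 v2 w2 w3 : 'rV[R[i]]_6) : l != 0 ->
  gram l u3 u2 v3 v2 w2 w3 -> rows6 u3 u2 v3 v2 w2 w3 \in unitmx.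
Proof.
move=> l0 G; rewrite -row_free_unit; apply: inj_row_free => v.
have [x1 [x2 [x3 [x4 [x5 [x6 ->]]]]]] := vec6P v.
rewrite -comb_rows => /(comb_eq0 G l0)[[-> -> ->] [-> -> ->]].
by apply/rowP => j; rewrite !mxE; case: j => [[|[|[|[|[|[|//]]]]]]].
Qed.

Lemma isometry_mx m n (T : 'M[R[i]]_(m, n)) : (forall v w, dot (v *m T) (w *m T) = dot v w) -> T *m T^T = 1%:M.
Proof.
move=> h; apply/matrixP => i j; have := h (delta_mx 0 i) (delta_mx 0 j).
rewrite -!rowE dotE [RHS]/dot trmx_delta -colE !mxE eqxx /= eq_sym => <-.
by apply: eq_bigr => k _; rewrite !mxE.
Qed.

Lemma model_gram : exists u3 u2 v3 v2 w2 w3 : 'rV[R[i]]_6, gram 1 u3 u2 v3 v2 w2 w3.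
Proof.
pose s : R[i] := sqrtC (- 5); pose t : R[i] := sqrtC 15.
have s2 : s * s = - 5 by rewrite -expr2 sqrtCK.
have t2 : t * t = 15 by rewrite -expr2 sqrtCK.
have i2 : 'i * 'i = -1 :> R[i] by rewrite -expr2 sqrCi.
(* A triangular solution: [u3] and [u2] are isotropic in orthogonal coordinate planes, [v3] and [v2]
   stay in the same four dimensions, and the last two coordinates, with $s^2=-5$ and $t^2=15$,
   adjust the products of [w2] and [w3] among themselves. *)
exists (vec6 1 'i 0 0 0 0), (vec6 0 0 1 'i 0 0), (vec6 (1 / 2) (- 'i / 2) (- 1) 'i 0 0),
  (vec6 1 (- 'i) (- (5 / 4)) (5 / 4 * 'i) 0 0),
  (vec6 (- (9 / 2)) (- (7 / 2) * 'i) (- (11 / 4)) (- (13 / 4) * 'i) s 0),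
  (vec6 (5 / 2) (7 / 2 * 'i) (3 / 2) (5 / 2 * 'i) s t).
move: ('i : R[i]) s t i2 s2 t2 => j s t i2 s2 t2.
by split; split; rewrite dot_vec6; field: i2 s2 t2.
Qed.

End Coordinates.

(** * Uniqueness of the associated family *)

Section Uniqueness.
Variable R : realType.
Local Notation P := (@punctured R).
Let oP := @open_punctured R.

Lemma polar (c : R[i]) : c != 0 -> exists r theta : R, 0 < r /\ c = r%:C * (cos theta +i* sin theta).
Proof.
case: c => a b c0.
have p0 : 0 < a ^+ 2 + b ^+ 2.
  rewrite lt_neqAle addr_ge0 ?sqr_ge0// andbT eq_sym paddr_eq0 ?sqr_ge0// !sqrf_eq0.
  by apply: contraNN c0 => /andP[/eqP -> /eqP ->].
pose r := Num.sqrt (a ^+ 2 + b ^+ 2).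
have r0 : 0 < r by rewrite sqrtr_gt0.
have r2 : r ^+ 2 = a ^+ 2 + b ^+ 2 by rewrite sqr_sqrtr// ltW.
have rn : r != 0 by rewrite gt_eqF.
have u1 : (a / r) ^+ 2 + (b / r) ^+ 2 = 1 by rewrite !expr_div_n -mulrDl -r2 divff// expf_neq0.
have h1 : -1 <= a / r <= 1.
  rewrite -ler_norml -(@expr_le1 _ 2)// real_normK ?num_real// -u1 lerDl; exact: sqr_ge0.
have cE := acosK h1; have sE := sin_acos h1.
have sb : Num.sqrt (1 - (a / r) ^+ 2) = `|b / r|.
  by rewrite -u1 addrAC subrr add0r sqrtr_sqr.
(* [acos] reaches the upper half circle only; the lower half needs the opposite angle. *)
have [b0|b0] := leP 0 (b / r).
  exists r, (acos (a / r)); split => //; rewrite cE sE sb ger0_norm//.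
  by apply/eqP; rewrite eq_complex /= !mul0r subr0 addr0 !(mulrC r) !divfK// !eqxx.
exists r, (- acos (a / r)); split => //; rewrite cosN sinN cE sE sb ltr0_norm// opprK.
by apply/eqP; rewrite eq_complex /= !mul0r subr0 addr0 !(mulrC r) !divfK// !eqxx.
Qed.

(** The Gram matrix of $x$ is [l] times that of the model, so the coefficient vectors differ by
    $\sqrt l$ and a linear isometry. Polar coordinates of $\sqrt l$ separate the rotation within the
    associated family from the dilation. *)
Lemma associated_congruent (u3 u2 v3 v2 w2 w3 : 'rV[R[i]]_6) n (x : R[i] -> 'rV[R]_n) :
  gram 1 u3 u2 v3 v2 w2 w3 -> special_surface x ->
  exists xt : R[i] -> 'rV[R]_6,
    associated P (re_curve (rprim u3 u2 v3 v2 w2 w3)) xt /\ congruent P xt x.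
Proof.
move=> G0 /special_gram[l [a3 [a2 [b3 [b2 [c2 [c3 [l0 G xE]]]]]]]].
have m0 : sqrtC l != 0 by rewrite sqrtC_eq0.
have [r [theta [r0 mE]]] := polar m0; pose e : R[i] := cos theta +i* sin theta.
have h := isv_rprim u3 u2 v3 v2 w2 w3.
have he : isv P (fun z => e *: rprim u3 u2 v3 v2 w2 w3 z) (fun z => e *: rphi u3 u2 v3 v2 w2 w3 z) (fun=> 0).
  by refine (isv_eq (isvZ oP (isd_cst oP e) h) _ _) => z _; rewrite ?scale0r ?scaler0 ?add0r.
have ht := isv_re_curve he; have h0 := isv_re_curve h.
have [st et] := (isvP _ _ _ _).1 ht; have [_ e0] := (isvP _ _ _ _).1 h0.
exists (re_curve (fun z => e *: rprim u3 u2 v3 v2 w2 w3 z)); split.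
  split; first exact: st.
  by exists theta => z Pz; rewrite (et z Pz).1 (e0 z Pz).1.
pose A := rows6 u3 u2 v3 v2 w2 w3; pose W := rows6 a3 a2 b3 b2 c2 c3.
have uA : A \in unitmx by exact: gram_rows_unit (oner_neq0 _) G0.
(* The six coefficients of the model form a basis, so one matrix sends them to those of $x$;
   dividing by $\sqrt l$ makes it isometric. *)
exists r, ((sqrtC l)^-1 *: (invmx A *m W)); split => //.
  apply: isometry_mx => v w; rewrite -!scalemxAr !mulmxA dotZl dotZr.
  have := gram_rows_dot G G0 (v *m invmx A) (w *m invmx A); rewrite -/A -/W mul1r => ->.
  rewrite !mulmxKV//; move: (dot v w) => t.
  have l2 : l = sqrtC l * sqrtC l by rewrite -expr2 sqrtCK.
  by rewrite [in X in _ * (_ * (X * _))]l2; move: (sqrtC l) m0 => m m0; field.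
move=> z Pz; rewrite (xE z Pz) (et z Pz).1 /rphi !comb_rows -/A -/W.
move: (vec6 _ _ _ _ _ _) => v.
rewrite -scalemxAl -scalemxAr !scalerA !mulmxA mulmxK// -/e in mE *.
by rewrite -mE divff// scale1r.
Qed.

(** The coordinates are recovered as $x'=(x-p)B^T$, and multiplication by $B$ preserves the dot
    product, so each condition passes to the coordinates. *)
Lemma affine_special n (x : R[i] -> 'rV[R]_n) m (x' : R[i] -> 'rV[R]_m) :
  affine_coords P x x' -> special_surface x -> special_surface x'.
Proof.
move=> [p [B [BB xE]]] [[sx hm] [u3 [u2 [v3 [v2 [w2 [w3 hf]]]]]] hs hv].
pose C := cplx B.
have CC : C *m C^T = 1%:M by rewrite /C /cplx map_trmx -map_mxM BB map_scalar_mx rmorph1.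
have hx := isv_self sx.
have hp := isv_cst oP (cplx p).
have xE'' z : P z -> cplx p + cmap x' z *m C = cmap x z.
  move=> Pz; rewrite /cmap (xE z Pz); move: (x' z) => v.
  by rewrite /cplx map_mxD map_mxM.
have xE' z : P z -> (cmap x z - cplx p) *m C^T = cmap x' z.
  move=> Pz; rewrite -(xE'' z Pz); move: (cplx p) (cmap x' z) => q v.
  by rewrite [q + _]addrC addrK -mulmxA CC mulmx1.
have h' := isv_ext oP (isv_mulmx oP C^T (isvD oP hx (isvN oP hp))) xE'.
have [sx' ex'] := (isvP _ _ _ _).1 h'.
have hx'' := isvD oP hp (isv_mulmx oP C (isv_self sx')).
have dE (a b : 'rV[R[i]]_m) : dot (a *m C) (b *m C) = dot a b by rewrite dot_mulmx CC mulmx1.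
have h1 := isv_ext oP hx'' xE''.
have z1 z : P z -> vz (cmap x) z = vz (cmap x') z *m C /\ vzb (cmap x) z = vzb (cmap x') z *m C.
  by move=> Pz; have [e1 e2] := isv_uniq hx h1 Pz; exact (conj (etrans e1 (add0r _)) (etrans e2 (add0r _))).
have [s1 _] := isv_smoothz oP (isv_self sx').
have [s0 _] := isv_smoothz oP hx.
have h2 := isv_ext oP (isv_mulmx oP C (isv_self s1)) (fun z Pz => esym (z1 z Pz).1).
have z2 z : P z -> vz (vz (cmap x)) z = vz (vz (cmap x')) z *m C /\ vzb (vz (cmap x)) z = vzb (vz (cmap x')) z *m C.
  by move=> Pz; exact (isv_uniq (isv_self s0) h2 Pz).
have [s2 _] := isv_smoothz oP (isv_self s1).
have [s02 _] := isv_smoothz oP (isv_self s0).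
have h3 := isv_ext oP (isv_mulmx oP C (isv_self s2)) (fun z Pz => esym (z2 z Pz).1).
have z3 z : P z -> vz (vz (vz (cmap x))) z = vz (vz (vz (cmap x'))) z *m C.
  by move=> Pz; exact (isv_uniq (isv_self s02) h3 Pz).1.
have CK m' (v : 'M[R[i]]_(m', m)) : v *m C *m C^T = v by rewrite -mulmxA CC mulmx1.
split.
- split; first exact sx'.
  move=> z Pz; have [f1 f2 f3] := hm z Pz; have [g1 g2] := z1 z Pz; split.
  + rewrite g1 dE in f1; exact f1.
  + rewrite g1 g2 dE in f2; exact f2.
  + by have := congr1 (fun v => v *m C^T) (esym (etrans (esym f3) (z2 z Pz).2)); rewrite CK mul0mx.
- exists (u3 *m C^T), (u2 *m C^T), (v3 *m C^T), (v2 *m C^T), (w2 *m C^T), (w3 *m C^T) => z Pz.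
  have := congr1 (fun v => v *m C^T) (etrans (esym (hf z Pz)) (z1 z Pz).1); rewrite /= CK => <-.
  move: (z ^- 3) (z ^- 2) ((z - 1) ^- 3) ((z - 1) ^- 2) => a b c d.
  by rewrite !mulmxDl -!scalemxAl.
- by move=> z Pz; have := hs z Pz; rewrite (z2 z Pz).1 dE.
by move=> h; apply: hv => z Pz; rewrite (z3 z Pz) dE h.
Qed.

Lemma special_adjoint n (x : R[i] -> 'rV[R]_n) : special_surface x -> has_adjoint_sphere x.
Proof.
move=> h; have [l [u3 [u2 [v3 [v2 [w2 [w3 [l0 G xE]]]]]]]] := special_gram h.
case: h => [[sx _] _ _ _]; exact: gram_adjoint_sphere G l0 sx xE.
Qed.

End Uniqueness.

Theorem proposition8p1 (R : realType) :
  (exists (n : nat) (x : R[i] -> 'rV[R]_n), special_surface x) /\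
  (exists x0 : R[i] -> 'rV[R]_6, special_surface x0 /\
    forall (n : nat) (x : R[i] -> 'rV[R]_n), special_surface x ->
      exists xt : R[i] -> 'rV[R]_6,
        associated (@punctured R) x0 xt /\ congruent (@punctured R) xt x) /\
  (forall (n : nat) (x : R[i] -> 'rV[R]_n), special_surface x ->
    has_adjoint_sphere x /\
    (forall x6 : R[i] -> 'rV[R]_6,
      affine_coords (@punctured R) x x6 -> has_adjoint_sphere x6)).
Proof.
have [u3 [u2 [v3 [v2 [w2 [w3 G]]]]]] := model_gram R.
have s0 := gram_special (oner_neq0 _) G.
split; [|split].
- by exists 6%N, (re_curve (rprim u3 u2 v3 v2 w2 w3)).
- exists (re_curve (rprim u3 u2 v3 v2 w2 w3)); split => // n x sx.
  exact: associated_congruent G sx.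
move=> n x sx; split; first exact: special_adjoint.
by move=> x6 /affine_special/(_ sx)/special_adjoint.
Qed.
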